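(* Let $\ell$ be a field, $E$ a finite graph and $S$ an $\ell$-algebra. Assume that the Leavitt path algebra $L(E)$ over $\ell$ is simple and that $S$ is unital, purely infinite simple and $K_1$-regular. Let $\xi_0:K_0(L(E))\to K_0(S)$ and $\xi_1:\ker(I-A_E^t)\to K_1(S)$ be group homomorphisms, and let $\gamma:\ker(I-A_E^t)\to K_1(L(E))$ be the homomorphism described in the context. Then there exists a nonzero algebra homomorphism $\phi:L(E)\to S$ such that $K_0(\phi)=\xi_0$ and $K_1(\phi)\gamma=\xi_1$. If moreover $\xi_0$ is unital (that is, $\xi_0([1_{L(E)}])=[1_S]$), then $\phi$ can be chosen to be a unital homomorphism $L(E)\to S$.
   Context: Algebras are associative $\ell$-algebras; homomorphisms need not be unital. A graph $E$ is a directed graph with vertex set $E^0$, edge set $E^1$ and source and range maps $s,r:E^1\to E^0$; it is finite if $E^0$ and $E^1$ are. The Leavitt path algebra $L(E)$ is the $\ell$-algebra generated by $E^0\cup E^1\cup\{e^*:e\in E^1\}$ subject to: $vw=\delta_{v,w}v$ for $v,w\in E^0$; $s(e)e=e=er(e)$ and $r(e)e^*=e^*=e^*s(e)$; $e^*f=\delta_{e,f}r(e)$; and $v=\sum_{s(e)=v}ee^*$ for every $v$ with $0<\#s^{-1}(v)<\infty$. It has an involution with $v\mapsto v$, $e\mapsto e^*$; for a matrix $X$ over $L(E)$, $X^*$ is the transpose with $*$ applied to the entries. A unital ring is purely infinite simple iff it is not a division ring and for every nonzero $x$ there are $a,b$ with $axb=1$. $S$ is $K_1$-regular if $K_1(S)\to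 K_1(S[t_1,\dots,t_m])$ is an isomorphism for all $m$. For a nonunital homomorphism $\phi:A\to S$ of unital algebras, $K_i(\phi)$ is the composite $K_i(A)\to K_i(\phi(1)S\phi(1))\to K_i(S)$. $\mathrm{reg}(E)=E^0\setminus\mathrm{sink}(E)$, where $\mathrm{sink}(E)$ is the set of vertices emitting no edges; $A_E\in\mathbb Z^{\mathrm{reg}(E)\times E^0}$, $(A_E)_{v,w}=\#\{e:s(e)=v,r(e)=w\}$; $I\in\mathbb Z^{\mathrm{reg}(E)\times E^0}$ is the identity matrix with rows of sinks removed; $I-A_E^t$ denotes the homomorphism $\mathbb Z^{\mathrm{reg}(E)}\to\mathbb Z^{E^0}$ given by the transpose of $I-A_E$. Definition of $\gamma$. Let $x\in\ker(I-A_E^t)$, and for $e\in E^1$ put $y_e=x_{s(e)}$. Let $\mathcal S=\{(e,j):e\in E^1,\ y_e\neq0,\ 1\le j\le|y_e|\}$. Let $V=V(x)\in M_{\mathcal S}(L(E))$ be the diagonal matrix with $V_{(e,j),(e,j)}=e$ if $y_e>0$ and $=e^*$ if $y_e<0$. Let $DL(E)=\mathrm{span}(\mathrm{sink}(E)\cup\{ee^*:e\in E^1\})\subset L(E)$, which is isomorphic to $\ell^\Lambda$ with $\Lambda=E^1\sqcup\mathrm{sink}(E)$. The idempotents $p=1-VV^*$ and $q=1-V^*V$ lie in $M_{\mathcal S}(DL(E))=\prod_{\alpha\in\Lambda}M_{\mathcal S}(\ell)$; their components $p_\alpha,q_\alpha$ are diagonal $0/1$ matrices with the same number of ones. For each $\alpha$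 choose a matrix $W_\alpha\in p_\alpha M_{\mathcal S}(\ell)q_\alpha$ with entries in $\{0,1\}$ such that $W_\alpha W_\alpha^t=p_\alpha$ and $W_\alpha^tW_\alpha=q_\alpha$, and let $W(x)\in M_{\mathcal S}(DL(E))$ be the matrix with components $W_\alpha$. Then $U(x)=V(x)+W(x)$ is invertible with inverse $U(x)^*$. Fix a basis $\{x_i\}$ of the free abelian group $\ker(I-A_E^t)$ and, for each $x_i$, a choice of matrices $W_\alpha$ ($\alpha\in\Lambda$) defining $W(x_i)$ and hence $U(x_i)=V(x_i)+W(x_i)$; define $\gamma(\sum_in_ix_i)=\sum_in_i[U(x_i)]\in K_1(L(E))$. *)

(* Defs.v *)
From HB Require Import structures.
From mathcomp Require Import mpoly.
From mathcomp Require Import all_boot all_order all_algebra.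
From mathcomp Require Import boolp.

Set Implicit Arguments.
Unset Strict Implicit.
Unset Printing Implicit Defensive.

Import GRing.Theory.
Local Open Scope ring_scope.
Local Open Scope quotient_scope.

(* Homomorphisms need not preserve the unit. *)
Record nuhom (A B : pzRingType) := NUHom {
  nuhom_fun :> {additive A -> B};
  nuhomM : {morph nuhom_fun : x y / x * y} }.

Definition nuhom_of_rmorphism (A B : pzRingType) (f : {rmorphism A -> B}) :
  nuhom A B := @NUHom A B f (rmorphM f).

Lemma map_mx_nuhomM (A B : pzRingType) (f : nuhom A B) m n p
    (X : 'M[A]_(m, n)) (Y : 'M[A]_(n, p)) :
  map_mx f (X *m Y) = map_mx f X *m map_mx f Y.
Proof.
apply/matrixP => i j; rewrite !mxE raddf_sum; apply: eq_bigr => k _.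
by rewrite !mxE nuhomM.
Qed.

Section GroupCompletion.
Variable M : nmodType.
Implicit Types x y z : (M * M)%type.

Definition gc_rel x y : bool := `[< exists t, x.1 + y.2 + t = y.1 + x.2 + t >].

Lemma gc_rel_refl : reflexive gc_rel.
Proof. by move=> x; apply/asboolP; exists 0. Qed.

Lemma gc_rel_sym : symmetric gc_rel.
Proof. by move=> x y; apply/asboolP/asboolP => -[t tP]; exists t. Qed.

Lemma gc_rel_trans : transitive gc_rel.
Proof.
move=> y x z /asboolP[t tP] /asboolP[u uP]; apply/asboolP.
exists (y.2 + t + u + y.1).
transitivity ((x.1 + y.2 + t) + (y.1 + z.2 + u)).
  by rewrite [RHS](AC (3*3) ((1*5)*(((2*3)*6)*4))).
rewrite tP uP.
by rewrite [LHS](AC (3*3) ((4*2)*(((5*3)*6)*1))).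
Qed.

Canonical gc_equiv := EquivRel gc_rel gc_rel_refl gc_rel_sym gc_rel_trans.

Definition groupCompletion := {eq_quot gc_equiv}.

HB.instance Definition _ := Choice.on groupCompletion.

Definition gc_class (x : M * M) : groupCompletion := \pi_({eq_quot gc_equiv}) x.

Lemma gc_classP x y : gc_class x = gc_class y <->
  exists t, x.1 + y.2 + t = y.1 + x.2 + t.
Proof.
by split=> [/eqquotP/asboolP//|xy]; apply/eqquotP/asboolP.
Qed.

Lemma gc_surj (u : groupCompletion) : exists x, u = gc_class x.
Proof. by exists (repr u); rewrite /gc_class reprK. Qed.

Lemma gc_reprP x : exists t,
  (repr (gc_class x)).1 + x.2 + t = x.1 + (repr (gc_class x)).2 + t.
Proof. by apply/gc_classP; rewrite {1}/gc_class reprK. Qed.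

Definition gc_add (u v : groupCompletion) :=
  gc_class ((repr u).1 + (repr v).1, (repr u).2 + (repr v).2).
Definition gc_opp (u : groupCompletion) := gc_class ((repr u).2, (repr u).1).

Lemma gc_addE x y :
  gc_add (gc_class x) (gc_class y) = gc_class (x.1 + y.1, x.2 + y.2).
Proof.
apply/gc_classP => /=; have [t tP] := gc_reprP x; have [s sP] := gc_reprP y.
exists (t + s).
set u := repr _ in tP *; set v := repr _ in sP *.
transitivity ((u.1 + x.2 + t) + (v.1 + y.2 + s)).
  by rewrite [RHS](AC (3*3) (((1*4)*(2*5))*(3*6))).
rewrite tP sP.
by rewrite [LHS](AC (3*3) (((1*4)*(2*5))*(3*6))).
Qed.

Lemma gc_oppE x : gc_opp (gc_class x) = gc_class (x.2, x.1).
Proof.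
apply/gc_classP => /=; have [t tP] := gc_reprP x; exists t.
by rewrite addrC addrC [_.2 + x.1]addrC -tP [x.2 + _]addrC.
Qed.

Fact gc_addA : associative gc_add.
Proof.
move=> u v w; have [x ->] := gc_surj u; have [y ->] := gc_surj v.
by have [z ->] := gc_surj w; rewrite !gc_addE /= !addrA.
Qed.

Fact gc_addC : commutative gc_add.
Proof.
move=> u v; have [x ->] := gc_surj u; have [y ->] := gc_surj v.
by rewrite !gc_addE addrC [x.2 + _]addrC.
Qed.

Fact gc_add0 : left_id (gc_class (0, 0)) gc_add.
Proof.
by move=> u; have [[x y] ->] := gc_surj u; rewrite !gc_addE /= !add0r.
Qed.

Fact gc_addN : left_inverse (gc_class (0, 0)) gc_opp gc_add.
Proof.
move=> u; have [x ->] := gc_surj u; rewrite gc_oppE gc_addE /=.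
by apply/gc_classP; exists 0; rewrite /= !addr0 add0r addrC.
Qed.

HB.instance Definition _ :=
  GRing.isZmodule.Build groupCompletion gc_addA gc_addC gc_add0 gc_addN.

Lemma gc_classD x y :
  gc_class (x.1 + y.1, x.2 + y.2) = gc_class x + gc_class y.
Proof. by rewrite -gc_addE. Qed.

End GroupCompletion.

(* K_0(R) is the group completion of the monoid V(R) of idempotent matrices up
   to Murray-von Neumann equivalence (finitely generated projective modules up
   to isomorphism) under block sum. *)

Record idem (R : pzRingType) := Idem {
  idem_size : nat;
  idem_mx :> 'M[R]_idem_size;
  idemP : idem_mx *m idem_mx = idem_mx }.

HB.instance Definition _ (R : pzRingType) := gen_eqMixin (idem R).
HB.instance Definition _ (R : pzRingType) := gen_choiceMixin (idem R).

Section VMonoid.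
Variable R : pzRingType.
Implicit Types e f g : idem R.

Definition mvn e f : bool :=
  `[< exists a : 'M[R]_(idem_size e, idem_size f),
      exists b : 'M[R]_(idem_size f, idem_size e),
        a *m b = e /\ b *m a = f >].

Lemma mvn_refl : reflexive mvn.
Proof. by move=> e; apply/asboolP; exists e, e; rewrite idemP. Qed.

Lemma mvn_sym : symmetric mvn.
Proof.
by move=> e f; apply/asboolP/asboolP => -[a [b [ab ba]]]; exists b, a.
Qed.

Lemma mvn_trans : transitive mvn.
Proof.
move=> f e g /asboolP[a [b [ab ba]]] /asboolP[c [d [cd dc]]].
apply/asboolP; exists (a *m c), (d *m b); split.
  by rewrite mulmxA -(mulmxA a) cd -ba !mulmxA ab -mulmxA ab idemP.
by rewrite mulmxA -(mulmxA d) ba -cd !mulmxA dc -mulmxA dc idemP.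
Qed.

Canonical mvn_equiv := EquivRel mvn mvn_refl mvn_sym mvn_trans.

Definition Vmon := {eq_quot mvn_equiv}.

HB.instance Definition _ := Choice.on Vmon.

Definition V_class e : Vmon := \pi_({eq_quot mvn_equiv}) e.

Lemma V_classP e f : V_class e = V_class f <-> mvn e f.
Proof. by split=> [/eqquotP|ef]; [|apply/eqquotP]. Qed.

Lemma V_surj (u : Vmon) : exists e, u = V_class e.
Proof. by exists (repr u); rewrite /V_class reprK. Qed.

Lemma dsum_subproof e f :
  block_mx (idem_mx e) 0 0 (idem_mx f) *m block_mx (idem_mx e) 0 0 (idem_mx f)
  = block_mx (idem_mx e) 0 0 (idem_mx f).
Proof. by rewrite mulmx_block !mulmx0 !mul0mx !addr0 !add0r !idemP. Qed.

Definition dsum e f : idem R := Idem (dsum_subproof e f).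

Definition idem0 : idem R := @Idem R 0 0 (mulmx0 _ _).

Lemma mvn_dsum e e' f f' : mvn e e' -> mvn f f' -> mvn (dsum e f) (dsum e' f').
Proof.
move=> /asboolP[a [b [ab ba]]] /asboolP[c [d [cd dc]]]; apply/asboolP.
exists (block_mx a 0 0 c), (block_mx b 0 0 d).
by rewrite !mulmx_block !mulmx0 !mul0mx !addr0 !add0r ab ba cd dc.
Qed.

Lemma dsumC e f : mvn (dsum e f) (dsum f e).
Proof.
apply/asboolP; exists (block_mx 0 (idem_mx e) (idem_mx f) 0).
exists (block_mx 0 (idem_mx f) (idem_mx e) 0).
by rewrite !mulmx_block !mulmx0 !mul0mx !addr0 !add0r !idemP.
Qed.

Lemma mvn_cast n m (enm : n = m) (A : 'M[R]_n) (B : 'M[R]_m)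
    (AA : A *m A = A) (BB : B *m B = B) :
  B = castmx (enm, enm) A -> mvn (Idem AA) (Idem BB).
Proof.
case: m / enm B BB => B BB; rewrite castmx_id => AB; subst B.
by apply/asboolP; exists A, A.
Qed.

Lemma dsumA e f g : mvn (dsum (dsum e f) g) (dsum e (dsum f g)).
Proof.
apply: (mvn_cast (enm := esym (addnA _ _ _))).
have := @block_mxA R _ _ _ _ _ _ (idem_mx e) 0 0 0 (idem_mx f) 0 0 0 (idem_mx g).
by rewrite /= !row_mx0 !col_mx0.
Qed.

Lemma dsum0 e : mvn (dsum idem0 e) e.
Proof.
apply/asboolP; exists (col_mx 0 (idem_mx e)), (row_mx 0 (idem_mx e)).
by rewrite mul_col_row mul_row_col !mulmx0 !mul0mx add0r !idemP.
Qed.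

Definition V_add (u v : Vmon) := V_class (dsum (repr u) (repr v)).

Lemma V_addE e f : V_add (V_class e) (V_class f) = V_class (dsum e f).
Proof.
by apply/V_classP/mvn_dsum; apply/V_classP; rewrite {1}/V_class reprK.
Qed.

Fact V_addA : associative V_add.
Proof.
move=> u v w; have [e ->] := V_surj u; have [f ->] := V_surj v.
have [g ->] := V_surj w; rewrite !V_addE; apply/V_classP.
by rewrite mvn_sym dsumA.
Qed.

Fact V_addC : commutative V_add.
Proof.
move=> u v; have [e ->] := V_surj u; have [f ->] := V_surj v.
by rewrite !V_addE; apply/V_classP/dsumC.
Qed.

Fact V_add0 : left_id (V_class idem0) V_add.
Proof.
by move=> u; have [e ->] := V_surj u; rewrite V_addE; apply/V_classP/dsum0.
Qed.

HB.instance Definition _ := GRing.isNmodule.Build Vmon V_addA V_addC V_add0.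

Lemma V_classD e f : V_class (dsum e f) = V_class e + V_class f.
Proof. by rewrite -V_addE. Qed.

Definition K0 := groupCompletion Vmon.

HB.instance Definition _ := GRing.Zmodule.on K0.

Definition K0_class e : K0 := gc_class (V_class e, 0).

Definition K0_unit : K0 := K0_class (@Idem R 1 1%:M (mul1mx _)).

End VMonoid.

Section K0Map.
Variables (A B : pzRingType) (f : nuhom A B).

Lemma idem_map_subproof (e : idem A) :
  map_mx f (idem_mx e) *m map_mx f (idem_mx e) = map_mx f (idem_mx e).
Proof. by rewrite -map_mx_nuhomM idemP. Qed.

Definition idem_map (e : idem A) : idem B := Idem (idem_map_subproof e).

Definition V_map (u : Vmon A) : Vmon B := V_class (idem_map (repr u)).

Lemma V_mapE e : V_map (V_class e) = V_class (idem_map e).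
Proof.
have /V_classP/asboolP[a [b [ab ba]]] : V_class (repr (V_class e)) = V_class e.
  by rewrite {1}/V_class reprK.
apply/V_classP/asboolP; exists (map_mx f a), (map_mx f b).
by rewrite -!map_mx_nuhomM ab ba.
Qed.

Lemma V_map_is_nmod_morphism : nmod_morphism V_map.
Proof.
split=> [|u v].
  rewrite (V_mapE (idem0 A)); apply/V_classP/asboolP.
  by exists 0, 0; split; apply/matrixP => [[]].
have [e ->] := V_surj u; have [g ->] := V_surj v.
rewrite -V_classD !V_mapE -V_classD; apply/V_classP.
apply: (mvn_cast (enm := erefl)).
by rewrite castmx_id map_block_mx !map_mx0.
Qed.

HB.instance Definition _ :=
  GRing.isNmodMorphism.Build (Vmon A) (Vmon B) V_map V_map_is_nmod_morphism.

(* The composite K_0(A) -> K_0(f(1)Bf(1)) -> K_0(B): both arrows send the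
   class of an idempotent matrix to the class of its entrywise image. *)
Definition K0_map (u : K0 A) : K0 B :=
  gc_class (V_map (repr u).1, V_map (repr u).2).

Lemma K0_mapE (x : Vmon A * Vmon A) :
  K0_map (gc_class x) = gc_class (V_map x.1, V_map x.2).
Proof.
have [t tP] := gc_reprP x; apply/gc_classP; exists (V_map t) => /=.
by rewrite -!raddfD tP.
Qed.

Lemma K0_map_class e : K0_map (K0_class e) = K0_class (idem_map e).
Proof. by rewrite K0_mapE /= raddf0 V_mapE. Qed.

Lemma K0_map_is_zmod_morphism : zmod_morphism K0_map.
Proof.
move=> u v; have [x ->] := gc_surj u; have [y ->] := gc_surj v.
rewrite [- gc_class y]gc_oppE [- _ in RHS](_ : _ = gc_class (V_map y.2, V_map y.1)).
  by rewrite -gc_classD !K0_mapE /= -gc_classD /= !raddfD.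
by rewrite K0_mapE [LHS]gc_oppE.
Qed.

HB.instance Definition _ :=
  GRing.isZmodMorphism.Build (K0 A) (K0 B) K0_map K0_map_is_zmod_morphism.

End K0Map.

(* K_1(R) = GL(R) / [GL(R), GL(R)]: an element of GL(R) is represented by an
   invertible n x n matrix, and two of them are identified when, after
   stabilization to a common size N, their quotient is in [GL_N(R), GL_N(R)]. *)

Record glelt (R : pzRingType) := GLElt {
  gl_size : nat;
  gl_mx :> 'M[R]_gl_size;
  gl_inv : 'M[R]_gl_size;
  gl_mulV : gl_mx *m gl_inv = 1%:M;
  gl_Vmul : gl_inv *m gl_mx = 1%:M }.

HB.instance Definition _ (R : pzRingType) := gen_eqMixin (glelt R).
HB.instance Definition _ (R : pzRingType) := gen_choiceMixin (glelt R).

Section K1.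
Variable R : pzRingType.
Implicit Types x y z : glelt R.

(* The matrix A (+) 1_(N - n), when n <= N. *)
Definition stab N n (A : 'M[R]_n) : 'M[R]_N :=
  pid_mx n *m A *m pid_mx n + copid_mx n.

Lemma stabM N n (A B : 'M[R]_n) :
  (n <= N)%N -> stab N (A *m B) = stab N A *m stab N B.
Proof.
move=> nN; rewrite /stab mulmxDl mulmxDr (mulmxDr (copid_mx n)) copid_mx_id //.
rewrite (mulmxA (copid_mx n)) (mulmxA (copid_mx n)) mul_copid_mx_pid //.
rewrite !mul0mx add0r -[_ *m pid_mx n *m copid_mx n]mulmxA.
rewrite mul_pid_mx_copid // mulmx0 addr0 !mulmxA.
by rewrite -(mulmxA (_ *m A) (pid_mx n)) pid_mx_id // pid_mx_1 mulmx1.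
Qed.

Lemma stab1 N n : (n <= N)%N -> stab N (1%:M : 'M[R]_n) = 1%:M.
Proof. by move=> nN; rewrite /stab mulmx1 pid_mx_id // /copid_mx addrC subrK. Qed.

Lemma stab_id n (A : 'M[R]_n) : stab n A = A.
Proof. by rewrite /stab /copid_mx pid_mx_1 mul1mx mulmx1 subrr addr0. Qed.

Lemma stab_stab N m n (A : 'M[R]_n) :
  (n <= m)%N -> (m <= N)%N -> stab N (stab m A) = stab N A.
Proof.
move=> nm mN; rewrite /stab mulmxDr mulmxDl !mulmxA !mul_pid_mx.
rewrite -(mulmxA _ (pid_mx n)) mul_pid_mx.
rewrite (minn_idPl nm) !(minn_idPr nm) -addrA; congr (_ + _).
rewrite /copid_mx mulmxBr mulmxBl mulmx1 !mul_pid_mx !minnn.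
rewrite (minn_idPr nm) (minn_idPr nm) (minn_idPl nm) (minn_idPr nm).
by rewrite addrC addrA subrK.
Qed.

(* [GL_n(R), GL_n(R)]; inverses are omitted since the inverse of a commutator
   is a commutator. *)
Inductive GLder n : 'M[R]_n -> Prop :=
| GLder1 : GLder 1%:M
| GLder_comm A A' B B' C :
    A *m A' = 1%:M -> A' *m A = 1%:M -> B *m B' = 1%:M -> B' *m B = 1%:M ->
    GLder C -> GLder (A *m B *m A' *m B' *m C).

Lemma GLderM n (P Q : 'M[R]_n) : GLder P -> GLder Q -> GLder (P *m Q).
Proof.
move=> dP dQ; elim: dP => [|A A' B B' C *]; first by rewrite mul1mx.
by rewrite -mulmxA; apply: GLder_comm.
Qed.

Lemma GLder_comm1 n (A A' B B' : 'M[R]_n) :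
    A *m A' = 1%:M -> A' *m A = 1%:M -> B *m B' = 1%:M -> B' *m B = 1%:M ->
  GLder (A *m B *m A' *m B').
Proof.
by move=> *; rewrite -[_ *m _]mulmx1; apply: GLder_comm => //; apply: GLder1.
Qed.

Lemma GLderV n (P Q : 'M[R]_n) : GLder P -> P *m Q = 1%:M -> GLder Q.
Proof.
move=> dP; elim: dP Q => [Q|A A' B B' C AA' A'A BB' B'B _ IH Q].
  by rewrite mul1mx => ->; apply: GLder1.
rewrite -mulmxA => PQ.
have -> : Q = (Q *m (A *m B *m A' *m B')) *m (B *m A *m B' *m A').
  rewrite -[LHS]mulmx1 -mulmxA; congr (_ *m _).
  by rewrite !mulmxA -(mulmxA _ B' B) B'B mulmx1 -(mulmxA _ A' A) A'A mulmx1
     -(mulmxA _ B B') BB' mulmx1 AA'.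
apply: GLderM; last exact: GLder_comm1.
apply: IH; rewrite mulmxA.
have VP : B *m A *m B' *m A' *m (A *m B *m A' *m B') = 1%:M.
  by rewrite !mulmxA -(mulmxA _ A' A) A'A mulmx1 -(mulmxA _ B' B) B'B mulmx1
     -(mulmxA _ A A') AA' mulmx1 BB'.
have -> : C *m Q = B *m A *m B' *m A'.
  by rewrite -[LHS]mul1mx -VP -mulmxA PQ mulmx1.
exact: VP.
Qed.

Lemma GLder_conj n (A A' P : 'M[R]_n) :
  A *m A' = 1%:M -> A' *m A = 1%:M -> GLder P -> GLder (A *m P *m A').
Proof.
move=> AA' A'A; elim=> [|X X' Y Y' C XX' X'X YY' Y'Y _ IH].
  by rewrite mulmx1 AA'; apply: GLder1.
have conjM (Z T : 'M[R]_n) : A *m (Z *m T) *m A' = A *m Z *m A' *m (A *m T *m A').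
  by rewrite !mulmxA -(mulmxA _ A') A'A mulmx1.
rewrite !conjM; apply: GLder_comm => //;
  by rewrite -conjM ?XX' ?X'X ?YY' ?Y'Y mulmx1.
Qed.

Lemma GLder_stab N n (P : 'M[R]_n) : (n <= N)%N -> GLder P -> GLder (stab N P).
Proof.
move=> nN; elim=> [|X X' Y Y' C XX' X'X YY' Y'Y _ IH].
  by rewrite stab1 //; apply: GLder1.
by rewrite !stabM //; apply: GLder_comm; rewrite -?stabM ?XX' ?X'X ?YY' ?Y'Y ?stab1.
Qed.

Definition gl_rel x y : bool :=
  `[< exists N, [/\ (gl_size x <= N)%N, (gl_size y <= N)%N
                 & GLder (stab N (gl_mx x) *m stab N (gl_inv y))] >].

Lemma stab_mulV N x : (gl_size x <= N)%N ->
  stab N (gl_mx x) *m stab N (gl_inv x) = 1%:M.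
Proof. by move=> xN; rewrite -stabM // gl_mulV stab1. Qed.

Lemma stab_Vmul N x : (gl_size x <= N)%N ->
  stab N (gl_inv x) *m stab N (gl_mx x) = 1%:M.
Proof. by move=> xN; rewrite -stabM // gl_Vmul stab1. Qed.

Lemma gl_relP x y : gl_rel x y -> exists2 N0, (gl_size x <= N0 /\ gl_size y <= N0)%N
  & forall N, (N0 <= N)%N -> GLder (stab N (gl_mx x) *m stab N (gl_inv y)).
Proof.
case/asboolP=> N0 [xN yN d]; exists N0 => // N NN.
by have := GLder_stab NN d; rewrite stabM // !stab_stab.
Qed.

Lemma gl_rel_stab N x y : (gl_size x <= N)%N -> (gl_size y <= N)%N ->
  stab N (gl_mx x) = stab N (gl_mx y) -> gl_rel x y.
Proof.
move=> xN yN xy; apply/asboolP; exists N; split=> //.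
by rewrite xy stab_mulV //; apply: GLder1.
Qed.

Lemma gl_rel_refl : reflexive gl_rel.
Proof. by move=> x; apply: (@gl_rel_stab (gl_size x)). Qed.

Lemma gl_rel_sym1 x y : gl_rel x y -> gl_rel y x.
Proof.
case/asboolP=> N [xN yN d]; apply/asboolP; exists N; split=> //.
apply: (GLderV d).
by rewrite mulmxA -(mulmxA _ (stab N (gl_inv y))) stab_Vmul // mulmx1 stab_mulV.
Qed.

Lemma gl_rel_sym : symmetric gl_rel.
Proof. by move=> x y; apply/idP/idP; apply: gl_rel_sym1. Qed.

Lemma gl_rel_trans : transitive gl_rel.
Proof.
move=> y x z /gl_relP[N1 [xN yN] d1] /gl_relP[N2 [yN2 zN] d2].
pose N := maxn N1 N2; have N1N : (N1 <= N)%N by rewrite leq_maxl.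
have N2N : (N2 <= N)%N by rewrite leq_maxr.
apply/asboolP; exists N; split; [exact: leq_trans N1N|exact: leq_trans N2N|].
have := GLderM (d1 _ N1N) (d2 _ N2N).
rewrite mulmxA -(mulmxA _ (stab N (gl_inv y))) stab_Vmul ?mulmx1 //.
exact: leq_trans N1N.
Qed.

Canonical gl_equiv := EquivRel gl_rel gl_rel_refl gl_rel_sym gl_rel_trans.

Definition K1 := {eq_quot gl_equiv}.

HB.instance Definition _ := Choice.on K1.

Definition K1_class x : K1 := \pi_({eq_quot gl_equiv}) x.

Lemma K1_classP x y : K1_class x = K1_class y <-> gl_rel x y.
Proof. by split=> [/eqquotP|xy]; [|apply/eqquotP]. Qed.

Lemma K1_surj (u : K1) : exists x, u = K1_class x.
Proof. by exists (repr u); rewrite /K1_class reprK. Qed.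

Section Mul.
Variables x y : glelt R.
Let N := maxn (gl_size x) (gl_size y).

Lemma gl_mul_mulV :
  stab N (gl_mx x) *m stab N (gl_mx y) *m (stab N (gl_inv y) *m stab N (gl_inv x))
  = 1%:M.
Proof.
rewrite mulmxA -(mulmxA _ (stab N (gl_mx y))) stab_mulV ?leq_maxr //.
by rewrite mulmx1 stab_mulV ?leq_maxl.
Qed.

Lemma gl_mul_Vmul :
  stab N (gl_inv y) *m stab N (gl_inv x) *m (stab N (gl_mx x) *m stab N (gl_mx y))
  = 1%:M.
Proof.
rewrite mulmxA -(mulmxA _ (stab N (gl_inv x))) stab_Vmul ?leq_maxl //.
by rewrite mulmx1 stab_Vmul ?leq_maxr.
Qed.

Definition gl_mul : glelt R := GLElt gl_mul_mulV gl_mul_Vmul.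

End Mul.

Definition gl_one : glelt R :=
  @GLElt R 0 1%:M 1%:M (mulmx1 _) (mulmx1 _).
Definition gl_opp x : glelt R := GLElt (gl_Vmul x) (gl_mulV x).

Lemma stab_mul N x y : (gl_size x <= N)%N -> (gl_size y <= N)%N ->
  stab N (gl_mx (gl_mul x y)) = stab N (gl_mx x) *m stab N (gl_mx y).
Proof.
move=> xN yN; rewrite stabM ?geq_max ?xN // !stab_stab ?leq_maxl ?leq_maxr //;
by rewrite geq_max xN.
Qed.

Lemma stab_mulI N x y : (gl_size x <= N)%N -> (gl_size y <= N)%N ->
  stab N (gl_inv (gl_mul x y)) = stab N (gl_inv y) *m stab N (gl_inv x).
Proof.
move=> xN yN; rewrite stabM ?geq_max ?xN // !stab_stab ?leq_maxl ?leq_maxr //;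
by rewrite geq_max xN.
Qed.

Lemma gl_mul_rel x x' y y' :
  gl_rel x x' -> gl_rel y y' -> gl_rel (gl_mul x y) (gl_mul x' y').
Proof.
move=> /gl_relP[N1 [xN xN'] d1] /gl_relP[N2 [yN yN'] d2].
pose N := maxn N1 N2; have N1N : (N1 <= N)%N by rewrite leq_maxl.
have N2N : (N2 <= N)%N by rewrite leq_maxr.
have {}xN := leq_trans xN N1N; have {}xN' := leq_trans xN' N1N.
have {}yN := leq_trans yN N2N; have {}yN' := leq_trans yN' N2N.
apply/asboolP; exists N; split; rewrite ?geq_max ?xN ?xN' //.
rewrite stab_mul // stab_mulI // .
have -> : stab N (gl_mx x) *m stab N (gl_mx y) *m
    (stab N (gl_inv y') *m stab N (gl_inv x')) =
  (stab N (gl_mx x) *m (stab N (gl_mx y) *m stab N (gl_inv y')) *m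
   stab N (gl_inv x)) *m (stab N (gl_mx x) *m stab N (gl_inv x')).
  by rewrite !mulmxA -(mulmxA _ (stab N (gl_inv x))) stab_Vmul // mulmx1.
apply: GLderM; last exact: d1.
by apply: GLder_conj; [exact: stab_mulV|exact: stab_Vmul|exact: d2].
Qed.

Definition K1_add (u v : K1) := K1_class (gl_mul (repr u) (repr v)).
Definition K1_opp (u : K1) := K1_class (gl_opp (repr u)).

Lemma gl_repr x : gl_rel (repr (K1_class x)) x.
Proof. by apply/K1_classP; rewrite {1}/K1_class reprK. Qed.

Lemma K1_addE x y : K1_add (K1_class x) (K1_class y) = K1_class (gl_mul x y).
Proof. by apply/K1_classP/gl_mul_rel; apply: gl_repr. Qed.

Fact K1_addA : associative K1_add.
Proof.
move=> u v w; have [x ->] := K1_surj u; have [y ->] := K1_surj v.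
have [z ->] := K1_surj w; rewrite !K1_addE; apply/K1_classP.
pose N := maxn (gl_size x) (maxn (gl_size y) (gl_size z)).
have xN : (gl_size x <= N)%N by rewrite leq_maxl.
have yN : (gl_size y <= N)%N by rewrite !leq_max leqnn orbT.
have zN : (gl_size z <= N)%N by rewrite !leq_max leqnn !orbT.
by apply: (@gl_rel_stab N); rewrite ?geq_max ?xN ?yN // !stab_mul ?geq_max ?xN ?yN //
  mulmxA.
Qed.

Fact K1_addC : commutative K1_add.
Proof.
move=> u v; have [x ->] := K1_surj u; have [y ->] := K1_surj v.
rewrite !K1_addE; apply/K1_classP/asboolP.
pose N := maxn (gl_size x) (gl_size y).
have xN : (gl_size x <= N)%N by rewrite leq_maxl.
have yN : (gl_size y <= N)%N by rewrite leq_maxr.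
exists N; split; rewrite ?geq_max ?xN ?yN //.
rewrite stab_mul // stab_mulI // mulmxA.
by apply: GLder_comm1; rewrite ?stab_mulV ?stab_Vmul.
Qed.

Fact K1_add0 : left_id (K1_class gl_one) K1_add.
Proof.
move=> u; have [x ->] := K1_surj u; rewrite K1_addE; apply/K1_classP.
apply: (@gl_rel_stab (gl_size x)); rewrite ?geq_max ?leqnn //.
by rewrite stab_mul // stab1 // mul1mx.
Qed.

Fact K1_addN : left_inverse (K1_class gl_one) K1_opp K1_add.
Proof.
move=> u; rewrite -[u in K1_add _ u]reprK [K1_add _ _]K1_addE; apply/K1_classP.
apply: (@gl_rel_stab (gl_size (repr u))); rewrite ?geq_max ?leqnn //.
by rewrite stab_mul //= stab_Vmul // stab1.
Qed.

HB.instance Definition _ :=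
  GRing.isZmodule.Build K1 K1_addA K1_addC K1_add0 K1_addN.

Lemma K1_classM x y : K1_class (gl_mul x y) = K1_class x + K1_class y.
Proof. by rewrite -K1_addE. Qed.

End K1.

Section K1Map.
Variables (A B : pzRingType) (f : nuhom A B).

(* K1_map is the composite K_1(A) -> K_1(f(1)Bf(1)) -> K_1(B): the image f(X)
   of an invertible matrix is invertible over the corner f(1)Bf(1), and adding
   (1 - f(1)) I_n is the map GL_n(f(1)Bf(1)) -> GL_n(B). *)
Definition gl_ext n (X : 'M[A]_n) : 'M[B]_n := map_mx f X + (1 - f 1)%:M.

Lemma map_mx_nuhom1 m n r :
  map_mx f (pid_mx r : 'M[A]_(m, n)) = (f 1)%:M *m (pid_mx r : 'M[B]_(m, n)).
Proof.
apply/matrixP => i j; rewrite mul_scalar_mx !mxE.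
by case: (_ && _); rewrite ?mulr1 ?mulr0 ?raddf0.
Qed.

Lemma map_mx_nuhom1r m n r :
  map_mx f (pid_mx r : 'M[A]_(m, n)) = (pid_mx r : 'M[B]_(m, n)) *m (f 1)%:M.
Proof.
rewrite map_mx_nuhom1; apply/matrixP => i j.
rewrite mul_scalar_mx !mxE (bigD1 j) //= big1 => [|k kj].
  by rewrite !mxE eqxx mulr1n addr0; case: (_ && _); rewrite ?mulr1 ?mul1r ?mulr0 ?mul0r.
by rewrite !mxE (negPf kj) mulr0n mulr0.
Qed.

Lemma map_mx_scalar1 n : map_mx f (1%:M : 'M[A]_n) = (f 1)%:M.
Proof. by apply/matrixP => i j; rewrite !mxE raddfMn. Qed.

Lemma gl_extM n (X Y : 'M[A]_n) : gl_ext (X *m Y) = gl_ext X *m gl_ext Y.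
Proof.
have fr (Z : 'M[A]_n) : map_mx f Z *m (1 - f 1)%:M = 0.
  rewrite [(1 - f 1)%:M]raddfB /= mulmxBr mulmx1 -map_mx_scalar1 -map_mx_nuhomM.
  by rewrite mulmx1 subrr.
have fl (Z : 'M[A]_n) : (1 - f 1)%:M *m map_mx f Z = 0.
  rewrite [(1 - f 1)%:M]raddfB /= mulmxBl mul1mx -map_mx_scalar1 -map_mx_nuhomM.
  by rewrite mul1mx subrr.
rewrite /gl_ext mulmxDl !mulmxDr fr fl addr0 add0r -map_mx_nuhomM.
congr (_ + _); rewrite -scalar_mxM mulrBl mul1r mulrBr mulr1.
by rewrite -nuhomM mulr1 subrr subr0.
Qed.

Lemma gl_ext1 n : gl_ext (1%:M : 'M[A]_n) = 1%:M.
Proof. by rewrite /gl_ext map_mx_scalar1 -raddfD /= addrC subrK. Qed.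

Lemma gl_ext_stab N n (X : 'M[A]_n) : (n <= N)%N ->
  gl_ext (stab N X) = stab N (gl_ext X).
Proof.
move=> nN; rewrite /gl_ext /stab map_mxD mulmxDr mulmxDl.
have -> : map_mx f (pid_mx n *m X *m pid_mx n : 'M[A]_N) =
          pid_mx n *m map_mx f X *m pid_mx n.
  rewrite !map_mx_nuhomM map_mx_nuhom1r map_mx_nuhom1 !mulmxA.
  rewrite -(mulmxA (pid_mx n)) -map_mx_scalar1 -map_mx_nuhomM mul1mx.
  by rewrite -(mulmxA (pid_mx n)) -map_mx_nuhomM mulmx1.
rewrite -!addrA; congr (_ + _).
have sB k : ((1 - f 1)%:M : 'M[B]_k) = 1%:M - (f 1)%:M by rewrite raddfB.
rewrite !sB mulmxBr mulmxBl mulmx1 pid_mx_id // -map_mx_nuhom1r map_mx_nuhom1.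
rewrite -mulmxA pid_mx_id // /copid_mx map_mxB map_mx_scalar1 map_mx_nuhom1.
by rewrite addrC addrA subrK [RHS]addrC addrA subrK.
Qed.

Lemma gl_map_mulV (x : glelt A) : gl_ext (gl_mx x) *m gl_ext (gl_inv x) = 1%:M.
Proof. by rewrite -gl_extM gl_mulV gl_ext1. Qed.

Lemma gl_map_Vmul (x : glelt A) : gl_ext (gl_inv x) *m gl_ext (gl_mx x) = 1%:M.
Proof. by rewrite -gl_extM gl_Vmul gl_ext1. Qed.

Definition gl_map (x : glelt A) : glelt B := GLElt (gl_map_mulV x) (gl_map_Vmul x).

Lemma GLder_ext n (X : 'M[A]_n) : GLder X -> GLder (gl_ext X).
Proof.
elim=> [|Y Y' Z Z' C YY' Y'Y ZZ' Z'Z _ IH]; first by rewrite gl_ext1; apply: GLder1.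
by rewrite !gl_extM; apply: GLder_comm; rewrite -?gl_extM ?YY' ?Y'Y ?ZZ' ?Z'Z ?gl_ext1.
Qed.

Lemma gl_map_rel x y : gl_rel x y -> gl_rel (gl_map x) (gl_map y).
Proof.
case/asboolP=> N [xN yN d]; apply/asboolP; exists N; split=> //=.
by rewrite -!gl_ext_stab // -gl_extM; apply: GLder_ext.
Qed.

Definition K1_map (u : K1 A) : K1 B := K1_class (gl_map (repr u)).

Lemma K1_map_class x : K1_map (K1_class x) = K1_class (gl_map x).
Proof. by apply/K1_classP/gl_map_rel; apply: gl_repr. Qed.

Lemma K1_mapD u v : K1_map (u + v) = K1_map u + K1_map v.
Proof.
have [x ->] := K1_surj u; have [y ->] := K1_surj v.
rewrite -K1_classM !K1_map_class -K1_classM; apply/K1_classP.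
pose N := maxn (gl_size x) (gl_size y).
have xN : (gl_size x <= N)%N by rewrite leq_maxl.
have yN : (gl_size y <= N)%N by rewrite leq_maxr.
apply: (@gl_rel_stab _ N); rewrite ?geq_max ?xN ?yN //.
by rewrite stab_mul // -gl_ext_stab ?geq_max ?xN // stab_mul // gl_extM !gl_ext_stab.
Qed.

Lemma K1_map_is_zmod_morphism : zmod_morphism K1_map.
Proof. by move=> u v; apply: (addIr (K1_map v)); rewrite -K1_mapD !subrK. Qed.

HB.instance Definition _ :=
  GRing.isZmodMorphism.Build (K1 A) (K1 B) K1_map K1_map_is_zmod_morphism.

End K1Map.

Definition simple_ring (R : pzRingType) : Prop :=
  (1 : R) <> 0 /\
  forall J : R -> Prop,
    J 0 -> (forall x y, J x -> J y -> J (x + y)) ->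
    (forall a x, J x -> J (a * x) /\ J (x * a)) ->
    (forall x, J x -> x = 0) \/ (forall x, J x).

Definition division_ring (R : nzRingType) : Prop :=
  forall x : R, x != 0 -> exists y, x * y = 1 /\ y * x = 1.

Definition purely_infinite_simple (R : nzRingType) : Prop :=
  ~ division_ring R /\
  forall x : R, x != 0 -> exists a b, a * x * b = 1.

Definition K1_regular (R : nzRingType) : Prop :=
  forall m : nat, bijective (K1_map (nuhom_of_rmorphism (@mpolyC m R))).

Record graph := Graph {
  vert : finType;
  edge : finType;
  source : edge -> vert;
  range : edge -> vert }.

Arguments source {g}.
Arguments range {g}.

Definition is_reg (E : graph) (v : vert E) : bool := [exists e : edge E, source e == v].

Notation reg E := {v : vert E | is_reg v}.
Notation sink E := {v : vert E | ~~ is_reg v}.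

Section Leavitt.
Variables (F : fieldType) (E : graph).

(* L(E) is the quotient of the set of non-unital algebra expressions in the
   generators by the congruence generated by the F-algebra axioms and the
   defining relations. *)
Inductive lterm :=
| LVert of vert E
| LEdge of edge E
| LGhost of edge E
| LZero
| LOpp of lterm
| LAdd of lterm & lterm
| LScale of F & lterm
| LMul of lterm & lterm.

Inductive lcong : lterm -> lterm -> Prop :=
| lc_refl x : lcong x x
| lc_sym x y : lcong x y -> lcong y x
| lc_trans x y z : lcong x y -> lcong y z -> lcong x z
| lc_opp x y : lcong x y -> lcong (LOpp x) (LOpp y)
| lc_add x x' y y' : lcong x x' -> lcong y y' -> lcong (LAdd x y) (LAdd x' y')
| lc_scale c x y : lcong x y -> lcong (LScale c x) (LScale c y)
| lc_mul x x' y y' : lcong x x' -> lcong y y' -> lcong (LMul x y) (LMul x' y')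
| lc_addA x y z : lcong (LAdd x (LAdd y z)) (LAdd (LAdd x y) z)
| lc_addC x y : lcong (LAdd x y) (LAdd y x)
| lc_add0 x : lcong (LAdd LZero x) x
| lc_addN x : lcong (LAdd (LOpp x) x) LZero
| lc_scaleA a b x : lcong (LScale a (LScale b x)) (LScale (a * b) x)
| lc_scale1 x : lcong (LScale 1 x) x
| lc_scaleDr a x y : lcong (LScale a (LAdd x y)) (LAdd (LScale a x) (LScale a y))
| lc_scaleDl a b x : lcong (LScale (a + b) x) (LAdd (LScale a x) (LScale b x))
| lc_mulA x y z : lcong (LMul x (LMul y z)) (LMul (LMul x y) z)
| lc_mulDl x y z : lcong (LMul (LAdd x y) z) (LAdd (LMul x z) (LMul y z))
| lc_mulDr x y z : lcong (LMul x (LAdd y z)) (LAdd (LMul x y) (LMul x z))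
| lc_scaleAl a x y : lcong (LScale a (LMul x y)) (LMul (LScale a x) y)
| lc_scaleAr a x y : lcong (LScale a (LMul x y)) (LMul x (LScale a y))
| lc_vert v w :
    lcong (LMul (LVert v) (LVert w)) (if v == w then LVert v else LZero)
| lc_source_edge e : lcong (LMul (LVert (source e)) (LEdge e)) (LEdge e)
| lc_edge_range e : lcong (LMul (LEdge e) (LVert (range e))) (LEdge e)
| lc_range_ghost e : lcong (LMul (LVert (range e)) (LGhost e)) (LGhost e)
| lc_ghost_source e : lcong (LMul (LGhost e) (LVert (source e))) (LGhost e)
| lc_CK1 e f :
    lcong (LMul (LGhost e) (LEdge f)) (if e == f then LVert (range e) else LZero)
| lc_CK2 v : is_reg v ->
    lcong (LVert v)
      (\big[LAdd/LZero]_(e : edge E | source e == v) LMul (LEdge e) (LGhost e)).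

HB.instance Definition _ := gen_eqMixin lterm.
HB.instance Definition _ := gen_choiceMixin lterm.

Definition lrel (x y : lterm) : bool := `[< lcong x y >].

Lemma lrel_refl : reflexive lrel.
Proof. by move=> x; apply/asboolP/lc_refl. Qed.
Lemma lrel_sym : symmetric lrel.
Proof. by move=> x y; apply/asboolP/asboolP => /lc_sym. Qed.
Lemma lrel_trans : transitive lrel.
Proof.
by move=> y x z /asboolP xy /asboolP yz; apply/asboolP/(lc_trans xy yz).
Qed.

Canonical lequiv := EquivRel lrel lrel_refl lrel_sym lrel_trans.

Definition leavitt := {eq_quot lequiv}.

HB.instance Definition _ := Choice.on leavitt.

Definition lpi (x : lterm) : leavitt := \pi_({eq_quot lequiv}) x.

Lemma lpiP x y : lpi x = lpi y <-> lcong x y.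
Proof. by split=> [/eqquotP/asboolP|xy]; [|apply/eqquotP/asboolP]. Qed.

Lemma lpi_eq x y : lcong x y -> lpi x = lpi y.
Proof. by move/lpiP. Qed.

Lemma lpiK u : lpi (repr u) = u.
Proof. by rewrite /lpi reprK. Qed.

Lemma lrepr x : lcong (repr (lpi x)) x.
Proof. by apply/lpiP; rewrite lpiK. Qed.

Lemma lpiW (P : leavitt -> Prop) : (forall x, P (lpi x)) -> forall u, P u.
Proof. by move=> Pl u; rewrite -[u]lpiK. Qed.

Definition ladd (u v : leavitt) := lpi (LAdd (repr u) (repr v)).
Definition lopp (u : leavitt) := lpi (LOpp (repr u)).
Definition lmul (u v : leavitt) := lpi (LMul (repr u) (repr v)).
Definition lscale (c : F) (u : leavitt) := lpi (LScale c (repr u)).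

Lemma laddE x y : ladd (lpi x) (lpi y) = lpi (LAdd x y).
Proof. by apply/lpiP/lc_add; apply: lrepr. Qed.
Lemma loppE x : lopp (lpi x) = lpi (LOpp x).
Proof. by apply/lpiP/lc_opp; apply: lrepr. Qed.
Lemma lmulE x y : lmul (lpi x) (lpi y) = lpi (LMul x y).
Proof. by apply/lpiP/lc_mul; apply: lrepr. Qed.
Lemma lscaleE c x : lscale c (lpi x) = lpi (LScale c x).
Proof. by apply/lpiP/lc_scale; apply: lrepr. Qed.

Fact laddA : associative ladd.
Proof.
elim/lpiW=> x; elim/lpiW=> y; elim/lpiW=> z; rewrite !laddE.
exact/lpiP/lc_addA.
Qed.
Fact laddC : commutative ladd.
Proof. by elim/lpiW=> x; elim/lpiW=> y; rewrite !laddE; apply/lpiP/lc_addC. Qed.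
Fact ladd0 : left_id (lpi LZero) ladd.
Proof. by elim/lpiW=> x; rewrite laddE; apply/lpiP/lc_add0. Qed.
Fact laddN : left_inverse (lpi LZero) lopp ladd.
Proof. by elim/lpiW=> x; rewrite loppE laddE; apply/lpiP/lc_addN. Qed.

HB.instance Definition _ :=
  GRing.isZmodule.Build leavitt laddA laddC ladd0 laddN.

Lemma lpi0 : lpi LZero = 0. Proof. by []. Qed.
Lemma lpiN x : lpi (LOpp x) = - lpi x. Proof. by rewrite -loppE. Qed.
Lemma lpiD x y : lpi (LAdd x y) = lpi x + lpi y.
Proof. by rewrite -laddE. Qed.

Lemma lpi_sum (I : Type) (r : seq I) (P : pred I) (G : I -> lterm) :
  lpi (\big[LAdd/LZero]_(i <- r | P i) G i) = \sum_(i <- r | P i) lpi (G i).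
Proof. exact: (big_morph lpi lpiD lpi0). Qed.

Fact lscaleA a b v : lscale a (lscale b v) = lscale (a * b) v.
Proof. by elim/lpiW: v => x; rewrite !lscaleE; apply/lpiP/lc_scaleA. Qed.
Fact lscale1 : left_id 1 lscale.
Proof. by elim/lpiW=> x; rewrite lscaleE; apply/lpiP/lc_scale1. Qed.
Fact lscaleDr : right_distributive lscale +%R.
Proof.
move=> a; elim/lpiW=> x; elim/lpiW=> y.
by rewrite -lpiD !lscaleE -lpiD; apply/lpiP/lc_scaleDr.
Qed.
Fact lscaleDl v : {morph lscale^~ v : a b / a + b}.
Proof.
by elim/lpiW: v => x a b; rewrite /= !lscaleE -lpiD; apply/lpiP/lc_scaleDl.
Qed.

HB.instance Definition _ := GRing.Zmodule_isLmodule.Build F leavitt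
  lscaleA lscale1 lscaleDr lscaleDl.

Definition lvert (v : vert E) : leavitt := lpi (LVert v).
Definition ledge (e : edge E) : leavitt := lpi (LEdge e).
Definition lghost (e : edge E) : leavitt := lpi (LGhost e).

(* E has finitely many vertices, so the sum of all of them is a unit. *)
Definition lone : leavitt := \sum_(v : vert E) lvert v.

Fact lmulA : associative lmul.
Proof.
elim/lpiW=> x; elim/lpiW=> y; elim/lpiW=> z; rewrite !lmulE.
exact/lpiP/lc_mulA.
Qed.
Fact lmulDl : left_distributive lmul +%R.
Proof.
elim/lpiW=> x; elim/lpiW=> y; elim/lpiW=> z.
by rewrite -lpiD !lmulE -lpiD; apply/lpiP/lc_mulDl.
Qed.
Fact lmulDr : right_distributive lmul +%R.
Proof.
elim/lpiW=> x; elim/lpiW=> y; elim/lpiW=> z.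
by rewrite -lpiD !lmulE -lpiD; apply/lpiP/lc_mulDr.
Qed.
Lemma lmul0 u : lmul 0 u = 0.
Proof. by apply: (addIr (lmul 0 u)); rewrite -lmulDl !add0r. Qed.
Lemma lmulr0 u : lmul u 0 = 0.
Proof. by apply: (addIr (lmul u 0)); rewrite -lmulDr !add0r. Qed.
Lemma lscaleAl a u v : a *: lmul u v = lmul (a *: u) v.
Proof.
elim/lpiW: u => x; elim/lpiW: v => y.
by rewrite [a *: lpi x]lscaleE !lmulE [LHS]lscaleE; apply/lpiP/lc_scaleAl.
Qed.
Lemma lscaleAr a u v : a *: lmul u v = lmul u (a *: v).
Proof.
elim/lpiW: u => x; elim/lpiW: v => y.
by rewrite [a *: lpi y]lscaleE !lmulE [LHS]lscaleE; apply/lpiP/lc_scaleAr.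
Qed.

Lemma lvertM v w : lmul (lvert v) (lvert w) = if v == w then lvert v else 0.
Proof. by rewrite lmulE (lpi_eq (lc_vert v w)); case: ifP. Qed.

Lemma lone_vl v : lmul lone (lvert v) = lvert v.
Proof.
rewrite (big_morph (fun x => lmul x (lvert v)) (fun x y => lmulDl x y _) (lmul0 _)).
rewrite (bigD1 v) //= lvertM eqxx big1 ?addr0 // => w wv.
by rewrite lvertM (negPf wv).
Qed.

Lemma lone_vr v : lmul (lvert v) lone = lvert v.
Proof.
rewrite (big_morph (lmul (lvert v)) (lmulDr _) (lmulr0 _)).
rewrite (bigD1 v) //= lvertM eqxx big1 ?addr0 // => w wv.
by rewrite lvertM eq_sym (negPf wv).
Qed.

Lemma loppM x : lpi (LOpp x) = (-1) *: lpi x.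
Proof. by rewrite lpiN scaleN1r. Qed.

Fact lmul1 : left_id lone lmul.
Proof.
elim/lpiW; elim=> [v|e|e||x IH|x IH y IH'|c x IH|x IH y _].
- exact: lone_vl.
- by rewrite -(lpi_eq (lc_source_edge e)) -lmulE lmulA lone_vl.
- by rewrite -(lpi_eq (lc_range_ghost e)) -lmulE lmulA lone_vl.
- exact: lmulr0.
- by rewrite loppM -lscaleAr IH.
- by rewrite lpiD lmulDr IH IH'.
- by rewrite -lscaleE -lscaleAr IH.
- by rewrite -lmulE lmulA IH.
Qed.

Fact lmulr1 : right_id lone lmul.
Proof.
elim/lpiW; elim=> [v|e|e||x IH|x IH y IH'|c x IH|x _ y IH].
- exact: lone_vr.
- by rewrite -(lpi_eq (lc_edge_range e)) -lmulE -lmulA lone_vr.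
- by rewrite -(lpi_eq (lc_ghost_source e)) -lmulE -lmulA lone_vr.
- exact: lmul0.
- by rewrite loppM -lscaleAl IH.
- by rewrite lpiD lmulDl IH IH'.
- by rewrite -lscaleE -lscaleAl IH.
- by rewrite -lmulE -lmulA IH.
Qed.

HB.instance Definition _ := GRing.Zmodule_isPzRing.Build leavitt
  lmulA lmul1 lmulr1 lmulDl lmulDr.

Lemma lpiM x y : lpi (LMul x y) = lpi x * lpi y.
Proof. by rewrite -lmulE. Qed.
Lemma lpiZ c x : lpi (LScale c x) = c *: lpi x.
Proof. by rewrite -lscaleE. Qed.

(* The library's algType requires 1 != 0, which fails when E has no vertex;
   leavitt is a pzRingType and an lmodType F, with these compatibilities. *)
Lemma leavitt_scalerAl c (u v : leavitt) : c *: (u * v) = (c *: u) * v.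
Proof. exact: lscaleAl. Qed.
Lemma leavitt_scalerAr c (u v : leavitt) : c *: (u * v) = u * (c *: v).
Proof. exact: lscaleAr. Qed.

Lemma lvert_mul v w : lvert v * lvert w = if v == w then lvert v else 0.
Proof. exact: lvertM. Qed.
Lemma lsource_edge e : lvert (source e) * ledge e = ledge e.
Proof. by rewrite -lpiM (lpi_eq (lc_source_edge e)). Qed.
Lemma ledge_range e : ledge e * lvert (range e) = ledge e.
Proof. by rewrite -lpiM (lpi_eq (lc_edge_range e)). Qed.
Lemma lrange_ghost e : lvert (range e) * lghost e = lghost e.
Proof. by rewrite -lpiM (lpi_eq (lc_range_ghost e)). Qed.
Lemma lghost_source e : lghost e * lvert (source e) = lghost e.
Proof. by rewrite -lpiM (lpi_eq (lc_ghost_source e)). Qed.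
Lemma lghost_edge e f : lghost e * ledge f = if e == f then lvert (range e) else 0.
Proof. by rewrite -lpiM (lpi_eq (lc_CK1 e f)); case: ifP. Qed.
Lemma lvert_CK2 v : is_reg v ->
  lvert v = \sum_(e : edge E | source e == v) ledge e * lghost e.
Proof.
move=> /lc_CK2/lpi_eq; rewrite lpi_sum /lvert => ->.
by apply: eq_bigr => e _; rewrite lpiM.
Qed.

Fixpoint tstar (x : lterm) : lterm :=
  match x with
  | LVert v => LVert v
  | LEdge e => LGhost e
  | LGhost e => LEdge e
  | LZero => LZero
  | LOpp x => LOpp (tstar x)
  | LAdd x y => LAdd (tstar x) (tstar y)
  | LScale c x => LScale c (tstar x)
  | LMul x y => LMul (tstar y) (tstar x)
  end.

Lemma tstar_cong x y : lcong x y -> lcong (tstar x) (tstar y).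
Proof.
elim=> /=; try by [constructor | move=> *; apply: lc_sym; constructor].
- by move=> ? ? ? _ IH _ IH'; exact: lc_trans IH IH'.
- move=> v w; rewrite (fun_if tstar) /=; move: (lc_vert w v).
  by rewrite [w == v]eq_sym; case: eqP => [->|].
- move=> e f; rewrite (fun_if tstar) /=; move: (lc_CK1 f e).
  by rewrite [f == e]eq_sym; case: eqP => [->|].
- move=> v rv; have := lc_CK2 rv.
  by rewrite (big_morph tstar (id1 := LZero) (op1 := LAdd)).
Qed.

Definition lstar (u : leavitt) : leavitt := lpi (tstar (repr u)).

Lemma lstarE x : lstar (lpi x) = lpi (tstar x).
Proof. by apply/lpiP/tstar_cong/lrepr. Qed.

Lemma lstarK : involutive lstar.
Proof.
have tK x : tstar (tstar x) = x by elim: x => //= *; congruence.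
by elim/lpiW=> x; rewrite !lstarE tK.
Qed.

Lemma lstarD u v : lstar (u + v) = lstar u + lstar v.
Proof. by elim/lpiW: u => x; elim/lpiW: v => y; rewrite -lpiD !lstarE /= lpiD. Qed.

Lemma lstar_is_zmod_morphism : zmod_morphism lstar.
Proof. by move=> u v; apply: (addIr (lstar v)); rewrite -lstarD !subrK. Qed.

HB.instance Definition _ :=
  GRing.isZmodMorphism.Build leavitt leavitt lstar lstar_is_zmod_morphism.

Lemma lstarM u v : lstar (u * v) = lstar v * lstar u.
Proof. by elim/lpiW: u => x; elim/lpiW: v => y; rewrite -lpiM !lstarE /= lpiM. Qed.

Lemma lstarZ c u : lstar (c *: u) = c *: lstar u.
Proof. by elim/lpiW: u => x; rewrite -lpiZ !lstarE /= lpiZ. Qed.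

Lemma lstar_vert v : lstar (lvert v) = lvert v. Proof. exact: lstarE. Qed.
Lemma lstar_edge e : lstar (ledge e) = lghost e. Proof. exact: lstarE. Qed.
Lemma lstar_ghost e : lstar (lghost e) = ledge e. Proof. exact: lstarE. Qed.

Definition mxstar m n (X : 'M[leavitt]_(m, n)) : 'M[leavitt]_(n, m) :=
  (map_mx lstar X)^T.

Lemma mxstarK m n : cancel (@mxstar m n) (@mxstar n m).
Proof. by move=> X; apply/matrixP => i j; rewrite !mxE lstarK. Qed.

Lemma mxstarD m n (X Y : 'M[leavitt]_(m, n)) : mxstar (X + Y) = mxstar X + mxstar Y.
Proof. by apply/matrixP => i j; rewrite !mxE raddfD. Qed.

Lemma mxstarM m n p (X : 'M[leavitt]_(m, n)) (Y : 'M[leavitt]_(n, p)) :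
  mxstar (X *m Y) = mxstar Y *m mxstar X.
Proof.
apply/matrixP => i j; rewrite !mxE raddf_sum /=; apply: eq_bigr => k _.
by rewrite !mxE lstarM.
Qed.

(* The basis of idempotents of DL(E) realizing DL(E) = F^(dl_index). *)
Definition dl_index : finType := (edge E + sink E)%type.

Definition dl_idem (a : dl_index) : leavitt :=
  match a with
  | inl e => ledge e * lghost e
  | inr v => lvert (val v)
  end.

Lemma dl_idemM a c : dl_idem a * dl_idem c = if a == c then dl_idem a else 0.
Proof.
have sE (v : sink E) (e : edge E) : lvert (val v) * ledge e = 0.
  rewrite -lsource_edge mulrA lvert_mul; case: eqP; last by rewrite mul0r.
  by move=> vs; case/existsP: (valP v); exists e; rewrite vs.
have gS (v : sink E) (e : edge E) : lghost e * lvert (val v) = 0.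
  by rewrite -[LHS]lstarK lstarM lstar_ghost lstar_vert sE [LHS]raddf0.
case: a c => [e|v] [f|w] /=.
- rewrite mulrA -(mulrA (ledge e)) lghost_edge; case: eqP => [<-|ef].
    by rewrite eqxx ledge_range.
  by rewrite mulr0 mul0r; case: eqP => // -[].
- by rewrite -mulrA gS mulr0.
- by rewrite mulrA sE mul0r.
- by rewrite lvert_mul; case: eqP => [/val_inj->|vw]; rewrite ?eqxx //;
    case: eqP => // -[vw']; rewrite vw' in vw.
Qed.

Lemma lstar_dl_idem a : lstar (dl_idem a) = dl_idem a.
Proof.
by case: a => [e|v]; rewrite /= ?lstarM ?lstar_edge ?lstar_ghost ?lstar_vert.
Qed.

(* The element of M_n(DL(E)), inside M_n(L(E)), with the given components in
   the product of the M_n(F) over the index set of dl_idem. *)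
Definition dl_mx n (X : dl_index -> 'M[F]_n) : 'M[leavitt]_n :=
  \matrix_(i, j) \sum_a X a i j *: dl_idem a.

Lemma eq_dl_mx n (X Y : dl_index -> 'M[F]_n) : X =1 Y -> dl_mx X = dl_mx Y.
Proof.
by move=> XY; apply/matrixP => i j; rewrite !mxE; apply: eq_bigr => a _; rewrite XY.
Qed.

Lemma dl_mxM n (X Y : dl_index -> 'M[F]_n) :
  dl_mx X *m dl_mx Y = dl_mx (fun a => X a *m Y a).
Proof.
apply/matrixP => i j; rewrite !mxE.
transitivity (\sum_k \sum_a (X a i k * Y a k j) *: dl_idem a).
  apply: eq_bigr => k _; rewrite !mxE mulr_suml; apply: eq_bigr => a _.
  rewrite mulr_sumr (bigD1 a) //= big1 => [|c ca].
    by rewrite -leavitt_scalerAl -leavitt_scalerAr dl_idemM eqxx scalerA addr0.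
  rewrite -leavitt_scalerAl -leavitt_scalerAr dl_idemM eq_sym (negPf ca).
  by rewrite !scaler0.
by rewrite exchange_big; apply: eq_bigr => a _; rewrite mxE scaler_suml.
Qed.

Lemma mxstar_dl n (X : dl_index -> 'M[F]_n) :
  mxstar (dl_mx X) = dl_mx (fun a => (X a)^T).
Proof.
apply/matrixP => i j; rewrite !mxE raddf_sum; apply: eq_bigr => a _.
by rewrite mxE /= lstarZ lstar_dl_idem.
Qed.

End Leavitt.

Section Kernel.
Variable E : graph.

Definition adj (v : reg E) (w : vert E) : int :=
  #|[set e : edge E | (source e == val v) && (range e == w)]|%:Z.

(* The matrix I; IAt is the transpose of I - A_E acting on columns. *)
Definition incl (v : reg E) (w : vert E) : int := (val v == w)%:Z.

Definition IAt (x : {ffun reg E -> int}) : {ffun vert E -> int} :=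
  [ffun w => \sum_v (incl v w - adj v w) * x v].

Definition ker_pred : {pred {ffun reg E -> int}} := fun x => IAt x == 0.

Lemma ker_pred_closed : zmod_closed ker_pred.
Proof.
have IAtB x y : IAt (x - y) = IAt x - IAt y.
  apply/ffunP => w; rewrite !ffunE -sumrB; apply: eq_bigr => v _.
  by rewrite !ffunE mulrBr.
split=> [|x y]; rewrite /in_mem /= /ker_pred.
  by rewrite -(subrr (0 : {ffun reg E -> int})) IAtB subrr.
by move=> /eqP x0 /eqP y0; rewrite IAtB x0 y0 subrr.
Qed.

HB.instance Definition _ :=
  GRing.isZmodClosed.Build {ffun reg E -> int} ker_pred ker_pred_closed.

Record kerIAt := KerIAt {
  ker_val :> {ffun reg E -> int};
  _ : ker_val \in ker_pred }.

HB.instance Definition _ := [isSub for ker_val].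
HB.instance Definition _ := [Choice of kerIAt by <:].
HB.instance Definition _ := [SubChoice_isSubZmodule of kerIAt by <:].

Lemma source_reg_subproof (e : edge E) : is_reg (source e).
Proof. by apply/existsP; exists e. Qed.

Definition source_reg (e : edge E) : reg E := Sub (source e) (source_reg_subproof e).

(* y_e = x_(s(e)), and Sidx x = {(e, j) : y_e != 0, 1 <= j <= |y_e|}, with j
   shifted to start at 0. *)
Definition ycoef (x : kerIAt) (e : edge E) : int := x (source_reg e).

Definition Sidx (x : kerIAt) : finType := {e : edge E & 'I_(absz (ycoef x e))}.

End Kernel.

Section Gamma.
Variables (F : fieldType) (E : graph).
Local Notation L := (leavitt F E).

Section OneKernelElement.
Variable x : kerIAt E.
Local Notation N := #|Sidx x|.

(* Matrices over Sidx x are indexed through its enumeration. *)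
Definition Vdiag (i : 'I_N) : L :=
  let e := tag (enum_val i) in if 0 < ycoef x e then ledge F e else lghost F e.

Definition Vmx : 'M[L]_N := \matrix_(i, j) if i == j then Vdiag i else 0.

Definition pmx : 'M[L]_N := 1%:M - Vmx *m mxstar Vmx.
Definition qmx : 'M[L]_N := 1%:M - mxstar Vmx *m Vmx.

(* A choice of the W_a: W_p and W_q are forced, being the components of p and q
   in the product of the matrix algebras over F. *)
Record Wchoice := {
  W_p : dl_index E -> 'M[F]_N;
  W_q : dl_index E -> 'M[F]_N;
  W_pE : pmx = dl_mx W_p;
  W_qE : qmx = dl_mx W_q;
  W_comp : dl_index E -> 'M[F]_N;
  W_01 : forall a i j, W_comp a i j \in [:: 0; 1];
  W_pq : forall a, W_p a *m W_comp a *m W_q a = W_comp a;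
  W_mul_tr : forall a, W_comp a *m (W_comp a)^T = W_p a;
  W_tr_mul : forall a, (W_comp a)^T *m W_comp a = W_q a }.

Variable W : Wchoice.

Definition Wmx : 'M[L]_N := dl_mx (W_comp W).
Definition Umx : 'M[L]_N := Vmx + Wmx.

Lemma mxstarV_entry i j : mxstar Vmx i j = if i == j then lstar (Vdiag i) else 0.
Proof. by rewrite !mxE eq_sym; case: eqP => [->|]; rewrite ?raddf0. Qed.

Lemma Vdiag_star i : Vdiag i * lstar (Vdiag i) * Vdiag i = Vdiag i.
Proof.
rewrite /Vdiag; case: ifP => _.
  by rewrite lstar_edge -mulrA lghost_edge eqxx ledge_range.
by rewrite lstar_ghost lghost_edge eqxx lrange_ghost.
Qed.

Lemma VVstarV : Vmx *m mxstar Vmx *m Vmx = Vmx.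
Proof.
apply/matrixP => i j; rewrite mxE (bigD1 j) //= big1 => [|k kj].
  rewrite mxE (bigD1 j) //= big1 => [|k kj].
    rewrite mxstarV_entry !mxE !eqxx !addr0; case: eqP => [->|_].
      by rewrite Vdiag_star.
    by rewrite !mul0r.
  by rewrite mxstarV_entry (negPf kj) mulr0.
by rewrite [Vmx k j]mxE (negPf kj) mulr0.
Qed.

Lemma VstarVVstar : mxstar Vmx *m Vmx *m mxstar Vmx = mxstar Vmx.
Proof. by rewrite -[in RHS]VVstarV !mxstarM mxstarK mulmxA. Qed.

Lemma Wmx_pq : pmx *m Wmx *m qmx = Wmx.
Proof.
rewrite (W_pE W) (W_qE W) !dl_mxM; apply: eq_dl_mx => a; exact: W_pq.
Qed.

Lemma WVstar : Wmx *m mxstar Vmx = 0.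
Proof.
have qV : qmx *m mxstar Vmx = 0 by rewrite mulmxBl mul1mx VstarVVstar subrr.
by rewrite -Wmx_pq -mulmxA qV mulmx0.
Qed.

Lemma VstarW : mxstar Vmx *m Wmx = 0.
Proof.
have Vp : mxstar Vmx *m pmx = 0 by rewrite mulmxBr mulmx1 mulmxA VstarVVstar subrr.
by rewrite -Wmx_pq !mulmxA Vp !mul0mx.
Qed.

Lemma Umx_mulV : Umx *m mxstar Umx = 1%:M.
Proof.
rewrite mxstarD mulmxDl !mulmxDr WVstar add0r.
have -> : Vmx *m mxstar Wmx = 0.
  by rewrite -[Vmx]mxstarK -mxstarM WVstar; apply/matrixP => i j; rewrite !mxE raddf0.
rewrite addr0 mxstar_dl dl_mxM (eq_dl_mx (W_mul_tr W)) -W_pE /pmx.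
by rewrite addrC subrK.
Qed.

Lemma Umx_Vmul : mxstar Umx *m Umx = 1%:M.
Proof.
rewrite mxstarD mulmxDl !mulmxDr VstarW addr0.
have -> : mxstar Wmx *m Vmx = 0.
  by rewrite -[Vmx]mxstarK -mxstarM VstarW; apply/matrixP => i j; rewrite !mxE raddf0.
rewrite add0r mxstar_dl dl_mxM (eq_dl_mx (W_tr_mul W)) -W_qE /qmx.
by rewrite addrC subrK.
Qed.

Definition Uclass : K1 L := K1_class (GLElt Umx_mulV Umx_Vmul).

End OneKernelElement.

End Gamma.

Record zbasis (I : finType) (M : zmodType) := ZBasis {
  zb_vec :> I -> M;
  zb_coord : M -> I -> int;
  zb_coordK : forall x, \sum_i zb_vec i *~ zb_coord x i = x;
  zb_vecK : forall (n : I -> int) i, zb_coord (\sum_j zb_vec j *~ n j) i = n i }.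

Definition gamma (F : fieldType) (E : graph) (I : finType)
    (b : zbasis I (kerIAt E)) (W : forall i, Wchoice F (b i)) (x : kerIAt E) :
  K1 (leavitt F E) := \sum_i Uclass (W i) *~ zb_coord b x i.

Lemma gamma_is_zmod_morphism (F : fieldType) (E : graph) (I : finType)
    (b : zbasis I (kerIAt E)) (W : forall i, Wchoice F (b i)) :
  zmod_morphism (gamma W).
Proof.
have coordB x y i : zb_coord b (x - y) i = zb_coord b x i - zb_coord b y i.
  rewrite -{1}(zb_coordK b x) -{1}(zb_coordK b y) -sumrB.
  rewrite -[RHS](zb_vecK b (fun k => zb_coord b x k - zb_coord b y k)).
  by congr zb_coord; apply: eq_bigr => j _; rewrite mulrzBr.
by move=> x y; rewrite /gamma -sumrB; apply: eq_bigr => i _; rewrite coordB mulrzBr.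
Qed.

HB.instance Definition _ (F : fieldType) (E : graph) (I : finType)
    (b : zbasis I (kerIAt E)) (W : forall i, Wchoice F (b i)) :=
  GRing.isZmodMorphism.Build (kerIAt E) (K1 (leavitt F E)) (gamma W)
    (gamma_is_zmod_morphism W).

(* Main.v *)
From HB Require Import structures.
Require Import Defs.
From mathcomp Require Import mpoly.
From mathcomp Require Import all_boot all_order all_algebra.
From mathcomp Require Import boolp ring.

Set Implicit Arguments.
Unset Strict Implicit.
Unset Printing Implicit Defensive.

Import GRing.Theory.
Local Open Scope ring_scope.

(* Since S is purely infinite simple, the nonzero elements of V(S) form a group
   isomorphic to K_0(S), and every class of K_1(S) is the class of a unit of any
   given nonzero corner pSp. As V(L(E)) is generated by the vertices, realizing
   xi_0 amounts to choosing orthogonal idempotents p_v of S with the prescribed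
   classes; the relation [v] = sum_(s(e) = v) [r(e)] then provides the images of
   the edges. Multiplying the image of each edge e on the left by a unit u_e of the
   corner of its range projection, and the image of the ghost edge on the right by
   u_e^-1, keeps K_0(phi) and adds sum_e y_e [u_e] to K_1(phi)[U(x)]. Since
   ker(I - A_E^t) is a direct summand of Z^reg(E), the u_e can be chosen so as to
   reach xi_1.

   V(L(E)) is generated by the vertices because the image of an idempotent matrix
   is, as a right L(E)-module, generated by vectors of linear combinations of paths
   (multiply on the right by edges until no ghost edge is left); subtracting multiples
   as in a Groebner basis computation, their leading monomials become prefix-free, and
   such vectors are independent, so that the module is a direct sum of modules v L(E). *)

(** * Idempotents and K_0 *)

(** The data on K_0 are equalities in a group completion, while edges need actual equivalences of
    idempotents. Over [S] the passage back is possible only between nonzero classes, which is why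
    every chosen idempotent is nonzero and why a regular vertex must have a nonempty sum over its
    edges. The twist fixes the images of the vertices and of every ee^*, hence the image of W(x).
    Since V(x)^* annihilates W(x) on both sides, the units pass through W(x), and the image of U(x)
    changes exactly by two diagonal factors, whatever W(x) was chosen. Only the defect of a first
    homomorphism on K_1 then has to be corrected. For modules over L(E) the difficulty is to know
    that paths are linearly independent: a quotient by a congruence only provides equalities. An
    explicit representation separates the paths. Ghost edges are harmless on the right because v is
    the sum of ee^* at a regular vertex, so an element is recovered from its products with edges. *)

Lemma diag_mx_recl (R : pzRingType) n (a : 'I_(1 + n) -> R) :
  diag_mx (\row_i a i) = block_mx (a ord0)%:M 0 0 (diag_mx (\row_i a (lift ord0 i))).
Proof.
rewrite -[\row_i a i]hsubmxK diag_mx_row; congr block_mx.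
  apply/matrixP => i j; rewrite !ord1 !mxE eqxx !mulr1n; congr a.
  exact: val_inj.
by congr diag_mx; apply/rowP => i; rewrite !mxE; congr a; apply: val_inj.
Qed.

(** * Monoids whose nonzero elements form a group *)

Section AbsorbingMonoid.
Variable M : nmodType.
Hypothesis conical : forall x y : M, x + y = 0 -> x = 0.
Hypothesis absorbing : forall a b : M, b <> 0 -> exists2 c, c <> 0 & b = a + c.

(** Absorbing [b] into itself gives [b = b + z]; every nonzero [x] is [b] plus something, so the
    same [z] is neutral for it. *)
Lemma absorbing_neutral (b : M) : b <> 0 ->
  exists2 z, z <> 0 & forall x : M, x <> 0 -> x + z = x.
Proof.
move=> b0; have [z z0 bz] := absorbing b b0; exists z => // x x0.
by have [c _ ->] := absorbing b x0; rewrite addrAC -bz.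
Qed.

(** The neutral element can be written [t + x + c], so adding [x + c] to both sides cancels [t]. *)
Lemma absorbing_addIr (x y t : M) : x <> 0 -> y <> 0 -> x + t = y + t -> x = y.
Proof.
move=> x0 y0 xyt; have [z z0 zN] := absorbing_neutral x0.
have tx0 : t + x <> 0 by rewrite addrC => /conical.
have [c _ zc] := absorbing (t + x) z0.
by rewrite -(zN _ x0) -(zN _ y0) zc !addrA xyt.
Qed.

(** Writing the neutral element as [y + c] turns the formal difference of [x] and [y] into the class
    of [x + c]. *)
Lemma absorbing_gc_surj (b : M) : b <> 0 ->
  forall u : groupCompletion M, exists2 x, x <> 0 & u = gc_class (x, 0).
Proof.
move=> b0 u; have [[x y] ->] := gc_surj u.
have [z z0 zN] := absorbing_neutral b0.
have [c c0 zc] := absorbing y z0.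
exists (x + c); first by rewrite addrC => /conical.
by apply/gc_classP; exists z; rewrite /= addr0 -(addrA x) (addrC c) -zc -addrA (zN _ z0).
Qed.

End AbsorbingMonoid.

(** * Splitting idempotents along sums of classes *)

Section Vclasses.
Variable R : pzRingType.

Lemma V_class_mvn m n (e : 'M[R]_m) (f : 'M[R]_n) a b ee ff :
  a *m b = e -> b *m a = f -> V_class (@Idem R m e ee) = V_class (@Idem R n f ff).
Proof. by move=> ab ba; apply/V_classP/asboolP; exists a, b. Qed.

Lemma V_class_irr n (e f : 'M[R]_n) ee ff :
  e = f -> V_class (@Idem R n e ee) = V_class (@Idem R n f ff).
Proof. by move=> ef; apply: (V_class_mvn (a := e) (b := e)); rewrite ee. Qed.

Lemma V_class_eq0 (e : idem R) : V_class e = 0 <-> idem_mx e = 0.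
Proof.
split=> [/V_classP/asboolP[a [b [<- _]]]|e0].
  by apply/matrixP => i j; rewrite !mxE big_ord0.
by apply/V_classP/asboolP; exists 0, 0; rewrite e0 mulmx0; split=> //; apply/matrixP => [[]].
Qed.

Lemma V_conical (u v : Vmon R) : u + v = 0 -> u = 0.
Proof.
have [e ->] := V_surj u; have [f ->] := V_surj v; rewrite -V_classD.
by rewrite !V_class_eq0 /= => /(congr1 ulsubmx); rewrite block_mxKul => ->; apply/matrixP => i j; rewrite !mxE.
Qed.

Lemma V_class_orth n (e f g : 'M[R]_n) ee ff gg :
  e *m f = 0 -> f *m e = 0 -> g = e + f ->
  V_class (@Idem R n g gg) = V_class (@Idem R n e ee) + V_class (@Idem R n f ff).
Proof.
move=> ef fe gE; rewrite -V_classD.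
apply: (V_class_mvn (a := row_mx e f) (b := col_mx e f)).
  by rewrite mul_row_col ee ff gE.
by rewrite mul_col_row ee ff ef fe.
Qed.

Lemma idem1_subproof (p : R) : p * p = p -> p%:M *m p%:M = p%:M :> 'M_1.
Proof. by move=> pp; rewrite -scalar_mxM pp. Qed.

Definition idem1 (p : R) (pp : p * p = p) : idem R := Idem (idem1_subproof pp).

(** The blocks of an equivalence between [e] and diag(q, f) identify [q] and [f] with two orthogonal
    idempotents that add up to [e]. *)
Lemma V_class_split n k (e : 'M[R]_n) ee (q : 'M[R]_k) qq (f : idem R) :
    V_class (@Idem R n e ee) = V_class (@Idem R k q qq) + V_class f ->
  exists (X : 'M_(n, k)) (Y : 'M_(k, n)) (e' : 'M_n) (ee' : e' *m e' = e'),
    [/\ Y *m X = q, e *m X = X /\ X *m q = X, q *m Y = Y /\ Y *m e = Y,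
        e' = e - X *m Y & V_class (Idem ee') = V_class f].
Proof.
rewrite -V_classD => /V_classP/asboolP /= [a [b [ab ba]]].
pose g := block_mx q 0 0 f; have gg : g *m g = g.
  by rewrite mulmx_block !mulmx0 !mul0mx !addr0 !add0r qq idemP.
(* Compression by [e] and [g] keeps both products and makes the factors absorb the idempotents; the
   corner identities of the blocks are read off from this. *)
pose a' : 'M_(n, k + idem_size f) := e *m a *m g.
pose b' : 'M_(k + idem_size f, n) := g *m b *m e.
have ea : e *m a' = a' by rewrite /a' !mulmxA ee.
have ag : a' *m g = a' by rewrite /a' -!mulmxA gg.
have gb : g *m b' = b' by rewrite /b' !mulmxA gg.
have be : b' *m e = b' by rewrite /b' -!mulmxA ee.
have ab' : a' *m b' = e.
  have -> : a' *m b' = e *m (a *m (g *m g) *m b) *m e by rewrite !mulmxA.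
  by rewrite gg /g -ba !mulmxA -(mulmxA _ a b) ab -(mulmxA _ a b) ab !ee.
have ba' : b' *m a' = g.
  have -> : b' *m a' = g *m (b *m (e *m e) *m a) *m g by rewrite !mulmxA.
  have beE : b *m e = g *m b by rewrite -ab mulmxA ba.
  by rewrite ee beE -(mulmxA g b a) ba !gg.
clearbody a' b'.
rewrite -(hsubmxK a') -(vsubmxK b') in ea ag gb be ab' ba'.
set X := lsubmx a' in ea ag gb be ab' ba'; set A := rsubmx a' in ea ag gb be ab' ba'.
set Y := usubmx b' in ea ag gb be ab' ba'; set B := dsubmx b' in ea ag gb be ab' ba'.
move: ea ag; rewrite mul_mx_row mul_row_block !mulmx0 addr0 add0r.
move=> /eq_row_mx[eX eA] /eq_row_mx[Xq Af].
move: gb be; rewrite mul_col_mx mul_block_col !mul0mx addr0 add0r.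
move=> /eq_col_mx[qY fB] /eq_col_mx[Ye Be].
move: ba' ab'; rewrite mul_col_row mul_row_col => /eq_block_mx[YX YA BX BA] XYAB.
have ee' : (A *m B) *m (A *m B) = A *m B.
  by rewrite mulmxA -(mulmxA A) BA Af.
exists X, Y, (A *m B), ee'; split=> //; first by rewrite -XYAB addrC addKr.
by apply/V_classP/asboolP; exists A, B.
Qed.

Lemma V_class_split1 (p : R) pp (q : R) qq (f : idem R) :
    V_class (@idem1 p pp) = V_class (@idem1 q qq) + V_class f ->
  exists (x y p' : R) (pp' : p' * p' = p'),
    [/\ y * x = q, p * x = x /\ x * q = x, q * y = y /\ y * p = y,
        p' = p - x * y & V_class (idem1 pp') = V_class f].
Proof.
case/V_class_split=> X [Y [e' [ee' []]]].
rewrite [X]mx11_scalar [Y]mx11_scalar; set x := X 0 0; set y := Y 0 0.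
have sI : injective (@scalar_mx R 1).
  by move=> a b /matrixP/(_ 0 0); rewrite !mxE eqxx !mulr1n.
rewrite -!scalar_mxM -raddfB /= => /sI yx [/sI px /sI xq] [/sI qy /sI yp] eE Ve.
have pp' : (p - x * y) * (p - x * y) = p - x * y.
  by apply: sI; rewrite scalar_mxM -eE.
exists x, y, (p - x * y), pp'; split=> //.
by rewrite -Ve; apply: V_class_irr; rewrite eE.
Qed.

(** One idempotent is split off at a time. The later ones lie below the remainder [p1], and
    [y0 * p1 = 0 = p1 * x0] gives the orthogonality. *)
Lemma V_class_split_seq (T : eqType) (s : seq T) (q : T -> R)
    (qq : forall t, q t * q t = q t) (p : R) pp (f : idem R) : uniq s ->
    V_class (@idem1 p pp) = \sum_(t <- s) V_class (idem1 (qq t)) + V_class f ->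
  exists (x y : T -> R) (p' : R) (pp' : p' * p' = p'),
    [/\ {in s &, forall t u, y t * x u = if t == u then q t else 0},
        {in s, forall t, p * x t = x t /\ x t * q t = x t},
        {in s, forall t, q t * y t = y t /\ y t * p = y t},
        p' = p - \sum_(t <- s) x t * y t & V_class (idem1 pp') = V_class f].
Proof.
elim: s p pp => [|t s IH] p pp /=.
  rewrite big_nil add0r => _ pf; exists (fun=> 0), (fun=> 0), p, pp.
  by split=> //; rewrite big_nil subr0.
case/andP=> ts us; rewrite big_cons -addrA.
have [g gE] := V_surj (\sum_(u <- s) V_class (idem1 (qq u)) + V_class f).
rewrite gE => /V_class_split1[x0 [y0 [p1 [pp1 [yx [px xq] [qy yp] p1E p1g]]]]].
have pp1' : p * p1 = p1 by rewrite p1E mulrBr mulrA px pp.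
have p1p : p1 * p = p1 by rewrite p1E mulrBl -mulrA yp pp.
have y0p1 : y0 * p1 = 0 by rewrite p1E mulrBr mulrA yp yx qy subrr.
have p1x0 : p1 * x0 = 0 by rewrite p1E mulrBl -mulrA yx px xq subrr.
rewrite -p1g in gE; have [x [y [p' [pp' [yxs pxs qys p'E p'f]]]]] := IH _ _ us (esym gE).
exists (fun u => if u == t then x0 else x u), (fun u => if u == t then y0 else y u).
exists p', pp'; have nt u : u \in s -> (u == t) = false.
  by move=> su; apply: contraNF ts => /eqP <-.
split=> //.
- move=> u w; rewrite !inE => /predU1P[->|su] /predU1P[->|sw].
  + by rewrite !eqxx yx.
  + rewrite eqxx nt // eq_sym nt //.
    by have [<- _] := pxs _ sw; rewrite mulrA y0p1 mul0r.
  + rewrite eqxx nt //.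
    by have [_ <-] := qys _ su; rewrite -mulrA p1x0 mulr0.
  + by rewrite !nt // yxs.
- move=> u; rewrite inE => /predU1P[->|su]; first by rewrite eqxx.
  have [pu uq] := pxs _ su; rewrite nt //; split=> //.
  by rewrite -pu mulrA pp1'.
- move=> u; rewrite inE => /predU1P[->|su]; first by rewrite eqxx.
  have [qu up] := qys _ su; rewrite nt //; split=> //.
  by rewrite -up -mulrA p1p.
rewrite big_cons eqxx opprD addrA -p1E p'E; congr (_ - _).
by apply: eq_big_seq => u su; rewrite nt.
Qed.

End Vclasses.

(** * Purely infinite simple rings *)

Section PurelyInfiniteSimple.
Variable S : nzRingType.
Hypothesis pisS : purely_infinite_simple S.

(** If all one-sided inverses were two-sided, [a * x * b = 1] would make [b * a] an inverse of [x],
    and [S] would be a division ring. *)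
Lemma pis_proper_isometry : exists s t : S, t * s = 1 /\ s * t <> 1.
Proof.
apply: contrapT => noST; case: pisS => + pis; apply => x x0.
have st (s t : S) : t * s = 1 -> s * t = 1.
  by move=> ts; apply: contrapT => nst; apply: noST; exists s, t.
have [a [b axb]] := pis _ x0; exists (b * a); split.
  by rewrite mulrA st // mulrA.
by rewrite -mulrA st.
Qed.

(** The entries behave like a Cuntz family. The defect [q = 1 - s * t] satisfies [a * q * b = 1], so
    [a * q] and [q * b] form a second pair orthogonal to [t] and [s]; the family of size [n] is
    placed inside it. *)
Lemma pis_isometries n :
  exists (T : 'M[S]_(n, 1)) (Z : 'M[S]_(1, n)), T *m Z = 1%:M.
Proof.
have [s [t [ts st]]] := pis_proper_isometry.
have q0 : 1 - s * t != 0.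
  by apply: contra_not_neq st => /eqP; rewrite subr_eq0 => /eqP <-.
have [a [b aqb]] := pisS.2 _ q0; set q := 1 - s * t in q0 aqb.
have qq : q * q = q.
  by rewrite /q mulrBl mul1r mulrBr mulr1 mulrA -(mulrA s t s) ts mulr1 subrr subr0.
have tq : t * q = 0 by rewrite /q mulrBr mulr1 mulrA ts mul1r subrr.
have qs : q * s = 0 by rewrite /q mulrBl mul1r -mulrA ts mulr1 subrr.
elim: n => [|n [T [Z TZ]]]; first by exists 0, 0; apply/matrixP => [[]].
rewrite -[n.+1]/(1 + n)%N; exists (col_mx t%:M (T *m (a * q)%:M) : 'M_(1 + n, 1)).
exists (row_mx s%:M ((q * b)%:M *m Z) : 'M_(1, 1 + n)).
rewrite mul_col_row !mulmxA -!scalar_mxM ts mulrA tq mul0r raddf0 mul0mx.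
rewrite -!(mulmxA T) -!scalar_mxM -(mulrA a q s) qs mulr0 raddf0 mulmx0.
have -> : a * q * (q * b) = 1 by rewrite mulrA -(mulrA a) qq.
by rewrite mul1mx TZ -scalar_mx_block.
Qed.

(** A nonzero entry of [f] can be multiplied to 1, so one row and one column of [f] give a copy of 1
    below [f]; the isometries cut it into [m] copies. *)
Lemma pis_sub_idem n (f : 'M[S]_n) m : f *m f = f -> f != 0 ->
  exists (T : 'M[S]_(m, n)) (Z : 'M[S]_(n, m)),
    [/\ T *m Z = 1%:M, T *m f = T & f *m Z = Z].
Proof.
move=> ff f0; have [i [j fij]] : exists i j, f i j != 0.
  apply: contrapT => nf; case/eqP: f0; apply/matrixP => i j; rewrite mxE.
  by apply/eqP/negPn/negP => fij; apply: nf; exists i, j.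
have [a [b afb]] := pisS.2 _ fij.
have [T [Z TZ]] := pis_isometries m.
pose r : 'M_(1, n) := a%:M *m row i f; pose c := col j f *m (b%:M : 'M_1).
have rc : r *m c = 1%:M.
  rewrite /r /c rowE colE; set u := delta_mx _ _; set w := delta_mx _ _.
  rewrite !mulmxA -(mulmxA _ f f) ff -!mulmxA (mulmxA f) (mulmxA u).
  have -> : u *m (f *m w) = (f i j)%:M.
    rewrite mulmxA -rowE -colE; apply/matrixP => k l.
    by rewrite !ord1 !mxE eqxx.
  by rewrite -!scalar_mxM mulrA afb.
exists (T *m r), (c *m Z); split.
- by rewrite mulmxA -(mulmxA T) rc mulmx1.
- by rewrite /r rowE !mulmxA -!(mulmxA _ f f) ff.
- by rewrite /c colE !mulmxA ff.
Qed.

Lemma pis_V_absorbing (a b : Vmon S) : b <> 0 -> exists2 c, c <> 0 & b = a + c.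
Proof.
have [[m e ee] ->] := V_surj a; have [[n f ff] ->] := V_surj b.
move=> /V_class_eq0/= /eqP f0.
(* The copy of [e] occupies the first [m] coordinates; the last one is left free so that the
   complement in [f] is nonzero. *)
have [T [Z [TZ Tf fZ]]] := pis_sub_idem (m + 1) ff f0.
pose h : 'M[S]_(m + 1) := block_mx e 0 0 0.
have hh : h *m h = h by rewrite mulmx_block !mulmx0 !mul0mx !addr0 ee.
pose f1 := Z *m h *m T.
have ff1 : f1 *m f1 = f1.
  by rewrite /f1 !mulmxA -(mulmxA _ T) TZ mulmx1 -(mulmxA Z) hh.
have f1f : f1 *m f = f1 by rewrite /f1 -!mulmxA Tf.
have ff1' : f *m f1 = f1 by rewrite /f1 !mulmxA fZ.
have ff2 : (f - f1) *m (f - f1) = f - f1.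
  by rewrite mulmxBl !mulmxBr ff ff1 f1f ff1' subrr subr0.
exists (V_class (Idem ff2)).
  move=> /V_class_eq0/= /(congr1 (fun X => T *m X *m Z)).
  rewrite mulmx0 mul0mx mulmxBr mulmxBl Tf TZ /f1 !mulmxA TZ mul1mx -mulmxA.
  rewrite !TZ mulmx1 =>  /matrixP/(_ (rshift m 0) (rshift m 0))/eqP.
  by rewrite !mxE eqxx (unsplitK (inr _)) mxE (unsplitK (inr _)) mxE subr0 oner_eq0.
have -> : V_class (Idem ee) = V_class (Idem ff1).
  transitivity (V_class (Idem hh)).
    apply: (V_class_mvn (a := row_mx e 0) (b := col_mx e 0)).
      by rewrite mul_row_col mulmx0 addr0 ee.
    by rewrite mul_col_row mulmx0 !mul0mx ee.
  apply: (V_class_mvn (a := h *m T) (b := Z *m h)).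
    by rewrite mulmxA -(mulmxA h) TZ mulmx1 hh.
  by rewrite mulmxA -(mulmxA Z) hh.
apply: V_class_orth; last by rewrite addrC subrK.
  by rewrite mulmxBr f1f ff1 subrr.
by rewrite mulmxBl ff1' ff1 subrr.
Qed.

(** The relations imposed by xi_0 are known in K_0 only; this is how they descend to equivalences of
    idempotents. *)
Lemma pis_V_cancel (x y : Vmon S) : x <> 0 -> y <> 0 ->
  gc_class (x, 0) = gc_class (y, 0) -> x = y.
Proof.
move=> x0 y0 /gc_classP[t /=]; rewrite !addr0.
exact: (absorbing_addIr (@V_conical S) pis_V_absorbing).
Qed.

(** Writing [1] as the sum of a given class and another one places a representative inside [S]
    itself. *)
Lemma pis_K0_surj (u : K0 S) :
  exists (p : S) (pp : p * p = p), p <> 0 /\ u = K0_class (idem1 pp).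
Proof.
have one0 : V_class (idem1 (mul1r (1 : S))) <> 0.
  by move/V_class_eq0/matrixP/(_ 0 0)/eqP; rewrite !mxE eqxx oner_eq0.
have [x x0 ->] := absorbing_gc_surj (@V_conical S) pis_V_absorbing one0 u.
have [c _ xc] := pis_V_absorbing x one0.
have [g gE] := V_surj c; rewrite gE in xc.
have [[n e ee] eE] := V_surj x; rewrite eE in xc x0 *.
have [X [Y [e' [ee' [YX [_ Xe] [eY _] _ _]]]]] := V_class_split xc.
have XYXY : (X *m Y) *m (X *m Y) = X *m Y by rewrite mulmxA -(mulmxA X) YX Xe.
have [p pE] : exists p : S, X *m Y = p%:M by exists ((X *m Y) 0 0); apply: mx11_scalar.
have pp : p * p = p.
  by move: XYXY; rewrite pE -scalar_mxM => /matrixP/(_ 0 0); rewrite !mxE eqxx.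
have ep : V_class (Idem ee) = V_class (idem1 pp).
  by apply: (V_class_mvn (a := Y) (b := X)).
exists p, pp; split; last by rewrite /K0_class -ep.
by move=> p0; apply: x0; rewrite ep; apply/V_class_eq0; rewrite /= p0 raddf0.
Qed.

End PurelyInfiniteSimple.

(** * K_1 and corners *)

Section K1classes.
Variable R : pzRingType.

Lemma K1_class1 n h h' : K1_class (@GLElt R n 1%:M 1%:M h h') = 0.
Proof.
by apply/K1_classP/(@gl_rel_stab _ n); rewrite // !stab1.
Qed.

Lemma K1_class_irr n (A A' B B' : 'M[R]_n) hA hA' hB hB' : A = B ->
  K1_class (@GLElt R n A A' hA hA') = K1_class (@GLElt R n B B' hB hB').
Proof. by move=> AB; apply/K1_classP/(@gl_rel_stab _ n); rewrite //= AB. Qed.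

Lemma K1_class_mulmx n (A A' B B' C C' : 'M[R]_n) hA hA' hB hB' hC hC' :
  C = A *m B ->
  K1_class (@GLElt R n C C' hC hC') =
  K1_class (@GLElt R n A A' hA hA') + K1_class (@GLElt R n B B' hB hB').
Proof.
move=> CE; rewrite -K1_classM.
apply/K1_classP/(@gl_rel_stab _ n); rewrite // ?geq_max ?leqnn //.
by rewrite stab_mul //= CE !stab_id.
Qed.

(** The quotient of [B] by [A] is the commutator of [J'] and [A]. The sizes are only propositionally
    equal, to allow the swap between [n + m] and [m + n]. *)
Lemma K1_class_conj n m (A A' : 'M[R]_n) (B B' : 'M[R]_m) hA hA' hB hB'
    (J : 'M[R]_(n, m)) (J' : 'M[R]_(m, n)) :
  n = m -> J *m J' = 1%:M -> J' *m J = 1%:M -> B = J' *m A *m J ->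
  K1_class (@GLElt R m B B' hB hB') = K1_class (@GLElt R n A A' hA hA').
Proof.
move=> nm; case: m / nm B B' hB hB' J J' => B B' hB hB' J J' JJ' J'J BE.
apply/K1_classP/asboolP; exists n; split=> //=; rewrite !stab_id BE.
exact: GLder_comm1.
Qed.

Lemma stab_block n m (A : 'M[R]_n) : stab (n + m) A = block_mx A 0 0 1%:M.
Proof.
rewrite /stab /copid_mx pid_mx_block pid_mx_col pid_mx_row mul_col_mx mul1mx.
rewrite mul_col_row !mulmx1 !mulmx0 !mul0mx (scalar_mx_block n m) opp_block_mx.
by rewrite !add_block_mx !oppr0 !addr0 subrr addr0 add0r.
Qed.

Lemma K1_class_block1 n m (A A' : 'M[R]_n) hA hA' B' h h' :
  K1_class (@GLElt R (n + m) (block_mx A 0 0 1%:M) B' h h') =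
  K1_class (@GLElt R n A A' hA hA').
Proof.
by apply/K1_classP/(@gl_rel_stab _ (n + m)); rewrite //= ?leq_addr // stab_id stab_block.
Qed.

Lemma K1_class_1block n m (A A' : 'M[R]_n) hA hA' B' h h' :
  K1_class (@GLElt R (m + n) (block_mx 1%:M 0 0 A) B' h h') =
  K1_class (@GLElt R n A A' hA hA').
Proof.
have inv (C C' : 'M[R]_n) : C *m C' = 1%:M ->
    block_mx C 0 0 (1%:M : 'M_m) *m block_mx C' 0 0 1%:M = 1%:M.
  by move=> CC'; rewrite mulmx_block !mulmx0 !mul0mx !addr0 add0r CC' mulmx1 -scalar_mx_block.
rewrite -(K1_class_block1 hA hA' (inv _ _ hA) (inv _ _ hA')).
pose swap k l : 'M[R]_(k + l, l + k) := block_mx 0 1%:M 1%:M 0.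
have swapK k l : swap k l *m swap l k = 1%:M.
  by rewrite mulmx_block !mulmx0 !mul0mx !addr0 !add0r !mulmx1 -scalar_mx_block.
apply: (K1_class_conj _ _ _ _ (J := swap n m) (J' := swap m n)); rewrite ?swapK 1?addnC //.
by rewrite !mulmx_block !mulmx0 !mul0mx !addr0 !add0r !mulmx1 !mul1mx.
Qed.

(* The involution [[0, T], [Z, 1 - ZT]] conjugates diag(A, 1) to diag(1, B). *)
Lemma K1_class_corner n m (A A' : 'M[R]_n) (B B' : 'M[R]_m) hA hA' hB hB'
    (T : 'M[R]_(n, m)) (Z : 'M[R]_(m, n)) :
  T *m Z = 1%:M -> B = Z *m A *m T + (1%:M - Z *m T) ->
  K1_class (@GLElt R m B B' hB hB') = K1_class (@GLElt R n A A' hA hA').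
Proof.
move=> TZ BE; pose D := 1%:M - Z *m T.
have TD : T *m D = 0 by rewrite mulmxBr mulmx1 mulmxA TZ mul1mx subrr.
have DZ : D *m Z = 0 by rewrite mulmxBl mul1mx -mulmxA TZ mulmx1 subrr.
have DD : D *m D = D by rewrite {2}/D mulmxBr mulmx1 mulmxA DZ mul0mx subr0.
have ZTD : Z *m T + D = 1%:M by rewrite addrC subrK.
pose J : 'M[R]_(n + m) := block_mx 0 T Z D.
have JJ : J *m J = 1%:M.
  rewrite mulmx_block !mul0mx !mulmx0 !add0r TZ TD DZ DD ZTD.
  by rewrite -scalar_mx_block.
have inv (C C' : 'M[R]_m) : C *m C' = 1%:M ->
    block_mx (1%:M : 'M_n) 0 0 C *m block_mx 1%:M 0 0 C' = 1%:M.
  by move=> CC'; rewrite mulmx_block !mulmx0 !mul0mx !addr0 add0r CC' mulmx1 -scalar_mx_block.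
have inv' (C C' : 'M[R]_n) : C *m C' = 1%:M ->
    block_mx C 0 0 (1%:M : 'M_m) *m block_mx C' 0 0 1%:M = 1%:M.
  by move=> CC'; rewrite mulmx_block !mulmx0 !mul0mx !addr0 add0r CC' mulmx1 -scalar_mx_block.
rewrite -(K1_class_1block hB hB' (inv _ _ hB) (inv _ _ hB')).
rewrite -(K1_class_block1 hA hA' (inv' _ _ hA) (inv' _ _ hA')).
apply: (K1_class_conj _ _ _ _ (J := J) (J' := J)) => //.
rewrite !mulmx_block !mul0mx !mulmx0 !mulmx1 !add0r !addr0 TZ TD DZ DD.
by rewrite BE mul0mx addr0.
Qed.

Lemma K1_class_diag n (a a' : 'I_n -> R) h h'
    (g : forall i, a i * a' i = 1) (g' : forall i, a' i * a i = 1)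
    (k : forall i, (a i)%:M *m (a' i)%:M = 1%:M :> 'M_1)
    (k' : forall i, (a' i)%:M *m (a i)%:M = 1%:M :> 'M_1) :
  K1_class (@GLElt R n (diag_mx (\row_i a i)) (diag_mx (\row_i a' i)) h h') =
  \sum_i K1_class (GLElt (k i) (k' i)).
Proof.
have inv m (b b' : 'I_m -> R) : (forall i, b i * b' i = 1) ->
    diag_mx (\row_i b i) *m diag_mx (\row_i b' i) = 1%:M.
  move=> bb; rewrite mulmx_diag -diag_const_mx; congr diag_mx; apply/rowP => i.
  by rewrite !mxE bb.
elim: n a a' h h' g g' k k' => [|n IH] a a' h h' g g' k k'.
  rewrite big_ord0 -(K1_class1 (mulmx1 1%:M) (mulmx1 (1%:M : 'M[R]_0))).
  by apply: K1_class_irr; apply/matrixP => [[]].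
rewrite big_ord_recl.
rewrite -(IH (fun i => a (lift ord0 i)) (fun i => a' (lift ord0 i))
            (inv _ _ _ (fun i => g _)) (inv _ _ _ (fun i => g' _))) //.
have inv1 (b b' : R) : b * b' = 1 -> block_mx (b%:M : 'M_1) 0 0 (1%:M : 'M_n) *m
    block_mx b'%:M 0 0 1%:M = 1%:M.
  move=> bb; rewrite mulmx_block !mulmx0 !mul0mx !addr0 add0r mulmx1 -scalar_mxM bb.
  by rewrite -scalar_mx_block.
have inv2 (X X' : 'M[R]_n) : X *m X' = 1%:M ->
    block_mx (1%:M : 'M_1) 0 0 X *m block_mx 1%:M 0 0 X' = 1%:M.
  by move=> XX'; rewrite mulmx_block !mulmx0 !mul0mx !addr0 add0r XX' mulmx1 -scalar_mx_block.
rewrite -(K1_class_block1 (k ord0) (k' ord0) (inv1 _ _ (g _)) (inv1 _ _ (g' _))).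
rewrite -(K1_class_1block _ _ (inv2 _ _ (inv _ _ _ (fun i => g (lift ord0 i))))
                        (inv2 _ _ (inv _ _ _ (fun i => g' (lift ord0 i))))).
have fE (c : R) (X : 'M_n) : block_mx (c%:M : 'M_1) 0 0 X =
    block_mx (c%:M : 'M_1) 0 0 1%:M *m block_mx 1%:M 0 0 X.
  by rewrite mulmx_block !mulmx0 !mul0mx !addr0 add0r mulmx1 mul1mx.
exact: K1_class_mulmx (etrans (diag_mx_recl a) (fE _ _)).
Qed.

End K1classes.

(** An n x n matrix is carried below [p] by [n] orthogonal copies of 1 and completed by the identity
    outside them, which keeps its class. *)
Lemma pis_K1_surj (S : nzRingType) (p : S) (c : K1 S) :
    purely_infinite_simple S -> p * p = p -> p <> 0 ->
  exists (u u' : S) (h : u%:M *m u'%:M = 1%:M :> 'M_1) (h' : u'%:M *m u%:M = 1%:M :> 'M_1),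
    [/\ u * (1 - p) = 1 - p, (1 - p) * u = 1 - p & K1_class (GLElt h h') = c].
Proof.
move=> pisS pp p0; have [[n A A' hA hA'] ->] := K1_surj c.
have ppM : p%:M *m p%:M = p%:M :> 'M_1 by rewrite -scalar_mxM pp.
have pM0 : p%:M != 0 :> 'M_1.
  by apply: contra_notN p0 => /eqP/matrixP/(_ 0 0); rewrite !mxE eqxx.
have [T [Z [TZ Tp pZ]]] := pis_sub_idem pisS n ppM pM0.
pose B (X : 'M_n) := Z *m X *m T + (1%:M - Z *m T).
have BM X Y : X *m Y = 1%:M -> B X *m B Y = 1%:M.
  move=> XY; rewrite /B; set D := 1%:M - Z *m T.
  have TD : T *m D = 0 by rewrite mulmxBr mulmx1 mulmxA TZ mul1mx subrr.
  have DZ : D *m Z = 0 by rewrite mulmxBl mul1mx -mulmxA TZ mulmx1 subrr.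
  have DD : D *m D = D by rewrite {2}/D mulmxBr mulmx1 mulmxA DZ mul0mx subr0.
  have ZTD : Z *m T + D = 1%:M by rewrite addrC subrK.
  clearbody D; rewrite mulmxDl !mulmxDr -!mulmxA TD !mulmx0 addr0 DD.
  rewrite (mulmxA D) DZ mul0mx add0r (mulmxA T) TZ mul1mx (mulmxA X) XY mul1mx.
  exact: ZTD.
have pD : (1 - p)%:M = 1%:M - p%:M :> 'M[S]_1 by rewrite raddfB.
have TD : T *m (1 - p)%:M = 0 by rewrite pD mulmxBr mulmx1 Tp subrr.
have DZ : (1 - p)%:M *m Z = 0 by rewrite pD mulmxBl mul1mx pZ subrr.
have sI : injective (@scalar_mx S 1).
  by move=> a b /matrixP/(_ 0 0); rewrite !mxE eqxx !mulr1n.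
have := BM _ _ hA; have := BM _ _ hA'.
have [u uE] : exists u, B A = u%:M by exists (B A 0 0); apply: mx11_scalar.
have [u' uE'] : exists u, B A' = u%:M by exists (B A' 0 0); apply: mx11_scalar.
rewrite uE uE' => h' h; exists u, u', h, h'; split.
- apply: sI; rewrite scalar_mxM -uE /B mulmxDl mulmxBl mul1mx -!mulmxA TD.
  by rewrite !mulmx0 add0r subr0.
- apply: sI; rewrite scalar_mxM -uE /B mulmxDr mulmxBr mulmx1 !mulmxA DZ.
  by rewrite !mul0mx add0r subr0.
exact: (K1_class_corner hA hA' h h' TZ (esym uE)).
Qed.

(** * Independence of paths in L(E) *)

Section LinearSpan.
Variables (F : fieldType) (V : lmodType F).

Inductive lspan (G : V -> Prop) : V -> Prop :=
| lspan0 : lspan G 0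
| lspan_cons c g b : G g -> lspan G b -> lspan G (c *: g + b).

Lemma lspan_gen (G : V -> Prop) g : G g -> lspan G g.
Proof. by move=> Gg; rewrite -[g]scale1r -[_ *: _]addr0; apply: lspan_cons => //; apply: lspan0. Qed.

Lemma lspanD (G : V -> Prop) a b : lspan G a -> lspan G b -> lspan G (a + b).
Proof.
by move=> Ga Gb; elim: Ga => [|c g d Gg _ IH]; rewrite ?add0r // -addrA; apply: lspan_cons.
Qed.

Lemma lspanZ (G : V -> Prop) c b : lspan G b -> lspan G (c *: b).
Proof.
elim=> [|d g a Gg _ IH]; first by rewrite scaler0; apply: lspan0.
by rewrite scalerDr scalerA; apply: lspan_cons.
Qed.

Lemma lspanB (G : V -> Prop) a b : lspan G a -> lspan G b -> lspan G (a - b).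
Proof. by move=> Ga Gb; rewrite -scaleN1r; apply: lspanD Ga (lspanZ _ Gb). Qed.

Lemma lspan_sum (G : V -> Prop) (T : Type) (s : seq T) (f : T -> V) :
  (forall t, lspan G (f t)) -> lspan G (\sum_(t <- s) f t).
Proof. by move=> Gf; elim/big_ind: _ => //; [apply: lspan0|apply: lspanD]. Qed.

(** Meant for [m] the largest monomial allowed by [G], with [H] the smaller ones. *)
Lemma lspan_extract (G H : V -> Prop) m b :
  (forall g, G g -> H g \/ g = m) -> lspan G b -> exists c, lspan H (b - c *: m).
Proof.
move=> GH; elim=> [|c g d /GH Gg _ [c' IH]].
  by exists 0; rewrite scale0r subr0; apply: lspan0.
case: Gg => [Hg|->]; first by exists c'; rewrite -addrA; apply: lspan_cons.
by exists (c + c'); rewrite scalerDl opprD addrACA subrr add0r.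
Qed.

Lemma lspan_sub (G H : V -> Prop) b :
  (forall g, G g -> H g) -> lspan G b -> lspan H b.
Proof.
by move=> GH; elim=> [|c g d /GH Hg _ IH]; [apply: lspan0|apply: lspan_cons].
Qed.

End LinearSpan.

Lemma lspan_lin (F : fieldType) (V W : lmodType F) (G : V -> Prop) (H : W -> Prop)
    (f : V -> W) b :
  (forall c x y, f (c *: x + y) = c *: f x + f y) -> f 0 = 0 ->
  (forall g, G g -> lspan H (f g)) -> lspan G b -> lspan H (f b).
Proof.
move=> flin f0 fG; elim=> [|c g d Gg _ IH]; first by rewrite f0; apply: lspan0.
by rewrite flin; apply: lspanD IH; apply/lspanZ/fG.
Qed.

Section PathIndependence.
Variables (F : fieldType) (E : graph).
Local Notation L := (leavitt F E).
Local Notation X := (vert E * nat * int)%type.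

Definition out_edges (v : vert E) : seq (edge E) := enum [pred e | source e == v].
Definition out_deg v := size (out_edges v).
Definition out_idx (e : edge E) : nat := index e (out_edges (source e)).

Lemma out_idx_lt e : (out_idx e < out_deg (source e))%N.
Proof. by rewrite index_mem mem_enum inE. Qed.

Lemma out_idx_inj e f : source e = source f -> out_idx e = out_idx f -> e = f.
Proof.
rewrite /out_idx => <- ef; rewrite -(nth_index e (s := out_edges (source e)) (x := e)).
  by rewrite ef nth_index // mem_enum inE; apply: contraT => sf;
     move: (out_idx_lt e); rewrite /out_idx ef /out_deg index_mem mem_enum inE (negPf sf).
by rewrite mem_enum inE.
Qed.

(* L(E) acts on the functions on [vert E * nat * int]: [e] identifies
   [{range e} * nat * int] with a part of [{source e} * nat * int], and the shift
   of the last coordinate separates paths of different lengths. *)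
Fixpoint tact (t : lterm F E) (f : X -> F) (x : X) : F :=
  match t with
  | LVert v => if x.1.1 == v then f x else 0
  | LEdge e => if (x.1.1 == source e) && (x.1.2 %% out_deg (source e) == out_idx e)%N
               then f (range e, (x.1.2 %/ out_deg (source e))%N, x.2 - 1) else 0
  | LGhost e => if x.1.1 == range e
                then f (source e, (x.1.2 * out_deg (source e) + out_idx e)%N, x.2 + 1) else 0
  | LZero => 0
  | LOpp t => - tact t f x
  | LAdd t u => tact t f x + tact u f x
  | LScale c t => c * tact t f x
  | LMul t u => tact t (tact u f) x
  end.

Lemma tact_lin t a f g :
  tact t (fun x => a * f x + g x) = (fun x => a * tact t f x + tact t g x).
Proof.
elim: t f g => [v|e|e||t IH|t IHt u IHu|c t IH|t IHt u IHu] f g; apply/funext => x /=.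
- by case: ifP; rewrite ?mulr0 ?addr0.
- by case: ifP; rewrite ?mulr0 ?addr0.
- by case: ifP; rewrite ?mulr0 ?addr0.
- by rewrite mulr0 addr0.
- by rewrite IH; ring.
- by rewrite IHt IHu; ring.
- by rewrite IH; ring.
- by rewrite IHu IHt.
Qed.

Lemma tact0 t x : tact t (fun=> 0) x = 0.
Proof.
have /= tE := congr1 (@^~ x) (tact_lin t (-1) (fun=> 0) (fun=> 0)).
transitivity (-1 * tact t (fun=> 0) x + tact t (fun=> 0) x); last first.
  by rewrite mulN1r addNr.
by rewrite -tE; congr (tact _ _ _); apply/funext => y; rewrite mulr0 addr0.
Qed.

Lemma tact_cong t u : lcong t u -> tact t = tact u.
Proof.
move=> tu; apply/funext => f; apply/funext => x; elim: tu f x => {t u} //=.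
- by move=> t u w _ IH _ IH' f x; rewrite IH.
- by move=> t u _ IH f x; rewrite IH.
- by move=> t t' u u' _ IH _ IH' f x; rewrite IH IH'.
- by move=> c t u _ IH f x; rewrite IH.
- move=> t t' u u' _ IH _ IH' f x; rewrite IH; congr (tact _ _ _).
  by apply/funext => y; rewrite IH'.
- by move=> *; rewrite addrA.
- by move=> *; rewrite addrC.
- by move=> *; rewrite add0r.
- by move=> *; rewrite addNr.
- by move=> *; rewrite mulrA.
- by move=> *; rewrite mul1r.
- by move=> *; rewrite mulrDr.
- by move=> *; rewrite mulrDl.
- move=> t u w f x; have := congr1 (@^~ x) (tact_lin t 1 (tact u f) (tact w f)).
  rewrite /= mul1r => <-; congr (tact _ _ _).
  by apply/funext => y; rewrite mul1r.
- move=> c t u f x; have := congr1 (@^~ x) (tact_lin t c (tact u f) (fun=> 0)).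
  rewrite /= tact0 addr0 => <-; congr (tact _ _ _).
  by apply/funext => y; rewrite addr0.
- move=> v w f x; case: (eqVneq v w) => [<-|vw] /=; first by case: (x.1.1 == _).
  by case: ifP => // /eqP ->; rewrite (negPf vw).
- by move=> e f x; case: (x.1.1 == _).
- by move=> e f x; rewrite eqxx.
- by move=> e f x; case: (x.1.1 == _).
- by move=> e f x; rewrite eqxx.
(* Relation e^*f: division of [m * d + i] with [i < d] returns [m] and [i], so another edge out of
   the same vertex sees the wrong residue. *)
- move=> e e' f [[u m] z] /=; case: (eqVneq e e') => [<-|ee'] /=.
    rewrite eqxx modnMDl modn_small ?out_idx_lt // eqxx /= divnMDl; last first.
      exact: leq_ltn_trans (out_idx_lt e).
    by rewrite divn_small ?out_idx_lt // addn0 addrK; case: eqP => // ->.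
  case: ifP => // _; case: eqP => //= se; rewrite -se modnMDl modn_small ?out_idx_lt //.
  by case: eqP => // /(out_idx_inj se) /eqP; rewrite (negPf ee').
move=> v /existsP[e0 /eqP e0v] f [[u m] z].
have -> (G : edge E -> lterm F E) (y : X) : tact (\big[@LAdd F E/@LZero F E]_(e | source e == v) G e) f y
    = \sum_(e | source e == v) tact (G e) f y.
  by apply: (big_morph (fun t => tact t f y)).
rewrite /=; case: eqP => [->|uv]; last first.
  by rewrite big1 // => e /eqP ->; case: eqP.
have dv : (0 < out_deg v)%N by rewrite -e0v; apply: leq_ltn_trans (out_idx_lt e0).
(* In the sum of ee^* only the edge whose index is the residue of [m] contributes; quotient and
   residue then recompose [m]. *)
pose e1 := nth e0 (out_edges v) (m %% out_deg v).
have e1s : e1 \in out_edges v by rewrite mem_nth // ltn_mod.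
have e1v : source e1 = v by move: e1s; rewrite mem_enum inE => /eqP.
have e1i : out_idx e1 = (m %% out_deg v)%N.
  by rewrite /out_idx e1v index_uniq ?enum_uniq // ltn_mod.
rewrite (bigD1 e1) ?e1v //= big1 => [|e /andP[/eqP ev ee1]].
  by rewrite e1i !eqxx /= addr0 -divn_eq subrK.
rewrite ev eqxx /=; case: eqP => // ei; case/eqP: ee1; apply: out_idx_inj; rewrite ?ev //.
by rewrite -ei e1i.
Qed.

Definition lact (u : L) : (X -> F) -> X -> F := tact (repr u).

Lemma lactE t : lact (lpi t) = tact t.
Proof. exact/tact_cong/lrepr. Qed.

Lemma lactD c u w f x : lact (c *: u + w) f x = c * lact u f x + lact w f x.
Proof. by elim/lpiW: u => t; elim/lpiW: w => s; rewrite -lpiZ -lpiD !lactE. Qed.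

Lemma lact0 f x : lact 0 f x = 0.
Proof. by rewrite -lpi0 lactE. Qed.

Lemma lactM u w f x : lact (u * w) f x = lact u (lact w f) x.
Proof. by elim/lpiW: u => t; elim/lpiW: w => s; rewrite -lpiM !lactE. Qed.

Implicit Types (v : vert E) (w : seq (edge E)).

(* The path [w] ending at [v]; the vertex matters only when [w] is empty. *)
Definition pathL v w : L := foldr (fun e x => ledge F e * x) (lvert F v) w.
Definition psrc v w := if w is e :: _ then source e else v.
Fixpoint pvalid v w :=
  if w is e :: w' then (range e == psrc v w') && pvalid v w' else true.

(** The point that supports the image of the indicator function of [(v, 0, 0)] under the path. *)
Fixpoint ppoint v w : X :=
  if w is e :: w' then
    let y := ppoint v w' in (source e, (y.1.2 * out_deg (source e) + out_idx e)%N, y.2 + 1)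
  else (v, 0%N, 0).

Lemma ppoint_size v w : (ppoint v w).2 = (size w)%:Z.
Proof. by elim: w => //= e w ->; rewrite -PoszD addn1. Qed.

(** The residue modulo the out-degree recovers the first edge. At a vertex of out-degree 1 the
    powers of a loop differ in the length coordinate alone. *)
Lemma ppoint_inj v w w' : pvalid v w -> pvalid v w' ->
  ppoint v w = ppoint v w' -> w = w'.
Proof.
elim: w w' => [|e w IH] [|e' w'] //=.
- by move=> _ _ /(congr1 snd) /=; rewrite ppoint_size -PoszD addn1.
- by move=> _ _ /(congr1 snd) /=; rewrite ppoint_size -PoszD addn1.
move=> /andP[/eqP ew vw] /andP[/eqP ew' vw'] [se mm zz].
move: mm; rewrite se => mm.
have := congr1 (modn^~ (out_deg (source e'))) mm.
have ie : (out_idx e < out_deg (source e'))%N by rewrite -se out_idx_lt.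
rewrite !modnMDl !modn_small ?out_idx_lt // => /(out_idx_inj se) ee'.
rewrite -{}ee' in ew' se mm *; congr (_ :: _); apply: IH => //.
have p1 u : pvalid v u -> (ppoint v u).1.1 = psrc v u by case: u.
have d0 : (0 < out_deg (source e))%N by apply: leq_ltn_trans (out_idx_lt e).
move/addIn/eqP: mm; rewrite eqn_pmul2r // => /eqP mm; move/addIr: zz => zz.
have := p1 _ vw; have := p1 _ vw'; rewrite -ew -ew'.
case: (ppoint v w) mm zz => [[? ?] ?]; case: (ppoint v w') => [[? ?] ?] /=.
by move=> -> -> -> ->.
Qed.

Lemma lact_path v w x : pvalid v w ->
  lact (pathL v w) (fun y => (y == (v, 0%N, 0))%:R) x = (x == ppoint v w)%:R.
Proof.
elim: w x => [|e w IH] [[u m] z] /=.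
  by rewrite lactE /= !xpair_eqE => _; case: (u == v).
case/andP=> /eqP ew vw; rewrite lactM lactE /=.
have -> : lact (pathL v w) (fun y => (y == (v, 0%N, 0))%:R) =
          (fun x => (x == ppoint v w)%:R) by apply/funext => y; apply: IH.
have p1 : (ppoint v w).1.1 = range e by rewrite ew; case: (w).
case: (ppoint v w) p1 => [[u' m'] z'] /= ->; rewrite !xpair_eqE eqxx /= subr_eq.
case: (u == source e) => //=; case: eqP => [mi|mi] /=.
  rewrite {2}(divn_eq m (out_deg (source e))) mi eqn_add2r eqn_pmul2r //.
  exact: leq_ltn_trans (out_idx_lt e).
case: eqP => // mE; case: mi.
by rewrite mE modnMDl modn_small ?out_idx_lt.
Qed.

End PathIndependence.

(** * Clearing ghost edges *)

Section PathSpans.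
Variables (F : fieldType) (E : graph).
Local Notation L := (leavitt F E).
Implicit Types (u v : vert E) (e f : edge E) (w : seq (edge E)).

Lemma pathL_edge e : pathL F (range e) [:: e] = ledge F e.
Proof. exact: ledge_range. Qed.

Lemma lvert_path u v w :
  lvert F u * pathL F v w = if psrc v w == u then pathL F v w else 0.
Proof.
case: w => [|e w] /=; first by rewrite lvert_mul eq_sym; case: eqP => // ->.
rewrite mulrA -(lsource_edge F e) mulrA lvert_mul eq_sym.
by case: eqP => [->//|_]; rewrite !mul0r.
Qed.

Lemma path_lvert v w : pathL F v w * lvert F v = pathL F v w.
Proof.
by elim: w => [|e w IH] /=; rewrite ?lvert_mul ?eqxx // -mulrA IH.
Qed.

Lemma pathL_cat v v' w w' : psrc v' w' = v ->
  pathL F v w * pathL F v' w' = pathL F v' (w ++ w').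
Proof.
move=> sv; elim: w => [|e w IH] /=; first by rewrite lvert_path sv eqxx.
by rewrite -mulrA IH.
Qed.

Lemma psrc_cat v v' w w' : psrc v' w' = v -> psrc v' (w ++ w') = psrc v w.
Proof. by case: w. Qed.

Lemma pvalid_cat v v' w w' : pvalid v w -> pvalid v' w' -> psrc v' w' = v ->
  pvalid v' (w ++ w').
Proof.
by move=> + vw' sv; elim: w => //= e w IH /andP[/eqP -> /IH ->]; rewrite (psrc_cat _ sv) eqxx.
Qed.

Lemma pvalid_catK v v' w w' : pvalid v w -> pvalid v' (w ++ w') ->
    psrc v' (w ++ w') = psrc v w -> pvalid v' w' /\ psrc v' w' = v.
Proof.
elim: w => [|e w IH] //= /andP[/eqP ew vw] /andP[/eqP ew' vw'] _.
by apply: IH => //; rewrite -ew' ew.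
Qed.

Definition path_gen v (P : seq (edge E) -> Prop) (x : L) : Prop :=
  exists w, [/\ pvalid v w, P w & x = pathL F v w].
Definition path_span v : L -> Prop := lspan (path_gen v (fun=> True)).

Lemma path_span_vert v : path_span v (lvert F v).
Proof. by apply: lspan_gen; exists [::]. Qed.

Lemma path_span_lvert u v x : path_span v x -> path_span v (lvert F u * x).
Proof.
apply: lspan_lin => [c a b||g [w [vw _ ->]]]; rewrite ?mulr0 //.
  by rewrite mulrDr leavitt_scalerAr.
by rewrite lvert_path; case: eqP => _; [apply: lspan_gen; exists w|apply: lspan0].
Qed.

Lemma path_span_ledge e v x : path_span v x -> path_span v (ledge F e * x).
Proof.
apply: lspan_lin => [c a b||g [w [vw _ ->]]]; rewrite ?mulr0 //.
  by rewrite mulrDr leavitt_scalerAr.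
rewrite -ledge_range -mulrA lvert_path; case: eqP => [we|_].
  by apply: lspan_gen; exists (e :: w); split; rewrite //= we eqxx.
by rewrite mulr0; apply: lspan0.
Qed.

Lemma path_span_edge e x : path_span (source e) x -> path_span (range e) (x * ledge F e).
Proof.
move=> xs; apply: (lspan_lin (f := fun y : L => y * ledge F e) _ _ _ xs)
  => [c a b||g [w [vw _ ->]]]; rewrite ?mul0r //.
  by rewrite mulrDl -leavitt_scalerAl.
apply: lspan_gen; exists (w ++ [:: e]); split=> //.
  by apply: pvalid_cat vw _ _; rewrite //= eqxx.
by rewrite -pathL_edge pathL_cat.
Qed.

(** The edge [f] keeps the words nonempty, so the ghost edge always meets an edge, which it cancels
    or annihilates. *)
Lemma path_span_ghost_edge e f x : path_span (source f) x ->
  path_span (range f) (lghost F e * x * ledge F f).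
Proof.
move=> xs; apply: (lspan_lin (f := fun y : L => lghost F e * y * ledge F f) _ _ _ xs).
- by move=> c a b; rewrite mulrDr mulrDl -leavitt_scalerAr -leavitt_scalerAl.
- by rewrite mulr0 mul0r.
move=> g [[|e' w] [vw _ ->]] /=.
  rewrite -mulrA lsource_edge lghost_edge; case: eqP => [->|_].
    exact: path_span_vert.
  exact: lspan0.
move: vw => /= /andP[/eqP ew vw]; rewrite mulrA lghost_edge; case: eqP => [ee|_].
  by apply: path_span_edge; apply: path_span_lvert; apply: lspan_gen; exists w.
by rewrite !mul0r; apply: lspan0.
Qed.

(** At a sink no further edge is required: the empty path is annihilated, since [e] does not start
    at [v], and any other path offers its first edge. *)
Lemma path_span_ghost_sink e v x : ~~ is_reg v ->
  path_span v x -> path_span v (lghost F e * x).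
Proof.
move=> sv; apply: lspan_lin => [c a b||g [[|f w] [/= vw _ ->]]]; rewrite ?mulr0 //.
- by rewrite mulrDr leavitt_scalerAr.
- rewrite -lghost_source -mulrA lvert_mul; case: eqP => [se|_].
    by case/existsP: sv; exists e; rewrite se.
  by rewrite mulr0; apply: lspan0.
case/andP: vw => _ vw; rewrite mulrA lghost_edge; case: eqP => [ee|_].
  by apply: path_span_lvert; apply: lspan_gen; exists w.
by rewrite mul0r; apply: lspan0.
Qed.

(* [k] bounds the number of ghost edges at the end of the monomials of [x]. *)
Fixpoint ghost_le (k : nat) (x : L) : Prop :=
  if k is k'.+1 then
    (forall e, ghost_le k' (x * ledge F e)) /\
    (forall v, ~~ is_reg v -> path_span v (x * lvert F v))
  else forall v, path_span v (x * lvert F v).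

Lemma ghost_le_sink k x v : ~~ is_reg v -> ghost_le k x -> path_span v (x * lvert F v).
Proof. by case: k => [|k] vs /= => [|[_]]; apply. Qed.

Lemma edge_vert (x : L) e v : x * ledge F e * lvert F v =
  if range e == v then x * lvert F (source e) * ledge F e else 0.
Proof.
rewrite -(mulrA x (lvert F _)) lsource_edge -{1}ledge_range -!mulrA lvert_mul.
by case: eqP => _; rewrite ?ledge_range ?mulr0.
Qed.

Lemma ghost_leS k x : ghost_le k x -> ghost_le k.+1 x.
Proof.
elim: k x => [|k IH] x gx; split=> [e|v vs].
- move=> v; rewrite edge_vert; case: eqP => [<-|_]; last exact: lspan0.
  exact/path_span_edge/gx.
- exact: ghost_le_sink vs gx.
- by case: gx => gx _; apply/IH/gx.
- exact: ghost_le_sink vs gx.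
Qed.

Lemma ghost_le_mono k k' x : (k <= k')%N -> ghost_le k x -> ghost_le k' x.
Proof. by move/subnK <-; elim: (k' - k)%N => //= n IH gx; apply/ghost_leS/IH. Qed.

Lemma ghost_le_lin k c x y : ghost_le k x -> ghost_le k y -> ghost_le k (c *: x + y).
Proof.
elim: k c x y => [|k IH] c x y gx gy.
  move=> v; rewrite mulrDl -leavitt_scalerAl; apply: lspanD (gy v).
  exact: lspanZ (gx v).
split=> [e|v vs].
  by rewrite mulrDl -leavitt_scalerAl; apply: IH; [case: gx => gx _; exact: gx|case: gy => gy _; exact: gy].
rewrite mulrDl -leavitt_scalerAl; apply: lspanD; first apply: lspanZ.
  exact: ghost_le_sink vs gx.
exact: ghost_le_sink vs gy.
Qed.

Lemma ghost_le0 k : ghost_le k 0.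
Proof.
by elim: k => [|k IH]; [|split]; move=> *; rewrite mul0r //; apply: lspan0.
Qed.

Lemma ghost_le_lmul k (y x : L) : (forall v z, path_span v z -> path_span v (y * z)) ->
  ghost_le k x -> ghost_le k (y * x).
Proof.
move=> yP; elim: k x => [|k IH] x gx.
  by move=> v; rewrite -mulrA; apply/yP/gx.
by split=> [e|v vs]; rewrite -mulrA; [case: gx => gx _; apply/IH/gx|apply/yP; case: gx => _; apply].
Qed.

(** After [k] edges have cleared [x], one more edge makes the remaining paths nonempty, and the new
    ghost edge on the left cancels. *)
Lemma ghost_le_ghost k e x : ghost_le k x -> ghost_le k.+1 (lghost F e * x).
Proof.
elim: k x => [|k IH] x gx; split=> [f|v vs]; rewrite -mulrA.
- move=> v; rewrite mulrA edge_vert; case: eqP => [<-|_]; last exact: lspan0.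
  rewrite -(mulrA (lghost F e) x).
  exact/path_span_ghost_edge/gx.
- by apply: path_span_ghost_sink => //; apply: ghost_le_sink vs gx.
- by case: gx => gx _; apply/IH/gx.
- by apply: path_span_ghost_sink => //; apply: ghost_le_sink vs gx.
Qed.

(** The induction is on left multiplication of an already bounded [y], since a product of terms is
    then handled one factor after the other. *)
Lemma ghost_leP (x : L) : exists k, ghost_le k x.
Proof.
suff H t k y : ghost_le k y -> exists k', ghost_le k' (lpi t * y).
  have [|k] := H (repr x) 0%N 1; last by rewrite lpiK mulr1; exists k.
  by move=> v; rewrite mul1r; apply: path_span_vert.
elim: t k y => [v|e|e||t IH|t IHt u IHu|c t IH|t IHt u IHu] k y gy.
- by exists k; apply: ghost_le_lmul => // ? ?; apply: path_span_lvert.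
- by exists k; apply: ghost_le_lmul => // ? ?; apply: path_span_ledge.
- by exists k.+1; apply: ghost_le_ghost.
- by exists 0%N; rewrite mul0r; apply: ghost_le0.
- have [k' gt] := IH _ _ gy; exists k'; rewrite loppM -leavitt_scalerAl.
  by rewrite -[_ *: _]addr0; apply: ghost_le_lin gt (ghost_le0 _).
- have [k1 g1] := IHt _ _ gy; have [k2 g2] := IHu _ _ gy.
  exists (maxn k1 k2); rewrite lpiD mulrDl -[lpi t * y]scale1r; apply: ghost_le_lin.
    exact: ghost_le_mono (leq_maxl _ _) g1.
  exact: ghost_le_mono (leq_maxr _ _) g2.
- have [k' gt] := IH _ _ gy; exists k'; rewrite lpiZ -leavitt_scalerAl.
  by rewrite -[_ *: _]addr0; apply: ghost_le_lin gt (ghost_le0 _).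
- have [k1 g1] := IHu _ _ gy; have [k2 g2] := IHt _ _ g1.
  by exists k2; rewrite lpiM -mulrA.
Qed.

End PathSpans.

(** * Monomials and right submodules of free modules *)

Section FreeModules.
Variables (F : fieldType) (E : graph) (n : nat).
Local Notation L := (leavitt F E).
Local Notation V := {ffun 'I_n -> L}.
Implicit Types (u v : vert E) (e f : edge E) (w : seq (edge E)) (i : 'I_n) (b x : V).

Definition ract b (l : L) : V := [ffun i => b i * l].

Lemma ractDl a b l : ract (a + b) l = ract a l + ract b l.
Proof. by apply/ffunP => i; rewrite !ffunE mulrDl. Qed.
Lemma ractZl c b l : ract (c *: b) l = c *: ract b l.
Proof. by apply/ffunP => i; rewrite !ffunE leavitt_scalerAl. Qed.
Lemma ractDr b l l' : ract b (l + l') = ract b l + ract b l'.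
Proof. by apply/ffunP => i; rewrite !ffunE mulrDr. Qed.
Lemma ractZr c b l : ract b (c *: l) = c *: ract b l.
Proof. by apply/ffunP => i; rewrite !ffunE leavitt_scalerAr. Qed.
Lemma ractA b l l' : ract (ract b l) l' = ract b (l * l').
Proof. by apply/ffunP => i; rewrite !ffunE mulrA. Qed.
Lemma ract0 l : ract 0 l = 0.
Proof. by apply/ffunP => i; rewrite !ffunE mul0r. Qed.
Lemma ractr0 b : ract b 0 = 0.
Proof. by apply/ffunP => i; rewrite !ffunE mulr0. Qed.
Lemma ractr1 b : ract b 1 = b.
Proof. by apply/ffunP => i; rewrite !ffunE mulr1. Qed.
Lemma ract_suml (I : Type) (s : seq I) (P : pred I) (G : I -> V) l :
  ract (\sum_(j <- s | P j) G j) l = \sum_(j <- s | P j) ract (G j) l.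
Proof. exact: (big_morph (ract^~ l) (fun a b => ractDl a b l) (ract0 l)). Qed.
Lemma ract_sumr (I : Type) (s : seq I) (P : pred I) (G : I -> L) b :
  ract b (\sum_(j <- s | P j) G j) = \sum_(j <- s | P j) ract b (G j).
Proof. exact: (big_morph (ract b) (ractDr b) (ractr0 b)). Qed.

Inductive rspan (T : Type) (x : T -> V) : V -> Prop :=
| rspan0 : rspan x 0
| rspan_cons t l b : rspan x b -> rspan x (ract (x t) l + b).

Lemma rspanD T (x : T -> V) a b : rspan x a -> rspan x b -> rspan x (a + b).
Proof.
by move=> xa xb; elim: xa => [|t l a' _ IH]; rewrite ?add0r // -addrA; apply: rspan_cons.
Qed.

Lemma rspanM T (x : T -> V) b l : rspan x b -> rspan x (ract b l).
Proof.
elim=> [|t l' b' _ IH]; first by rewrite ract0; apply: rspan0.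
by rewrite ractDl ractA; apply: rspan_cons.
Qed.

Lemma rspan_gen T (x : T -> V) t : rspan x (x t).
Proof. by rewrite -[x t]ractr1 -[ract _ _]addr0; apply: rspan_cons; apply: rspan0. Qed.

Lemma rspan_sum T (x : T -> V) (I : Type) (s : seq I) (P : pred I) (G : I -> V) :
  (forall j, P j -> rspan x (G j)) -> rspan x (\sum_(j <- s | P j) G j).
Proof. by move=> xG; elim/big_ind: _ => //; [apply: rspan0|apply: rspanD]. Qed.

Lemma rspan_sub T U (x : T -> V) (y : U -> V) b :
  (forall t, rspan y (x t)) -> rspan x b -> rspan y b.
Proof.
move=> xy; elim=> [|t l b' _ IH]; first exact: rspan0.
by apply: rspanD IH; apply/rspanM/xy.
Qed.

Lemma rspan_coef (T : finType) (x : T -> V) b : rspan x b ->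
  exists l : T -> L, b = \sum_t ract (x t) (l t).
Proof.
elim=> [|t l b' _ [l' ->]]; first by exists (fun=> 0); rewrite big1 // => t _; rewrite ractr0.
exists (fun s => (if s == t then l else 0) + l' s).
under [RHS]eq_bigr do rewrite ractDr.
rewrite big_split; congr (_ + _); rewrite (bigD1 t) //= eqxx big1 ?addr0 // => s /negPf ->.
exact: ractr0.
Qed.

(** Passing from [x] to its products with edges loses nothing: at a regular vertex [x v] is the sum
    of the [(x e) e^*]. Products with sinks are already clear and are kept as generators. *)
Lemma rspan_clear k (T : finType) (x : T -> V) : (forall t i, ghost_le k (x t i)) ->
  exists (U : finType) (v : U -> vert E) (y : U -> V),
    [/\ forall r i, path_span (v r) (y r i), forall t, rspan y (x t)
      & forall r, rspan x (y r)].
Proof.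
elim: k T x => [|k IH] T x gx.
  exists (T * vert E)%type, snd, (fun p => ract (x p.1) (lvert F p.2)); split.
  - by move=> [t v] i; rewrite ffunE; apply: gx.
  - move=> t; rewrite -[x t]ractr1 [1]/(lone F E) ract_sumr; apply: rspan_sum => v _.
    exact: (rspan_gen (fun p => ract (x p.1) (lvert F p.2)) (t, v)).
  - by move=> [t v]; apply/rspanM/rspan_gen.
pose x' (p : T * edge E) := ract (x p.1) (ledge F p.2).
have [|U [v [y [yP yx xy]]]] := IH _ x'.
  by move=> [t e] i; rewrite ffunE; case: (gx t i) => gxt _; apply: gxt.
pose y' (p : U + T * sink E) := match p with
  inl u => y u | inr q => ract (x q.1) (lvert F (val q.2)) end.
pose v' (p : U + T * sink E) := match p with inl u => v u | inr q => val q.2 end.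
exists (U + T * sink E)%type, v', y'; split.
- case=> [u|[t s]] i /=; first exact: yP.
  by rewrite ffunE; apply: (ghost_le_sink (valP s) (gx t i)).
- move=> t; rewrite -[x t]ractr1 [1]/(lone F E) ract_sumr; apply: rspan_sum => z _.
  case: (boolP (is_reg z)) => [rz|sz]; last first.
    exact: (rspan_gen y' (inr (t, Sub z sz))).
  rewrite (lvert_CK2 F rz) ract_sumr; apply: rspan_sum => e _.
  rewrite -ractA; apply: rspanM; apply: (rspan_sub _ (yx (t, e))) => u.
  exact: (rspan_gen y' (inl u)).
- case=> [u|[t s]] /=; last exact/rspanM/rspan_gen.
  by apply: (rspan_sub _ (xy u)) => -[t e]; apply/rspanM/rspan_gen.
Qed.

(** Exceeds every digit: [i.+1] is at most [n], and the digit of an edge at most the number of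
    edges. *)
Definition base := (n + #|edge E|).+1.
Definition shift N w : nat := foldl (fun m (e : edge E) => m * base + (enum_rank e).+1)%N N w.
(* Monomials are ordered by reading [i.+1] followed by the edges of [w] as the
   digits of a number in base [base]. *)
Definition code i w : nat := shift i.+1 w.

Lemma code_cat i w w' : code i (w ++ w') = shift (code i w) w'.
Proof. by rewrite /code /shift foldl_cat. Qed.

(** Compatibility of the order with right multiplication by a path, which therefore carries leading
    monomials to leading monomials. *)
Lemma ltn_shift N M w : (N < M)%N -> (shift N w < shift M w)%N.
Proof.
elim: w N M => //= e w IH N M NM; apply: IH.
by rewrite ltn_add2r ltn_pmul2r.
Qed.

Lemma shift_gt0 N w : (0 < N)%N -> (0 < shift N w)%N.
Proof. by move=> N0; apply: leq_ltn_trans (ltn_shift w N0). Qed.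

(** The first digit [i.+1] is nonzero, so exactly the empty word has a code below [base]; otherwise
    the residue gives the last edge. *)
Lemma code_inj i i' w w' : code i w = code i' w' -> i = i' /\ w = w'.
Proof.
have rB e : ((enum_rank e).+1 < base)%N.
  by rewrite ltnS; apply: leq_trans (ltn_ord _) _; apply: leq_addl.
have iB (j : 'I_n) : (j.+1 < base)%N by rewrite ltnS; apply: leq_trans (ltn_ord _) _; apply: leq_addr.
have big (j : 'I_n) w0 e : (base <= shift j.+1 (rcons w0 e))%N.
  rewrite /shift -cats1 foldl_cat /= -/(shift _ w0).
  by rewrite (leq_trans (leq_pmull base (shift_gt0 w0 (ltn0Sn j)))) // leq_addr.
rewrite /code; elim/last_ind: w w' => [|w e IH] w'; case/lastP: w' => [|w' e'].
- by move=> [/val_inj].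
- by move=> ii; have := big i' w' e'; rewrite -ii leqNgt iB.
- by move=> ii; have := big i w e; rewrite ii leqNgt iB.
move: IH; rewrite /shift -!cats1 !foldl_cat /=.
rewrite -!/(shift _ _) => IH ii.
have := congr1 (modn^~ base) ii; rewrite !modnMDl !modn_small // => -[/val_inj/enum_rank_inj ee].
subst e'; move/addIn/eqP: ii; rewrite eqn_pmul2r // => /eqP/IH[-> ->].
by [].
Qed.

Definition mon v i w : V := [ffun k => if k == i then pathL F v w else 0].

Lemma mon_ract v v' i w w' : psrc v' w' = v ->
  ract (mon v i w) (pathL F v' w') = mon v' i (w ++ w').
Proof.
move=> sv; apply/ffunP => k; rewrite !ffunE.
by case: eqP => _; rewrite ?mul0r // pathL_cat.
Qed.

Definition mono v N (g : V) : Prop :=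
  exists i w, [/\ pvalid v w, (code i w < N)%N & g = mon v i w].
Definition low v N : V -> Prop := lspan (mono v N).

Lemma low_le v N M b : (N <= M)%N -> low v N b -> low v M b.
Proof.
move=> NM; apply: lspan_sub => g [i [w [vw wN ->]]].
by exists i, w; split=> //; apply: leq_trans NM.
Qed.

(** The functional [phi] lets coordinate [i] act on the indicator function and evaluates at the
    point of [w]: it is 1 on this monomial and 0 on the other ones that end at [v]. *)
Lemma mon_not_low v i w : pvalid v w -> ~ low v (code i w) (mon v i w).
Proof.
move=> vw; pose phi b := lact (b i) (fun y => (y == (v, 0%N, 0))%:R) (ppoint v w).
suff phi0 b : low v (code i w) b -> phi b = 0.
  by move/phi0/eqP; rewrite /phi ffunE eqxx lact_path // eqxx oner_eq0.
elim=> [|c g d [i' [w' [vw' cw' ->]]] _ IH]; first by rewrite /phi ffunE lact0.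
rewrite /phi !ffunE lactD -/(phi d) IH addr0; case: eqP => [ii|_]; last first.
  by rewrite lact0 mulr0.
rewrite lact_path //; case: eqP => [/(ppoint_inj vw vw') ww|_]; last by rewrite mulr0.
by move: cw'; rewrite ii ww ltnn.
Qed.

Lemma low_extract v i w b : low v (code i w).+1 b ->
  exists c, low v (code i w) (b - c *: mon v i w).
Proof.
apply: lspan_extract => g [i' [w' [vw' cw' ->]]].
move: cw'; rewrite ltnS leq_eqVlt => /orP[/eqP/code_inj[-> ->]|cw']; first by right.
by left; exists i', w'.
Qed.

Lemma low_pred v N b : (forall i w, pvalid v w -> code i w <> N) ->
  low v N.+1 b -> low v N b.
Proof.
move=> vN; apply: lspan_sub => g [i [w [vw cw ->]]]; exists i, w; split=> //.
by move: cw; rewrite ltnS leq_eqVlt => /orP[/eqP/(vN _ _ vw)|].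
Qed.

Lemma low0 v b : low v 0 b -> b = 0.
Proof. by elim=> // c g d [i [w []]]. Qed.

Lemma low_ract v v' N b w : psrc v' w = v -> pvalid v' w -> low v N b ->
  low v' (shift N w) (ract b (pathL F v' w)).
Proof.
move=> sv vw lb; apply: (lspan_lin (f := fun b : V => ract b (pathL F v' w)) _ _ _ lb).
- by move=> c a d; rewrite ractDl ractZl.
- exact: ract0.
move=> g [i [w' [vw' cw' ->]]]; rewrite (mon_ract _ _ sv).
apply: lspan_gen; exists i, (w' ++ w); split=> //; first exact: pvalid_cat sv.
by rewrite code_cat; apply: ltn_shift.
Qed.

Lemma low_exists v b : (forall i, path_span v (b i)) -> exists N, low v N b.
Proof.
move=> bP; have -> : b = \sum_i [ffun k => if k == i then b i else 0].
  apply/ffunP => k; rewrite sum_ffunE (bigD1 k) //= ffunE eqxx big1 ?addr0 // => i ik.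
  by rewrite ffunE eq_sym (negPf ik).
elim: (index_enum _) => [|i s [N IH]].
  by exists 0%N; rewrite big_nil; apply: lspan0.
suff [M lM] : exists M, low v M [ffun k => if k == i then b i else 0].
  exists (maxn M N); rewrite big_cons.
  by apply: lspanD; [apply: low_le lM; apply: leq_maxl|apply: low_le IH; apply: leq_maxr].
elim: (bP i) => [|c g d [w [vw _ ->]] _ [M lM]].
  by exists 0%N; rewrite (_ : finfun _ = 0); [apply: lspan0|apply/ffunP => k; rewrite !ffunE if_same].
exists (maxn (code i w).+1 M).
have -> : [ffun k => if k == i then c *: pathL F v w + d else 0] =
          c *: mon v i w + [ffun k => if k == i then d else 0].
  by apply/ffunP => k; rewrite !ffunE; case: eqP; rewrite // scaler0 addr0.
apply: lspan_cons; last by apply: low_le lM; apply: leq_maxr.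
by exists i, w; split=> //; apply: leq_maxl.
Qed.

Definition leads v i w b : Prop :=
  pvalid v w /\ exists2 c, c <> 0 & low v (code i w) (b - c *: mon v i w).

Lemma leads_low v i w b : leads v i w b -> low v (code i w).+1 b.
Proof.
move=> [vw [c _ lb]]; rewrite -[b](subrK (c *: mon v i w)) addrC; apply: lspan_cons.
  by exists i, w.
exact: low_le lb.
Qed.

Lemma leads_ract v v' i w w' b : psrc v' w' = v -> pvalid v' w' ->
  leads v i w b -> leads v' i (w ++ w') (ract b (pathL F v' w')).
Proof.
move=> sv vw' [vw [c c0 lb]]; split; first exact: pvalid_cat sv.
exists c => //; rewrite -(mon_ract i w sv) -ractZl -scaleN1r -ractZl -ractDl scaleN1r code_cat.
exact: low_ract sv vw' lb.
Qed.

End FreeModules.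

(** * Reduction to prefix-free leading monomials *)

Section Reduction.
Variables (F : fieldType) (E : graph) (n : nat) (T : finType) (v : T -> vert E).
Local Notation L := (leavitt F E).
Local Notation V := {ffun 'I_n -> L}.
Local Notation monomial := ('I_n * seq (edge E))%type.

(** Generators that reduce to zero are kept and marked [None], so that the index type and the end
    vertices never change. *)
Definition leading (x : T -> V) (m : T -> option monomial) : Prop :=
  forall t, match m t with
            | Some p => leads (v t) p.1 p.2 (x t)
            | None => x t = 0
            end.

(** The condition on sources matters for empty [w] only: a vertex is a prefix just of the paths that
    start there. *)
Definition prefix_free (m : T -> option monomial) : Prop :=
  forall s t i w w', s != t -> m s = Some (i, w) -> m t = Some (i, w ++ w') ->
  psrc (v t) (w ++ w') <> psrc (v s) w.

(** Termination is by the sum of the bounds: a reduction lowers the bound of one generator to the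
    code of its old leading monomial and leaves the others alone. *)
Lemma rspan_reduce (N : T -> nat) (x : T -> V) : (forall t, low (v t) (N t) (x t)) ->
  exists (y : T -> V) (m : T -> option monomial),
    [/\ leading y m, prefix_free m, forall t, rspan y (x t) & forall t, rspan x (y t)].
Proof.
have [k] := ubnP (\sum_t N t); elim: k => // k IH in N x *; rewrite ltnS => Nk lx.
have decr t M : (M < N t)%N -> (\sum_s (if s == t then M else N s) < k)%N.
  move=> MN; apply: leq_trans Nk; rewrite (bigD1 t) //= eqxx [X in (_ < X)%N](bigD1 t) //=.
  rewrite (eq_bigr N) ?ltn_add2r // => s /negPf ->.
  by [].
(* Slack bounds are lowered first; afterwards the bound of a nonzero generator is one more than the
   code of its leading monomial. *)
have [[t [M [NM lM]]]|nolow] := pselect (exists t M, N t = M.+1 /\ low (v t) M (x t)).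
  apply: (IH _ _ (decr t M _)); first by rewrite NM.
  by move=> s; case: eqP => [->|].
have /boolp.choice[m mP] t : exists p : option monomial,
    if p is Some p then leads (v t) p.1 p.2 (x t) /\ N t = (code p.1 p.2).+1 else x t = 0.
  have := lx t; case NM: (N t) => [|M] lM; first by exists None; apply: low0 lM.
  have [[i [w [vw cM]]]|nom] := pselect (exists (i : 'I_n) w, pvalid (v t) w /\ code i w = M); last first.
    case: nolow; exists t, M; split=> //; apply: low_pred lM => i w vw cM.
    by apply: nom; exists i, w.
  subst M; have [c lc] := low_extract lM; exists (Some (i, w)) => /=; split=> //; split=> //.
  exists c => // c0; case: nolow; exists t, (code i w); split=> //.
  by move: lc; rewrite c0 scale0r subr0.
have xm : leading x m by move=> t; have := mP t; case: (m t) => // p [].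
have [pf|] := pselect (prefix_free m).
  by exists x, m; split=> // t; apply: rspan_gen.
move=> /existsNP[s] /existsNP[t] /existsNP[i] /existsNP[w] /existsNP[w'].
move=> /not_implyP[st] /not_implyP[ms] /not_implyP[mt] /contrapT sE.
have := mP s; rewrite ms /= => -[[vs [c c0 ls]] _].
have := mP t; rewrite mt /= => -[[vt [d _ lt]] Nt].
have [vw' sw'] := pvalid_catK vs vt sE.
(* [z] has the leading monomial of [x t] with coefficient [c] instead of [d], so the leading terms
   cancel in [x t - a *: z]. *)
pose a := d / c; pose z := ract (x s) (pathL F (v t) w').
pose x' r := if r == t then x t - a *: z else x r.
have [|r|y [m' [ym pf yx' x'y]]] := IH _ x' (decr t (code i (w ++ w')) _).
- by rewrite Nt.
- rewrite /x'; case: eqP => [->|_]; last exact: lx.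
  have -> : x t - a *: z = (x t - d *: mon F (v t) i (w ++ w')) -
      a *: (ract (x s - c *: mon F (v s) i w) (pathL F (v t) w')).
    have -> : ract (x s - c *: mon F (v s) i w) (pathL F (v t) w') =
              z - c *: mon F (v t) i (w ++ w').
      by rewrite ractDl -scaleN1r !ractZl scaleN1r (mon_ract F i w sw').
    by rewrite scalerBr scalerA divfK ?opprB ?addrA ?subrK //; apply/eqP.
  by apply: lspanB => //; apply: lspanZ; rewrite code_cat; apply: low_ract sw' vw' ls.
have zE : a *: z = ract (x s) (a *: pathL F (v t) w') by rewrite ractZr.
have xx' r : rspan x' (x r).
  have [->|rt] := eqVneq r t; last first.
    by have := rspan_gen x' r; rewrite /x' (negPf rt).
  have -> : x t = x' t + ract (x' s) (a *: pathL F (v t) w').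
    by rewrite /x' eqxx (negPf st) -zE subrK.
  by apply: rspanD; [|apply: rspanM]; apply: rspan_gen.
have x'x r : rspan x (x' r).
  rewrite /x'; case: eqP => [_|_]; last exact: rspan_gen.
  rewrite zE -[- _]scaleN1r -ractZr; apply: rspanD; first exact: rspan_gen.
  exact/rspanM/rspan_gen.
exists y, m'; split=> // r.
  exact: rspan_sub yx' (xx' r).
exact: rspan_sub x'x (x'y r).
Qed.

(** * Independence of generators with prefix-free leading monomials *)

Section Independence.
Variables (x : T -> V) (m : T -> option monomial).
Hypotheses (xm : leading x m) (m_pf : prefix_free m).

(** By prefix-freeness each code arises from at most one leading monomial and one path of its
    coefficient. The top code therefore cannot cancel, its scalar vanishes, and [N] drops. *)
Lemma leading_indep_path u N (l : T -> L) :
    (forall t, if m t is Some p then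
       lspan (path_gen u (fun w => psrc u w = v t /\ (code p.1 (p.2 ++ w) < N)%N)) (l t)
       else l t = 0) ->
  \sum_t ract (x t) (l t) = 0 -> forall t, l t = 0.
Proof.
elim: N l => [|N IH] l lP lx t.
  by have := lP t; case: (m t) => // p; elim=> // c g d [w [_ []]].
have [[t0 [i0 [w0 [g0 [mt0 vg0 sg0 cN]]]]]|noN] := pselect (exists t i w w',
    [/\ m t = Some (i, w), pvalid u w', psrc u w' = v t & code i (w ++ w') = N]); last first.
  apply: IH lx t => t; have := lP t; case mt: (m t) => [[i w]|] //=.
  apply: lspan_sub => g [w' [vw' [sw' cw'] ->]]; exists w'; split=> //; split=> //.
  move: cw'; rewrite ltnS leq_eqVlt => /predU1P[cN|//].
  by case: noN; exists t, i, w, w'.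
have lead0 := xm t0; rewrite mt0 /= in lead0.
(* Of two left factors of the same word one is a prefix of the other. *)
have uniqN s i w w' : m s = Some (i, w) -> pvalid u w' -> psrc u w' = v s ->
    code i (w ++ w') = N -> s = t0 /\ w' = g0.
  move=> ms vw' sw'; rewrite -cN => /code_inj[ii ww].
  have srcE : psrc (v s) w = psrc (v t0) w0.
    by rewrite -(psrc_cat _ sw') ww (psrc_cat _ sg0).
  have [sE|st] := eqVneq s t0.
    split=> //; move: ms ww; rewrite sE mt0 => -[_ <-].
    by move/eqP; rewrite eqseq_cat // eqxx => /eqP.
  have [le|/ltnW le] := leqP (size w) (size w0).
    have w0E : w0 = w ++ drop (size w) w0.
      have := congr1 (take (size w)) ww; rewrite take_size_cat // takel_cat // => wE.
      by rewrite -[LHS](cat_take_drop (size w)) -wE.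
    case: (m_pf (s := s) (t := t0) (i := i) (w := w) (w' := drop (size w) w0)) => //.
      by rewrite -w0E mt0 ii.
    by rewrite -w0E.
  have wE : w = w0 ++ drop (size w0) w.
    have := congr1 (take (size w0)) ww; rewrite takel_cat // take_size_cat // => wE.
    by rewrite -[LHS](cat_take_drop (size w0)) wE.
  case: (m_pf (s := t0) (t := s) (i := i) (w := w0) (w' := drop (size w0) w)) => //.
  - by rewrite eq_sym.
  - by rewrite mt0 ii.
  - by rewrite -wE.
  - by rewrite -wE.
have [c l0P] : exists c, lspan (path_gen u (fun w => psrc u w = v t0 /\
    (code i0 (w0 ++ w) < N)%N)) (l t0 - c *: pathL F u g0).
  have := lP t0; rewrite mt0 /=; apply: lspan_extract => g [w' [vw' [sw' cw'] ->]].
  move: cw'; rewrite ltnS leq_eqVlt => /predU1P[cN'|cw'].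
    by right; have [_ ->] := uniqN _ _ _ _ mt0 vw' sw' cN'.
  by left; exists w'.
pose l' s := if s == t0 then l t0 - c *: pathL F u g0 else l s.
have l'P s : if m s is Some p then
    lspan (path_gen u (fun w => psrc u w = v s /\ (code p.1 (p.2 ++ w) < N)%N)) (l' s)
    else l' s = 0.
  rewrite /l'; have [->|st] := eqVneq s t0; first by rewrite mt0.
  have := lP s; case ms: (m s) => [[i w]|] //=.
  apply: lspan_sub => g [w' [vw' [sw' cw'] ->]]; exists w'; split=> //; split=> //.
  move: cw'; rewrite ltnS leq_eqVlt => /predU1P[cN'|//].
  by have [sE] := uniqN _ _ _ _ ms vw' sw' cN'; rewrite sE eqxx in st.
have sumE : \sum_s ract (x s) (l' s) + c *: ract (x t0) (pathL F u g0) = 0.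
  rewrite -[RHS]lx (bigD1 t0) //= [RHS](bigD1 t0) //= /l' eqxx addrAC; congr (_ + _).
    by rewrite -ractZr -ractDr subrK.
  by apply: eq_bigr => s /negPf ->.
have lowN : low u N (\sum_s ract (x s) (l' s)).
  apply: lspan_sum => s; have := l'P s; have := xm s.
  case: (m s) => [[i w]|] /= lead_s; last by move=> ->; rewrite ractr0; apply: lspan0.
  move=> ls; apply: (lspan_lin (f := fun z : L => ract (x s) z) _ _ _ ls).
  - by move=> ? ? ?; rewrite ractDr ractZr.
  - exact: ractr0.
  move=> g [w' [vw' [sw' cw'] ->]].
  exact: low_le cw' (leads_low (leads_ract sw' vw' lead_s)).
have [vg [d d0]] := leads_ract sg0 vg0 lead0; rewrite cN => lowd.
(* Otherwise the top monomial would be a combination of monomials of smaller code, against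
   [mon_not_low]. *)
have c0 : c = 0.
  apply/eqP/negPn/negP => /eqP c0; case: (mon_not_low (F := F) (i := i0) vg).
  rewrite cN.
  have -> : mon F u i0 (w0 ++ g0) = (- (c * d)^-1) *: (\sum_s ract (x s) (l' s) +
      c *: (ract (x t0) (pathL F u g0) - d *: mon F u i0 (w0 ++ g0))).
    rewrite scalerBr addrA sumE sub0r scalerN scaleNr opprK !scalerA -?mulrA mulVf ?scale1r //.
    by rewrite mulf_neq0 //; apply/eqP.
  by apply: lspanZ; apply: lspanD => //; apply: lspanZ.
have l'E s : l' s = l s.
  by rewrite /l' c0 scale0r subr0; case: eqP => [->|].
rewrite -l'E; apply: IH => [s|]; first by have := l'P s; case: (m s).
by move: sumE; rewrite c0 scale0r addr0.
Qed.

(** Right multiplication by edges clears the ghost edges of the coefficients. A coefficient vanishes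
    as soon as its products with all edges and all sinks do, because 1 is the sum of the ee^* and
    the sinks. *)
Lemma leading_indep (l : T -> L) :
    (forall t, if m t is Some p then lvert F (v t) * l t = l t else l t = 0) ->
  \sum_t ract (x t) (l t) = 0 -> forall t, l t = 0.
Proof.
have [k lk] : exists k, forall t, ghost_le k (l t).
  have /boolp.choice[k kP] t := ghost_leP (l t).
  exists (\max_t k t) => t; apply: ghost_le_mono (kP t); exact: leq_bigmax.
have path_case u (l' : T -> L) : (forall t, path_span u (l' t)) ->
    (forall t, if m t is Some p then lvert F (v t) * l' t = l' t else l' t = 0) ->
    \sum_t ract (x t) (l' t) = 0 -> forall t, l' t = 0.
  move=> l'u l'm l'x.
  have /boolp.choice[N NP] t : exists N, if m t is Some p then
      lspan (path_gen u (fun w => psrc u w = v t /\ (code p.1 (p.2 ++ w) < N)%N)) (l' t)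
      else True.
    case mt: (m t) => [p|]; last by exists 0%N.
    have := l'm t; rewrite mt => <-.
    elim: (l'u t) => [|c g d [w [vw _ ->]] _ [N IH]].
      by exists 0%N; rewrite mulr0; apply: lspan0.
    exists (maxn (code p.1 (p.2 ++ w)).+1 N).
    rewrite mulrDr -leavitt_scalerAr; apply: lspanD; last first.
      apply: lspan_sub IH => g' [w' [vw' [sw' cw'] ->]]; exists w'; split=> //; split=> //.
      exact: leq_trans (leq_maxr _ _).
    apply: lspanZ; rewrite lvert_path; case: eqP => [sw|_]; last exact: lspan0.
    by apply: lspan_gen; exists w; split=> //; split=> //; apply: leq_maxl.
  apply: (leading_indep_path (u := u) (N := \max_t N t)) l'x => t.
  have := NP t; have := l'm t; case: (m t) => // p _.
  apply: lspan_sub => g [w [vw [sw cw] ->]]; exists w; split=> //; split=> //.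
  exact: leq_trans (leq_bigmax t).
have mulP (l' : T -> L) y :
    (forall t, if m t is Some p then lvert F (v t) * l' t = l' t else l' t = 0) ->
    forall t, if m t is Some p then lvert F (v t) * (l' t * y) = l' t * y else l' t * y = 0.
  by move=> l'm t; have := l'm t; case: (m t) => [_|] h; rewrite ?mulrA h ?mul0r.
have sumP (l' : T -> L) y : \sum_t ract (x t) (l' t) = 0 ->
    \sum_t ract (x t) (l' t * y) = 0.
  by move=> h; under eq_bigr do rewrite -ractA; rewrite -ract_suml h ract0.
elim: k l lk => [|k IH] l lk lm lx t; rewrite -[l t]mulr1 [1]/(lone F E) mulr_sumr.
  rewrite big1 // => u _.
  exact: (path_case u (fun t => l t * lvert F u) (fun t => lk t u) (mulP _ _ lm) (sumP _ _ lx)).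
rewrite big1 // => u _; case: (boolP (is_reg u)) => [ru|su]; last first.
  by apply: (path_case u (fun t => l t * lvert F u) _ (mulP _ _ lm) (sumP _ _ lx)) => s;
     apply: ghost_le_sink su (lk s).
rewrite (lvert_CK2 F ru) mulr_sumr big1 // => e _; rewrite mulrA.
rewrite (IH (fun t => l t * ledge F e)) ?mul0r //.
- by move=> s; have [h _] := lk s; apply: h.
- exact: mulP.
- exact: sumP.
Qed.

End Independence.

End Reduction.

(** * Generation of V(L(E)) by the vertices *)

Lemma V_class_diag (R : pzRingType) n (a : 'I_n -> R) (aa : forall i, a i * a i = a i) h :
  V_class (@Idem R n (diag_mx (\row_i a i)) h) = \sum_i V_class (idem1 (aa i)).
Proof.
elim: n a aa h => [|n IH] a aa h.
  by rewrite big_ord0; apply/V_class_eq0/matrixP => [[]].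
have h' : diag_mx (\row_i a (lift ord0 i)) *m diag_mx (\row_i a (lift ord0 i)) =
    diag_mx (\row_i a (lift ord0 i)).
  by rewrite mulmx_diag; congr diag_mx; apply/rowP => i; rewrite !mxE aa.
rewrite big_ord_recl -(IH (fun i => a (lift ord0 i)) _ h') -V_classD.
exact: (V_class_irr _ _ (diag_mx_recl a)).
Qed.

Lemma lvert_idem (F : fieldType) (E : graph) (v : vert E) :
  lvert F v * lvert F v = lvert F v.
Proof. by rewrite lvert_mul eqxx. Qed.

Lemma V_class_leavitt (F : fieldType) (E : graph) (u : Vmon (leavitt F E)) :
  exists s : seq (vert E), u = \sum_(v <- s) V_class (idem1 (lvert_idem F v)).
Proof.
have [[n e ee] ->] := V_surj u.
pose col (j : 'I_n) : {ffun 'I_n -> leavitt F E} := [ffun i => e i j].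
have [k gk] : exists k, forall t i, ghost_le k (col t i).
  have /boolp.choice[k kP] (p : 'I_n * 'I_n) := ghost_leP (col p.1 p.2).
  exists (\max_p k p) => t i; apply: ghost_le_mono (kP (t, i)); exact: leq_bigmax.
have [T [v [y0 [y0P ey y0e]]]] := rspan_clear gk.
have /boolp.choice[N NP] t := low_exists (y0P t).
have [y [m [ym m_pf y0y yy0]]] := rspan_reduce NP.
have {y0y ey} /boolp.choice[l lE] j := rspan_coef (rspan_sub y0y (ey j)).
have {y0e yy0} /boolp.choice[c cE] t := rspan_coef (rspan_sub y0e (yy0 t)).
pose q t := if m t then lvert F (v t) else 0.
have qq t : q t * q t = q t.
  by rewrite /q; case: (m t) => [p|] /=; rewrite ?lvert_idem ?mulr0.
have yq t : ract (y t) (q t) = y t.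
  rewrite /q; have := ym t; case: (m t) => [p|->] /=; last by rewrite ract0.
  move/leads_low; elim=> [|d g b [i [w [_ _ ->]]] _ IH]; first by rewrite ract0.
  rewrite ractDl ractZl IH; congr (_ *: _ + _); apply/ffunP => j; rewrite !ffunE.
  by case: eqP; rewrite ?mul0r ?path_lvert.
pose A : 'M_(n, #|T|) := \matrix_(i, a) y (enum_val a) i.
(* Cutting the coordinates by [q] changes no combination, since [y t] absorbs [q t] on the right,
   and it puts them where independence applies. *)
pose B : 'M_(#|T|, n) := \matrix_(a, j) (q (enum_val a) * l j (enum_val a)).
pose C : 'M_(n, #|T|) := \matrix_(j, a) c (enum_val a) j.
pose Q : 'M_#|T| := diag_mx (\row_a q (enum_val a)).
have AB : A *m B = e.
  apply/matrixP => i j; rewrite !mxE.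
  transitivity (col j i); last by rewrite ffunE.
  rewrite lE sum_ffunE (reindex (@enum_val T predT)) /=; last first.
    by exists enum_rank => t _; rewrite ?enum_rankK ?enum_valK.
  apply: eq_bigr => a _; rewrite !mxE ffunE mulrA; congr (_ * _).
  by rewrite -[in RHS]yq ffunE.
have eC : e *m C = A.
  apply/matrixP => i a; rewrite !mxE cE sum_ffunE; apply: eq_bigr => j _.
  by rewrite mxE !ffunE.
have eA : e *m A = A by rewrite -eC mulmxA ee.
have QB : Q *m B = B.
  by apply/matrixP => a j; rewrite mul_diag_mx !mxE mulrA qq.
have AQ : A *m Q = A.
  by apply/matrixP => i a; rewrite mul_mx_diag !mxE -[in RHS]yq ffunE.
have QQ : Q *m Q = Q.
  by rewrite mulmx_diag; congr diag_mx; apply/rowP => a; rewrite !mxE qq.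
(* The columns of [B *m A - Q] are relations between the generators in [A]. *)
have BA : B *m A = Q.
  apply/eqP; rewrite -subr_eq0; apply/eqP/matrixP => a b; rewrite [RHS]mxE.
  pose D := B *m A - Q.
  have AD : A *m D = 0 by rewrite mulmxBr mulmxA AB eA AQ subrr.
  have QD : Q *m D = D by rewrite mulmxBr mulmxA QB QQ.
  pose f t := D (enum_rank t) b.
  suff /(_ (enum_val a)) : forall t, f t = 0 by rewrite /f enum_valK.
  have qf t : q t * f t = f t.
    by rewrite /f -[in RHS]QD mul_diag_mx !mxE enum_rankK.
  apply: (leading_indep ym m_pf) => [t|].
    by have := qf t; rewrite /q; case: (m t) => //= <-; rewrite mul0r.
  apply/ffunP => i; rewrite sum_ffunE ffunE.
  transitivity ((A *m D) i b); last by rewrite AD mxE.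
  rewrite mxE (reindex (@enum_val T predT)) /=; last first.
    by exists enum_rank => t _; rewrite ?enum_rankK ?enum_valK.
  by apply: eq_bigr => z _; rewrite mxE ffunE /f enum_valK.
exists [seq v t | t <- enum T & m t].
have -> : V_class (Idem ee) = V_class (Idem QQ) by apply: (V_class_mvn _ _ AB BA).
rewrite (V_class_diag (fun a => qq (enum_val a))) big_map big_filter.
rewrite [RHS]big_mkcond big_enum /= [RHS](reindex (@enum_val T predT)) /=; last first.
  by exists enum_rank => t _; rewrite ?enum_rankK ?enum_valK.
apply: eq_bigr => a _; case mt: (m _) => [p|].
  by apply: V_class_irr; rewrite /= /q mt.
by apply/V_class_eq0; rewrite /= /q mt raddf0.
Qed.

(** * The kernel of I - A_E^t *)

(** For the Smith form [D] the left kernel consists of the coordinates at its zero rows; [Z]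
    projects onto them, and conjugation by [L] transports this projection to [M]. *)
Lemma int_mx_ker_retract m n (M : 'M[int]_(m, n)) :
  exists Q : 'M[int]_m, Q *m M = 0 /\ forall X : 'rV_m, X *m M = 0 -> X *m Q = X.
Proof.
have [L Lu [R Ru [d _ ->]]] := int_Smith_normal_form M.
set D := \matrix_(i, j) _.
pose Z := diag_mx (\row_i (row i D == 0)%:R : 'rV[int]_m).
have ZD : Z *m D = 0.
  apply/matrixP => i j; rewrite mul_diag_mx mxE mxE [RHS]mxE.
  by case: eqP => [/rowP/(_ j)|_]; rewrite ?mul0r // mxE [RHS]mxE => ->; rewrite mulr0.
exists (L *m Z *m invmx L); split.
  by rewrite !mulmxA mulmxKV // -(mulmxA L) ZD mulmx0 mul0mx.
move=> X; rewrite !mulmxA => /(canRL (mulmxK Ru)); rewrite mul0mx => XLD.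
rewrite -[RHS](mulmxK Lu); congr (_ *m _); apply/rowP => i.
move: (X *m L) XLD => Y XLD; rewrite mul_mx_diag !mxE; case: eqP => [_|Di]; first by rewrite mulr1.
have [j [ij Dij]] : exists j : 'I_n, i = j :> nat /\ d`_i <> 0.
  apply: contrapT => nj; apply: Di; apply/rowP => j; rewrite !mxE.
  by case: eqP => // ij; apply: contrapT => dj; apply: nj; exists j.
move/rowP/(_ j): XLD; rewrite mxE (bigD1 i) //= big1 => [|k ki].
  by rewrite mxE ij eqxx addr0 mxE => /eqP; rewrite mulf_eq0 -ij => /orP[/eqP->|/eqP//]; rewrite mul0r.
rewrite !mxE; case: eqP => [kj|_]; last by rewrite mulr0.
by case/eqP: ki; apply: val_inj; rewrite /= kj ij.
Qed.

(** Composing [h] with the retraction onto the kernel extends it to the whole free group; [c v] is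
    the value at the basis vector of [v]. *)
Lemma kerIAt_hom_extend (E : graph) (A : zmodType) (h : {additive kerIAt E -> A}) :
  exists c : reg E -> A, forall x, h x = \sum_v c v *~ (x : {ffun _ -> _}) v.
Proof.
pose M : 'M[int]_(#|{: reg E}|, #|{: vert E}|) :=
  \matrix_(a, j) (incl (enum_val a) (enum_val j) - adj (enum_val a) (enum_val j)).
pose vec (x : {ffun reg E -> int}) : 'rV_(#|{: reg E}|) := \row_a x (enum_val a).
have vecM x j : (vec x *m M) 0 j = IAt x (enum_val j).
  rewrite !mxE ffunE (reindex (@enum_val (reg E) predT)) /=; last first.
    by exists enum_rank => t _; rewrite ?enum_rankK ?enum_valK.
  by apply: eq_bigr => a _; rewrite !mxE mulrC.
have [Q [QM QX]] := int_mx_ker_retract M.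
pose k a : {ffun reg E -> int} := [ffun v => Q a (enum_rank v)].
have vk a : vec (k a) = row a Q by apply/rowP => j; rewrite !mxE ffunE enum_valK.
have kP a : k a \in @ker_pred E.
  rewrite /in_mem /= /ker_pred; apply/eqP/ffunP => w; rewrite [RHS]ffunE.
  by rewrite -[w]enum_rankK -vecM vk -row_mul QM !mxE.
exists (fun v => h (KerIAt (kP (enum_rank v)))) => x.
have xE : x = \sum_v (KerIAt (kP (enum_rank v)) *~ (x : {ffun _ -> _}) v).
  apply: val_inj; rewrite [RHS]raddf_sum /=.
  apply/ffunP => v; rewrite sum_ffunE.
  have : vec x *m Q = vec x.
    apply: QX; apply/rowP => j; rewrite vecM mxE.
    have /eqP -> : IAt x == 0 by exact: (valP x).
    by rewrite ffunE.
  move/rowP/(_ (enum_rank v)); rewrite !mxE enum_rankK => <-.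
  rewrite (reindex (@enum_val (reg E) predT)) /=; last first.
    by exists enum_rank => t _; rewrite ?enum_rankK ?enum_valK.
  have valMz (y : kerIAt E) z : ker_val (y *~ z) = ker_val y *~ z.
    exact: (raddfMz (val : kerIAt E -> {ffun reg E -> int})).
  apply: eq_bigr => a _; rewrite ?mxE enum_valK valMz /=.
  by rewrite ffunMzE ffunE -mulrzr intz mulrC.
by rewrite {1}xE raddf_sum; apply: eq_bigr => v _; rewrite raddfMz.
Qed.

(** * Homomorphisms out of L(E) *)

(** The vertices are not asked to add up to 1, as the induced homomorphism may be nonunital. *)
Record CKfamily (F : fieldType) (E : graph) (S : algType F) := CKFamily {
  ck_vert : vert E -> S;
  ck_edge : edge E -> S;
  ck_ghost : edge E -> S;
  ck_vertM : forall v w, ck_vert v * ck_vert w = if v == w then ck_vert v else 0;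
  ck_source_edge : forall e, ck_vert (source e) * ck_edge e = ck_edge e;
  ck_edge_range : forall e, ck_edge e * ck_vert (range e) = ck_edge e;
  ck_range_ghost : forall e, ck_vert (range e) * ck_ghost e = ck_ghost e;
  ck_ghost_source : forall e, ck_ghost e * ck_vert (source e) = ck_ghost e;
  ck_ghost_edge : forall e f,
    ck_ghost e * ck_edge f = if e == f then ck_vert (range e) else 0;
  ck_vert_sum : forall v, is_reg v ->
    ck_vert v = \sum_(e | source e == v) ck_edge e * ck_ghost e }.

Section UniversalProperty.
Variables (F : fieldType) (E : graph) (S : algType F) (X : CKfamily E S).
Local Notation L := (leavitt F E).

Fixpoint ck_eval (t : lterm F E) : S :=
  match t with
  | LVert v => ck_vert X v
  | LEdge e => ck_edge X e
  | LGhost e => ck_ghost X e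
  | LZero => 0
  | LOpp t => - ck_eval t
  | LAdd t u => ck_eval t + ck_eval u
  | LScale c t => c *: ck_eval t
  | LMul t u => ck_eval t * ck_eval u
  end.

Lemma ck_eval_cong t u : lcong t u -> ck_eval t = ck_eval u.
Proof.
elim=> {t u} //=.
- by move=> ? ? ? _ -> _ ->.
- by move=> ? ? _ ->.
- by move=> ? ? ? ? _ -> _ ->.
- by move=> ? ? ? _ ->.
- by move=> ? ? ? ? _ -> _ ->.
- by move=> *; rewrite addrA.
- by move=> *; rewrite addrC.
- by move=> *; rewrite add0r.
- by move=> *; rewrite addNr.
- by move=> *; rewrite scalerA.
- by move=> *; rewrite scale1r.
- by move=> *; rewrite scalerDr.
- by move=> *; rewrite scalerDl.
- by move=> *; rewrite mulrA.
- by move=> *; rewrite mulrDl.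
- by move=> *; rewrite mulrDr.
- by move=> *; rewrite scalerAl.
- by move=> *; rewrite scalerAr.
- by move=> v w; rewrite ck_vertM; case: eqP.
- by move=> e; rewrite ck_source_edge.
- by move=> e; rewrite ck_edge_range.
- by move=> e; rewrite ck_range_ghost.
- by move=> e; rewrite ck_ghost_source.
- by move=> e f; rewrite ck_ghost_edge; case: eqP.
move=> v rv; rewrite (ck_vert_sum X rv).
by rewrite (big_morph ck_eval (id1 := 0) (op1 := +%R)).
Qed.

Definition ck_map (u : L) : S := ck_eval (repr u).

Lemma ck_mapE t : ck_map (lpi t) = ck_eval t.
Proof. exact/ck_eval_cong/lrepr. Qed.

Lemma ck_map_is_zmod_morphism : zmod_morphism ck_map.
Proof. by elim/lpiW=> t; elim/lpiW=> u; rewrite -lpiN -lpiD !ck_mapE. Qed.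

HB.instance Definition _ :=
  GRing.isZmodMorphism.Build L S ck_map ck_map_is_zmod_morphism.

Lemma ck_mapM : {morph ck_map : x y / x * y}.
Proof. by elim/lpiW=> t; elim/lpiW=> u; rewrite -lpiM !ck_mapE. Qed.

Definition ck_hom : nuhom L S := NUHom ck_mapM.

Lemma ck_homZ : scalable ck_hom.
Proof. by move=> c; elim/lpiW=> t; rewrite -lpiZ /= !ck_mapE. Qed.

Lemma ck_hom_vert v : ck_hom (lvert F v) = ck_vert X v.
Proof. exact: ck_mapE. Qed.
Lemma ck_hom_edge e : ck_hom (ledge F e) = ck_edge X e.
Proof. exact: ck_mapE. Qed.
Lemma ck_hom_ghost e : ck_hom (lghost F e) = ck_ghost X e.
Proof. exact: ck_mapE. Qed.

Lemma ck_hom1 : ck_hom 1 = \sum_v ck_vert X v.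
Proof. by rewrite [1]/(lone F E) raddf_sum; apply: eq_bigr => v _; rewrite ck_hom_vert. Qed.

Lemma ck_proj_idem e : (ck_edge X e * ck_ghost X e) * (ck_edge X e * ck_ghost X e) =
  ck_edge X e * ck_ghost X e.
Proof. by rewrite mulrA -(mulrA _ (ck_ghost X e)) ck_ghost_edge eqxx ck_edge_range. Qed.

End UniversalProperty.

(** * Twisting a family by units of the corners at its range projections *)

Section Twist.
Variables (F : fieldType) (E : graph) (S : algType F) (X : CKfamily E S).
Variables (w w' : edge E -> S).
Hypotheses (ww' : forall e, w e * w' e = 1) (w'w : forall e, w' e * w e = 1).
Let pc e := 1 - ck_edge X e * ck_ghost X e.
Hypotheses (w_pc : forall e, w e * pc e = pc e) (pc_w : forall e, pc e * w e = pc e).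

Lemma w'_pc e : w' e * pc e = pc e.
Proof. by rewrite -{1}w_pc mulrA w'w mul1r. Qed.
Lemma pc_w' e : pc e * w' e = pc e.
Proof. by rewrite -{1}pc_w -mulrA ww' mulr1. Qed.

(** Conjugation by [w e] fixes the complementary idempotent [pc e], hence the range projection. *)
Lemma twist_proj e : w e * ck_edge X e * (ck_ghost X e * w' e) = ck_edge X e * ck_ghost X e.
Proof.
have pE : ck_edge X e * ck_ghost X e = 1 - pc e by rewrite /pc opprB addrC subrK.
by rewrite mulrA -(mulrA (w e)) pE mulrBr mulr1 w_pc mulrBl ww' pc_w'.
Qed.

(** The twisted edge stays below its old range projection, so its products with the other twisted
    ghost edges still vanish. *)
Lemma twist_edge e :
  w e * ck_edge X e = ck_edge X e * ck_ghost X e * (w e * ck_edge X e).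
Proof.
have pE : ck_edge X e * ck_ghost X e = 1 - pc e by rewrite /pc opprB addrC subrK.
rewrite pE mulrBl mul1r (mulrA (pc e)) pc_w.
by rewrite /pc mulrBl mul1r -mulrA ck_ghost_edge eqxx ck_edge_range subrr subr0.
Qed.

Lemma twist_ghost e :
  ck_ghost X e * w' e = ck_ghost X e * w' e * (ck_edge X e * ck_ghost X e).
Proof.
have pE : ck_edge X e * ck_ghost X e = 1 - pc e by rewrite /pc opprB addrC subrK.
rewrite pE mulrBr mulr1 -(mulrA _ _ (pc e)) w'_pc.
by rewrite /pc mulrBr mulr1 mulrA ck_ghost_edge eqxx ck_range_ghost subrr subr0.
Qed.

Lemma twist_family : exists X' : CKfamily E S,
  [/\ ck_vert X' = ck_vert X, ck_edge X' = (fun e => w e * ck_edge X e)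
    & ck_ghost X' = (fun e => ck_ghost X e * w' e)].
Proof.
unshelve eexists (@CKFamily F E S (ck_vert X) (fun e => w e * ck_edge X e)
                  (fun e => ck_ghost X e * w' e) _ _ _ _ _ _ _); last by [].
- exact: ck_vertM.
- by move=> e /=; rewrite [in LHS]twist_edge !mulrA ck_source_edge -mulrA -twist_edge.
- by move=> e /=; rewrite -mulrA ck_edge_range.
- by move=> e /=; rewrite mulrA ck_range_ghost.
- by move=> e /=; rewrite [in LHS]twist_ghost -mulrA -(mulrA (ck_edge X e)) ck_ghost_source -twist_ghost.
- move=> e f /=; case: eqP => [<-|/eqP ef].
    by rewrite mulrA -(mulrA _ (w' e)) w'w mulr1 ck_ghost_edge eqxx.
  rewrite twist_ghost twist_edge !mulrA -(mulrA _ (ck_ghost X e)) ck_ghost_edge.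
  by rewrite (negPf ef) mulr0 !mul0r.
move=> v rv; rewrite (ck_vert_sum X rv).
by apply: eq_bigr => e _; rewrite twist_proj.
Qed.

End Twist.

(** * Effect of the twist on K_1 *)

Section TwistK1.
Variables (F : fieldType) (E : graph) (S : algType F).
Local Notation L := (leavitt F E).
Variables (phi0 phi : nuhom L S) (w w' : edge E -> S).
Let pc e := 1 - phi0 (ledge F e * lghost F e).
Hypotheses (phi0Z : scalable phi0) (phiZ : scalable phi).
Hypotheses (phi_vert : forall v, phi (lvert F v) = phi0 (lvert F v))
  (phi_edge : forall e, phi (ledge F e) = w e * phi0 (ledge F e))
  (phi_ghost : forall e, phi (lghost F e) = phi0 (lghost F e) * w' e).
Hypotheses (k : forall e, (w e)%:M *m (w' e)%:M = 1%:M :> 'M_1)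
  (k' : forall e, (w' e)%:M *m (w e)%:M = 1%:M :> 'M_1).
Hypotheses (w_pc : forall e, w e * pc e = pc e) (pc_w : forall e, pc e * w e = pc e).

Let sI : injective (@scalar_mx S 1).
Proof. by move=> a b /matrixP/(_ 0 0); rewrite !mxE eqxx !mulr1n. Qed.
Let ww' e : w e * w' e = 1. Proof. by apply: sI; rewrite scalar_mxM k. Qed.
Let w'w e : w' e * w e = 1. Proof. by apply: sI; rewrite scalar_mxM k'. Qed.
Let pc_w' e : pc e * w' e = pc e.
Proof. by rewrite -{1}pc_w -mulrA ww' mulr1. Qed.

Lemma twist_hom1 : phi 1 = phi0 1.
Proof. by rewrite [1]/(lone F E) !raddf_sum; apply: eq_bigr => v _. Qed.

(** Gives the agreement on DL(E), where the entries of W(x) lie. *)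
Lemma twist_dl_idem a : phi (dl_idem F a) = phi0 (dl_idem F a).
Proof.
case: a => [e|v] /=; last exact: phi_vert.
have pE : phi0 (ledge F e * lghost F e) = 1 - pc e by rewrite /pc opprB addrC subrK.
rewrite nuhomM phi_edge phi_ghost mulrA -(mulrA (w e)) -nuhomM pE.
by rewrite mulrBr mulr1 w_pc mulrBl ww' pc_w'.
Qed.

Lemma twist_fixl e (z : L) : lghost F e * z = 0 -> w e * phi0 z = phi0 z.
Proof.
move=> ez; have pz : pc e * phi0 z = phi0 z.
  by rewrite mulrBl mul1r -nuhomM -mulrA ez mulr0 raddf0 subr0.
by rewrite -pz mulrA w_pc.
Qed.

Lemma twist_fixr e (z : L) : z * ledge F e = 0 -> phi0 z * w' e = phi0 z.
Proof.
move=> ze; have pz : phi0 z * pc e = phi0 z.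
  by rewrite mulrBr mulr1 -nuhomM mulrA ze mul0r raddf0 subr0.
by rewrite -pz -mulrA pc_w'.
Qed.

Let pc1 e : pc e * (1 - phi0 1) = 1 - phi0 1.
Proof. by rewrite mulrBl mul1r mulrBr mulr1 -nuhomM mulr1 subrr subr0. Qed.
Let pc1r e : (1 - phi0 1) * pc e = 1 - phi0 1.
Proof. by rewrite mulrBr mulr1 mulrBl mul1r -nuhomM mul1r subrr subr0. Qed.

Variables (x : kerIAt E) (W : Wchoice F x).
Let N := #|Sidx x|.
Let ed (i : 'I_N) : edge E := tag (enum_val i).
Let pos (i : 'I_N) := 0 < ycoef x (ed i).
(** An edge entry of V(x) takes its unit on the left, a ghost entry on the right. Hence the row
    factor carries the units for positive y_e and the column factor [dr] the inverses for negative
    y_e. *)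
Let dl i := if pos i then w (ed i) else 1.
Let dl' i := if pos i then w' (ed i) else 1.
Let dr i := if pos i then 1 else w' (ed i).
Let dr' i := if pos i then 1 else w (ed i).

Lemma twist_Umx : gl_ext phi (Umx W) =
  diag_mx (\row_i dl i) *m (gl_ext phi0 (Umx W) *m diag_mx (\row_i dr i)).
Proof.
apply/matrixP => i j; rewrite mul_diag_mx mxE mul_mx_diag !mxE.
set X := \sum_a _.
have XW : X = Wmx W i j by rewrite mxE.
have phiX : phi X = phi0 X.
  by rewrite /X !raddf_sum; apply: eq_bigr => a _; rewrite phiZ phi0Z twist_dl_idem.
(* For positive y_e the diagonal entry of V(x)^* is e^*, so [VstarW] puts the entry of W(x) under
   the complement of ee^*, which [w e] fixes; the right side is dual, through [WVstar]. *)
have dlX : dl i * phi0 X = phi0 X.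
  rewrite /dl; case: ifP => [pi|_]; last by rewrite mul1r.
  apply: twist_fixl; have := congr1 (fun A : 'M_N => A i j) (VstarW W).
  rewrite !mxE (bigD1 i) //= big1 => [|l li].
    rewrite mxstarV_entry eqxx addr0 -XW /Vdiag -/(ed i) -/(pos i) pi lstar_edge.
    by [].
  by rewrite mxstarV_entry eq_sym (negPf li) mul0r.
have Xdr : phi0 X * dr j = phi0 X.
  rewrite /dr; case: ifP => [_|nj]; first by rewrite mulr1.
  apply: twist_fixr; have := congr1 (fun A : 'M_N => A i j) (WVstar W).
  rewrite !mxE (bigD1 j) //= big1 => [|l lj].
    rewrite mxstarV_entry eqxx addr0 -XW /Vdiag -/(ed j) -/(pos j) nj lstar_ghost.
    by [].
  by rewrite mxstarV_entry (negPf lj) mulr0.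
rewrite !raddfD /= phiX twist_hom1 !(mulrDr, mulrDl) Xdr dlX.
congr (_ + _ + _).
  case: eqP => [<-|_]; last by rewrite !raddf0 mul0r mulr0.
  rewrite /Vdiag -/(ed i) -/(pos i) /dl /dr.
  by case: (pos i); rewrite ?phi_edge ?phi_ghost ?mulr1 ?mul1r.
(* The stabilizing term [1 - phi 1] lies below every [pc e], so the units fix it as well. *)
case: (i == j) / eqP => [<-|_]; last by rewrite !mulr0n mul0r mulr0.
rewrite mulr1n /dl /dr; case: (pos i); rewrite ?mulr1 ?mul1r.
  by rewrite -(pc1 (ed i)) mulrA w_pc.
by rewrite -(pc1r (ed i)) -mulrA pc_w'.
Qed.

(** Each edge occurs |y_e| times among the diagonal factors, as a unit or as its inverse according
    to the sign of y_e. *)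
Lemma twist_Uclass : K1_map phi (Uclass W) =
  K1_map phi0 (Uclass W) + \sum_e K1_class (GLElt (k e) (k' e)) *~ ycoef x e.
Proof.
have inv (a a' : 'I_N -> S) : (forall i, a i * a' i = 1) ->
    diag_mx (\row_i a i) *m diag_mx (\row_i a' i) = 1%:M.
  move=> aa; rewrite mulmx_diag -diag_const_mx; congr diag_mx; apply/rowP => i.
  by rewrite !mxE aa.
have hl i : dl i * dl' i = 1 by rewrite /dl /dl'; case: (pos i); rewrite ?mulr1.
have hl' i : dl' i * dl i = 1 by rewrite /dl /dl'; case: (pos i); rewrite ?mulr1.
have hr i : dr i * dr' i = 1 by rewrite /dr /dr'; case: (pos i); rewrite ?mulr1.
have hr' i : dr' i * dr i = 1 by rewrite /dr /dr'; case: (pos i); rewrite ?mulr1.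
have s1 (a a' : S) : a * a' = 1 -> a%:M *m a'%:M = 1%:M :> 'M_1.
  by move=> aa; rewrite -scalar_mxM aa.
pose U := GLElt (Umx_mulV W) (Umx_Vmul W).
have hU := gl_map_mulV phi0 U; have hU' := gl_map_Vmul phi0 U.
have hM : (gl_ext phi0 (gl_mx U) *m diag_mx (\row_i dr i)) *m
    (diag_mx (\row_i dr' i) *m gl_ext phi0 (gl_inv U)) = 1%:M.
  by rewrite mulmxA -(mulmxA (gl_ext _ _)) (inv _ _ hr) mulmx1.
have hM' : (diag_mx (\row_i dr' i) *m gl_ext phi0 (gl_inv U)) *m
    (gl_ext phi0 (gl_mx U) *m diag_mx (\row_i dr i)) = 1%:M.
  by rewrite mulmxA -(mulmxA (diag_mx _)) hU' mulmx1 (inv _ _ hr').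
rewrite /Uclass !K1_map_class.
rewrite (K1_class_mulmx (inv _ _ hl) (inv _ _ hl') hM hM' _ _ twist_Umx).
rewrite (K1_class_mulmx hU hU' (inv _ _ hr) (inv _ _ hr') hM hM' erefl).
rewrite (K1_class_diag _ _ hl hl' (fun i => s1 _ _ (hl i)) (fun i => s1 _ _ (hl' i))).
rewrite (K1_class_diag _ _ hr hr' (fun i => s1 _ _ (hr i)) (fun i => s1 _ _ (hr' i))).
rewrite addrCA; congr (_ + _); first exact: K1_class_irr.
pose K e := K1_class (GLElt (k e) (k' e)).
rewrite -big_split /=.
transitivity (\sum_(i < N) (if 0 < ycoef x (ed i) then K (ed i) else - K (ed i))).
  apply: eq_bigr => i _; rewrite -/(pos i).
  have K1_1 a a' (h : a%:M *m a'%:M = 1%:M :> 'M[S]_1) h' : a = 1 -> K1_class (GLElt h h') = 0.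
    by move=> a1; rewrite -(K1_class1 (mulmx1 1%:M) (mulmx1 (1%:M : 'M[S]_1))); apply: K1_class_irr; rewrite a1.
  case pi: (pos i).
    rewrite (K1_1 (dr i)) ?addr0; last by rewrite /dr pi.
    by apply: K1_class_irr; rewrite /dl pi.
  rewrite (K1_1 (dl i)) ?add0r; last by rewrite /dl pi.
  apply: (addIr (K (ed i))); rewrite addNr /K.
  rewrite -(K1_class_mulmx _ _ _ _ (mulmx1 1%:M) (mulmx1 1%:M)) ?K1_class1 //.
  by rewrite /dr pi k'.
rewrite (reindex (@enum_rank (Sidx x))) /=; last first.
  by exists enum_val => t _; rewrite ?enum_rankK ?enum_valK.
under eq_bigr do rewrite /ed enum_rankK.
rewrite -(sig_big_dep (fun=> true) (fun _ => xpredT) (fun e _ => if 0 < ycoef x e then K e else - K e)) /=.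
apply: eq_bigr => e _; rewrite sumr_const card_ord.
case: (ycoef x e) => [[|n]|n] //=.
by rewrite NegzE /= mulrNz mulNrn.
Qed.

End TwistK1.

(** * Realizing homomorphisms on K_0 and K_1 *)

Lemma V_class_sum_seq (R : pzRingType) (T : eqType) (s : seq T) (x y q : T -> R)
    (qq : forall t, q t * q t = q t) (p : R) (pp : p * p = p) : uniq s ->
    p = \sum_(t <- s) x t * y t ->
    (forall t u, y t * x u = if t == u then q t else 0) ->
  V_class (idem1 pp) = \sum_(t <- s) V_class (idem1 (qq t)).
Proof.
move=> us pE yx; pose T_ := tnth (in_tuple s).
have TI : injective T_ by apply/tuple_uniqP.
pose a : 'M_(1, size s) := \row_i x (T_ i).
pose b : 'M_(size s, 1) := \col_i y (T_ i).
have QQ : diag_mx (\row_i q (T_ i)) *m diag_mx (\row_i q (T_ i)) = diag_mx (\row_i q (T_ i)).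
  by rewrite mulmx_diag; congr diag_mx; apply/rowP => i; rewrite !mxE qq.
rewrite [RHS]big_tnth -(V_class_diag (fun i => qq (T_ i)) QQ).
apply: (V_class_mvn (a := a) (b := b)).
  apply/matrixP => i j; rewrite !ord1 !mxE eqxx pE mulr1n [RHS]big_tnth.
  by apply: eq_bigr => l _; rewrite !mxE.
apply/matrixP => i j; rewrite !mxE big_ord1 !mxE yx (inj_eq TI).
by case: eqP => [->|]; rewrite ?mulr1n ?mulr0n.
Qed.

(** * The vertex classes in K_0(L(E)) *)

Section K0Generators.
Variables (F : fieldType) (E : graph).
Local Notation L := (leavitt F E).

Lemma K0_class_sum (R : pzRingType) (T : Type) (s : seq T) (e : T -> idem R) (f : idem R) :
  V_class f = \sum_(t <- s) V_class (e t) -> K0_class f = \sum_(t <- s) K0_class (e t).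
Proof.
rewrite /K0_class => ->; elim: s => [|t s IH]; first by rewrite !big_nil.
by rewrite !big_cons -IH -gc_classD /= addr0.
Qed.

Lemma K0_leavitt_ext (A : zmodType) (g h : {additive K0 L -> A}) :
  (forall v, g (K0_class (idem1 (lvert_idem F v))) = h (K0_class (idem1 (lvert_idem F v)))) ->
  forall u, g u = h u.
Proof.
move=> gh u.
have gcE (x : Vmon L) : g (gc_class (x, 0)) = h (gc_class (x, 0)).
  have [f fE] := V_surj x; have [s sE] := V_class_leavitt x.
  rewrite fE in sE *; rewrite -/(K0_class f) (K0_class_sum sE) !raddf_sum.
  exact: eq_bigr.
have [[x y] ->] := gc_surj u.
have -> : gc_class (x, y) = gc_class (x, 0) - gc_class (y, 0).
  apply/eqP; rewrite eq_sym subr_eq -gc_classD /=; apply/eqP/gc_classP.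
  by exists 0; rewrite /= !addr0.
by rewrite !raddfB !gcE.
Qed.

Lemma K0_unit_leavitt :
  K0_unit L = \sum_(v <- enum (vert E)) K0_class (idem1 (lvert_idem F v)).
Proof.
rewrite -(K0_class_sum (f := idem1 (mulr1 (1 : L)))).
  by rewrite /K0_unit /K0_class; congr (gc_class (_, _)); apply: V_class_irr.
apply: (V_class_sum_seq _ _ (x := @lvert F E) (y := @lvert F E)) => [||v w].
- exact: enum_uniq.
- rewrite [1]/(lone F E) big_enum; apply: eq_bigr => v _; rewrite lvert_mul eqxx.
  by [].
- exact: lvert_mul.
Qed.

Lemma K0_leavitt_reg (v : vert E) : is_reg v -> K0_class (idem1 (lvert_idem F v)) =
  \sum_(e <- enum [pred e : edge E | source e == v]) K0_class (idem1 (lvert_idem F (range e))).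
Proof.
move=> rv; apply: K0_class_sum.
apply: (V_class_sum_seq (fun e : edge E => lvert_idem F (range e)) _ (x := @ledge F E) (y := @lghost F E)).
- exact: enum_uniq.
- by rewrite (lvert_CK2 F rv) big_enum.
- exact: lghost_edge.
Qed.

End K0Generators.

Lemma ck_family_exists (F : fieldType) (E : graph) (S : algType F) (p : vert E -> S)
    (pM : forall v u, p v * p u = if v == u then p v else 0)
    (pp : forall v, p v * p v = p v) :
    (forall v, is_reg v -> V_class (idem1 (pp v)) =
       \sum_(e <- enum [pred e : edge E | source e == v]) V_class (idem1 (pp (range e)))) ->
  exists X : CKfamily E S, ck_vert X = p.
Proof.
move=> pV; pose out (v : vert E) := enum [pred e : edge E | source e == v].
have outP v e : (e \in out v) = (source e == v) by rewrite mem_enum.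
have /boolp.choice[xy xyP] v : exists xy : (edge E -> S) * (edge E -> S), is_reg v ->
    [/\ {in out v &, forall e f, xy.2 e * xy.1 f = if e == f then p (range e) else 0},
        {in out v, forall e, p v * xy.1 e = xy.1 e /\ xy.1 e * p (range e) = xy.1 e},
        {in out v, forall e, p (range e) * xy.2 e = xy.2 e /\ xy.2 e * p v = xy.2 e}
      & p v = \sum_(e <- out v) xy.1 e * xy.2 e].
  case: (boolP (is_reg v)) => [rv|_]; last by exists (fun=> 0, fun=> 0).
  (* With zero as the remaining class, the leftover idempotent [p'] vanishes and [p v] is exactly
     the sum required at a regular vertex. *)
  have [|x [y [p' [pp' [yx px qy p'E p'0]]]]] := V_class_split_seq (pp := pp v)
    (f := idem0 S) (qq := fun e => pp (range e)) (enum_uniq [pred e : edge E | source e == v]).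
    by rewrite addr0; apply: pV.
  exists (x, y) => _; split=> //=; apply/eqP; rewrite -subr_eq0 -p'E; apply/eqP.
  by move/V_class_eq0: p'0 => /matrixP/(_ 0 0); rewrite !mxE eqxx.
pose x e := (xy (source e)).1 e; pose y e := (xy (source e)).2 e.
have so e : e \in out (source e) by rewrite outP.
have xP e := xyP _ (source_reg_subproof e).
have px e : p (source e) * x e = x e by have [_ /(_ _ (so e))[]] := xP e.
have xq e : x e * p (range e) = x e by have [_ /(_ _ (so e))[]] := xP e.
have qy e : p (range e) * y e = y e by have [_ _ /(_ _ (so e))[]] := xP e.
have yp e : y e * p (source e) = y e by have [_ _ /(_ _ (so e))[]] := xP e.
have yx e f : y e * x f = if e == f then p (range e) else 0.
  have [ef|nef] := eqVneq (source e) (source f).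
    have [h _ _ _] := xP e; rewrite -(h e f) ?outP ?ef //.
    by rewrite /x /y ef.
  rewrite -yp -px mulrA -(mulrA (y e)) pM (negPf nef) mulr0 mul0r.
  by case: eqP => // ef; rewrite ef eqxx in nef.
have pE v : is_reg v -> p v = \sum_(e | source e == v) x e * y e.
  move=> rv; have [_ _ _ ->] := xyP v rv; rewrite big_enum.
  by apply: eq_bigr => e /eqP ev; rewrite /x /y ev.
by exists (CKFamily pM px xq qy yp yx pE).
Qed.

Lemma K0_map_ck (F : fieldType) (E : graph) (S : algType F) (X : CKfamily E S) v
    (pp : ck_vert X v * ck_vert X v = ck_vert X v) :
  K0_map (ck_hom X) (K0_class (idem1 (lvert_idem F v))) = K0_class (idem1 pp).
Proof.
rewrite K0_map_class /K0_class; congr (gc_class (_, _)); apply: V_class_irr => /=.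
by apply/matrixP => i j; rewrite !ord1 !mxE eqxx !mulr1n ck_mapE.
Qed.

Lemma gamma_basis (F : fieldType) (E : graph) (I : finType) (b : zbasis I (kerIAt E))
    (W : forall i : I, Wchoice F (b i)) i :
  gamma W (b i) = Uclass (W i).
Proof.
have bi : \sum_j b j *~ (j == i)%:Z = b i.
  by rewrite (bigD1 i) //= eqxx big1 ?addr0 // => j /negPf ->.
rewrite /gamma (bigD1 i) //= -[X in zb_coord b X i]bi zb_vecK eqxx big1 ?addr0 // => j ji.
by rewrite -[X in zb_coord b X j]bi zb_vecK (negPf ji).
Qed.

(** One chosen edge at each regular vertex carries the whole value [c v] and the others carry 0;
    this suffices because y_e depends only on the source of e. *)
Lemma sum_reg_edges (E : graph) (A : zmodType) (c : reg E -> A) (x : kerIAt E) :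
  \sum_e (if [pick f | source f == source e] == Some e then c (source_reg e) else 0)
           *~ ycoef x e = \sum_v c v *~ (x : {ffun _ -> _}) v.
Proof.
rewrite (partition_big (@source_reg E) predT) //=; apply: eq_bigr => v _.
have [e0 e0v pe0] : exists2 e0, source e0 = val v &
    [pick f | source f == val v] = Some e0.
  case: pickP => [e0 /eqP|no]; first by exists e0.
  by case: v no => v /= /existsP[e ev] /(_ e); rewrite ev.
have e0r : source_reg e0 = v by apply: val_inj.
rewrite (bigD1 e0) /=; last by rewrite e0r.
rewrite e0v pe0 eqxx /ycoef e0r big1 ?addr0 // => e /andP[/eqP ev ee0].
have sev : source e = val v by rewrite -ev.
by rewrite sev pe0 ifN ?mul0rz //; apply: contra ee0 => /eqP[->].
Qed.

Section Lifting.
Variables (F : fieldType) (E : graph) (S : algType F).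
Local Notation L := (leavitt F E).
Hypothesis pisS : purely_infinite_simple S.

(** The proposition [unital] lets a single construction serve both halves of the theorem. *)
Lemma K0_lift (xi0 : {additive K0 L -> K0 S}) (unital : Prop) :
    (1 : L) <> 0 -> (unital -> xi0 (K0_unit L) = K0_unit S) ->
  exists X : CKfamily E S, [/\ forall v, ck_vert X v <> 0,
    forall u, K0_map (ck_hom X) u = xi0 u & unital -> ck_hom X 1 = 1].
Proof.
move=> L10 un; have [v0 _] : exists v0 : vert E, True.
  apply: contrapT => nov; apply: L10; rewrite [1]/(lone F E) big1 // => v _.
  by case: nov; exists v.
have /boolp.choice[q qP] v : exists q : S, exists (qq : q * q = q), q <> 0 /\
    xi0 (K0_class (idem1 (lvert_idem F v))) = K0_class (idem1 qq).
  exact: pis_K0_surj.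
have qq v : q v * q v = q v by have [] := qP v.
have q0 v : q v <> 0 by have [? []] := qP v.
have qK v : xi0 (K0_class (idem1 (lvert_idem F v))) = K0_class (idem1 (qq v)).
  by have [h [_ ->]] := qP v; congr K0_class; congr idem1; apply: eq_irrelevance.
have Vne (r : S) rr : r <> 0 -> V_class (@idem1 _ r rr) <> 0.
  by move=> r0 /V_class_eq0/matrixP/(_ 0 0); rewrite !mxE eqxx.
have one0 : (1 : S) <> 0 by apply/eqP/oner_neq0.
pose Vq v := V_class (idem1 (qq v)).
have sumN (T : eqType) (s : seq T) (f : T -> vert E) : s != [::] -> \sum_(t <- s) Vq (f t) <> 0.
  by case: s => // t s _; rewrite big_cons => /V_conical; apply: Vne.
have K0sum (T : eqType) (s : seq T) (f : T -> vert E) :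
    \sum_(t <- s) K0_class (idem1 (qq (f t))) = gc_class (\sum_(t <- s) Vq (f t), 0).
  elim: s => [|t s IH]; first by rewrite !big_nil.
  by rewrite !big_cons IH /K0_class -gc_classD /= addr0.
(* Room for all vertices below 1: absorption leaves some remainder, while in the unital case
   cancellation leaves none. Cancellation requires a nonzero sum, hence the vertex [v0]. *)
have [f [fE fun0]] : exists f : idem S, V_class (idem1 (mulr1 (1 : S))) =
    \sum_(v <- enum (vert E)) Vq v + V_class f /\ (unital -> V_class f = 0).
  have [u|nu] := pselect unital; last first.
    have [c c0 cE] := pis_V_absorbing pisS (\sum_(v <- enum (vert E)) Vq v)
      (Vne _ (mulr1 1) one0).
    by have [f fE] := V_surj c; exists f; rewrite -fE.
  exists (idem0 S); split=> //; rewrite addr0; apply: (pis_V_cancel pisS); first exact: Vne.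
    by apply: sumN; rewrite -size_eq0 -cardE; apply/eqP => /card0_eq/(_ v0).
  rewrite -K0sum; have := un u; rewrite K0_unit_leavitt raddf_sum /=.
  under eq_bigr do rewrite qK.
  move=> ->; rewrite /K0_unit /K0_class; congr (gc_class (_, _)).
  exact: V_class_irr.
have [x [y [p' [pp' [yx px _ p'E p'f]]]]] := V_class_split_seq (qq := qq) (enum_uniq _) fE.
(* The [q v] need not be orthogonal; the [p v] are orthogonal copies of them. *)
pose p v := x v * y v.
have ev v : v \in enum (vert E) by rewrite mem_enum.
have xq v : x v * q v = x v by have [] := px _ (ev v).
have yx' v w : y v * x w = if v == w then q v else 0 by apply: yx.
have pM v w : p v * p w = if v == w then p v else 0.
  rewrite /p mulrA -(mulrA (x v)) yx'; case: eqP => [<-|_]; first by rewrite xq.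
  by rewrite mulr0 mul0r.
have pp v : p v * p v = p v by rewrite pM eqxx.
have pV v : V_class (idem1 (pp v)) = Vq v.
  apply: (V_class_mvn (a := (x v)%:M) (b := (y v)%:M)); rewrite -scalar_mxM //.
  by rewrite yx' eqxx.
have [v rv|X XE] := ck_family_exists pM (pp := pp).
  rewrite pV; under eq_bigr do rewrite pV.
  (* The relation at a regular vertex holds in K_0 and descends to V(S), its right side being
     nonzero because [v] emits an edge. *)
  apply: (pis_V_cancel pisS); first exact: Vne.
    apply: sumN; apply: contraTneq rv => s0; apply/existsP => -[e se].
    by have := mem_enum [pred e : edge E | source e == v] e; rewrite s0 inE se.
  rewrite -K0sum -/(K0_class (idem1 (qq v))) -qK K0_leavitt_reg // raddf_sum.
  by apply: eq_bigr => e _; rewrite qK.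
exists X; split.
- move=> v; rewrite XE /p => p0; apply: (q0 v).
  have qE : q v = y v * x v by rewrite yx' eqxx.
  by rewrite -[q v]qq qE mulrA -(mulrA (y v)) p0 mulr0 mul0r.
- apply: K0_leavitt_ext => v; have pp1 : ck_vert X v * ck_vert X v = ck_vert X v.
    by rewrite XE.
  apply: etrans (K0_map_ck pp1) _; rewrite qK /K0_class; congr (gc_class (_, _)); rewrite -/(Vq v) -pV.
  by apply: V_class_irr; rewrite /= XE.
move=> u; rewrite ck_hom1; apply/esym/eqP; rewrite -subr_eq0; apply/eqP.
have := p'f; rewrite (fun0 u) => /V_class_eq0/matrixP/(_ 0 0).
rewrite !mxE eqxx mulr1n p'E => h; rewrite -[RHS]h; congr (_ - _).
by rewrite [RHS]big_enum XE.
Qed.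

Lemma K1_lift (X : CKfamily E S) (I : finType) (b : zbasis I (kerIAt E))
    (W : forall i : I, Wchoice F (b i)) (xi1 : {additive kerIAt E -> K1 S}) :
    (forall v, ck_vert X v <> 0) ->
  exists2 Y : CKfamily E S, ck_vert Y = ck_vert X &
    forall x, K1_map (ck_hom Y) (gamma W x) = xi1 x.
Proof.
(* [h] is the defect of the first homomorphism, which the twist has to add. *)
move=> X0; pose h x := xi1 x - K1_map (ck_hom X) (gamma W x).
have hB : zmod_morphism h.
  by move=> x y; rewrite /h !raddfB /= addrACA.
pose hA : {additive kerIAt E -> K1 S} :=
  HB.pack h (GRing.isZmodMorphism.Build _ _ h hB).
have [c cP] := kerIAt_hom_extend hA.
pose p e := ck_edge X e * ck_ghost X e.
(* The range projection is equivalent to the vertex at the range of [e], so its corner contains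
   units of every class. *)
have p0 e : p e <> 0.
  rewrite /p => pe; apply: (X0 (range e)).
  have yx : ck_ghost X e * ck_edge X e = ck_vert X (range e).
    by rewrite ck_ghost_edge eqxx.
  have := ck_vertM X (range e) (range e); rewrite eqxx => <-.
  by rewrite -yx mulrA -(mulrA (ck_ghost X e)) pe mulr0 mul0r.
pose C e := if [pick f | source f == source e] == Some e then c (source_reg e) else 0.
have /boolp.choice[z zP] e : exists z : S * S,
    [/\ z.1 * (1 - p e) = 1 - p e, (1 - p e) * z.1 = 1 - p e
      & exists k k', K1_class (@GLElt S 1 z.1%:M z.2%:M k k') = C e].
  have [u [u' [k [k' [up pu uC]]]]] := pis_K1_surj (C e) pisS (ck_proj_idem X e) (p0 e).
  by exists (u, u'); split=> //; exists k, k'.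
pose w e := (z e).1; pose w' e := (z e).2.
have w_pc e : w e * (1 - p e) = 1 - p e by have [] := zP e.
have pc_w e : (1 - p e) * w e = 1 - p e by have [] := zP e.
have k e : (w e)%:M *m (w' e)%:M = 1%:M :> 'M_1 by have [_ _ [? _]] := zP e.
have k' e : (w' e)%:M *m (w e)%:M = 1%:M :> 'M_1 by have [_ _ [? [? _]]] := zP e.
have kC e : K1_class (GLElt (k e) (k' e)) = C e.
  by have [_ _ [? [? <-]]] := zP e; apply: K1_class_irr.
have sI : injective (@scalar_mx S 1).
  by move=> a a' /matrixP/(_ 0 0); rewrite !mxE eqxx !mulr1n.
have ww' e : w e * w' e = 1 by apply: sI; rewrite scalar_mxM k.
have w'w e : w' e * w e = 1 by apply: sI; rewrite scalar_mxM k'.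
have [Y [Yv Ye Yg]] := twist_family ww' w'w w_pc pc_w.
exists Y => //.
have projE e : ck_hom X (ledge F e * lghost F e) = p e.
  by rewrite nuhomM ck_hom_edge ck_hom_ghost.
have UE i : K1_map (ck_hom Y) (Uclass (W i)) = xi1 (b i).
  rewrite (@twist_Uclass F E S (ck_hom X) (ck_hom Y) w w' _ _ _ _ _ k k').
  - under eq_bigr do rewrite kC.
    rewrite sum_reg_edges -cP /= /h gamma_basis addrC subrK.
    by [].
  - exact: ck_homZ.
  - exact: ck_homZ.
  - by move=> v; rewrite !ck_hom_vert Yv.
  - by move=> e; rewrite !ck_hom_edge Ye.
  - by move=> e; rewrite !ck_hom_ghost Yg.
  - by move=> e; rewrite projE.
  - by move=> e; rewrite projE.
move=> x; rewrite /gamma raddf_sum /= -[in RHS](zb_coordK b x) raddf_sum.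
by apply: eq_bigr => i _; rewrite !raddfMz /= UE.
Qed.

End Lifting.

Theorem theorem4p16 (F : fieldType) (E : graph) (S : algType F)
    (simpleL : simple_ring (leavitt F E))
    (pisS : purely_infinite_simple S)
    (K1regS : K1_regular S)
    (I : finType) (b : zbasis I (kerIAt E))
    (W : forall i : I, Wchoice F (b i))
    (xi0 : {additive K0 (leavitt F E) -> K0 S})
    (xi1 : {additive kerIAt E -> K1 S}) :
  (exists phi : nuhom (leavitt F E) S,
     [/\ scalable phi,
         (exists a, phi a <> 0),
         (forall u, K0_map phi u = xi0 u)
       & (forall x, K1_map phi (gamma W x) = xi1 x)]) /\
  (xi0 (K0_unit (leavitt F E)) = K0_unit S ->
   exists phi : nuhom (leavitt F E) S,
     [/\ scalable phi,
         phi 1 = 1,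
         (exists a, phi a <> 0),
         (forall u, K0_map phi u = xi0 u)
       & (forall x, K1_map phi (gamma W x) = xi1 x)]).
Proof.
have [phi [phiZ phi0 phiK0 phiK1 phi1]] : exists phi : nuhom (leavitt F E) S,
    [/\ scalable phi, exists a, phi a <> 0, forall u, K0_map phi u = xi0 u,
        forall x, K1_map phi (gamma W x) = xi1 x
      & xi0 (K0_unit (leavitt F E)) = K0_unit S -> phi 1 = 1].
  have [X [X0 XK0 X1]] := K0_lift pisS simpleL.1
    (fun un : xi0 (K0_unit (leavitt F E)) = K0_unit S => un).
  have [Y YX YK1] := K1_lift pisS W xi1 X0.
  exists (ck_hom Y); split=> //; first exact: ck_homZ.
  - apply: contrapT => Y0; apply: simpleL.1; rewrite [1]/(lone F E) big1 // => v _.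
    by case: Y0; exists (lvert F v); rewrite ck_hom_vert YX.
  (* The twist has not moved the images of the vertices, and these determine the map on K_0. *)
  - move=> u; rewrite -XK0; apply: K0_leavitt_ext => v.
    have Xv : ck_vert X v * ck_vert X v = ck_vert X v by rewrite ck_vertM eqxx.
    have Yv : ck_vert Y v * ck_vert Y v = ck_vert Y v by rewrite ck_vertM eqxx.
    apply: etrans (K0_map_ck Yv) _; apply: esym; apply: etrans (K0_map_ck Xv) _.
    by rewrite /K0_class; congr (gc_class (_, _)); apply: V_class_irr; rewrite /= YX.
  by move/X1; rewrite !ck_hom1 YX.
by split=> [|un]; exists phi; split=> //; apply: phi1.
Qed.
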